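(* Suppose that $L$ satisfies Assumption 1 and that $F,G$ satisfy Assumptions 2 and 3 (all stated in the context). Then, for the given initial datum $(m_{x,0}(u))_{x\in\Sigma,u\in\mathcal U}$, the Mean Field Game equations $$ \begin{aligned} -\frac{d}{dt}V(t,x,u) &= -H(x,\nabla V(t,x,u),u)+F(x,m(t),u),\\ V(T,x,u) &= G(x,m(T),u),\\ \frac{d}{dt}m_x(t,u) &= \sum_{y\in\Sigma} m_y(t,u)\,a^*_x(y,\nabla V(t,y,u),u),\\ m_x(0,u) &= m_{x,0}(u), \end{aligned} $$ for $t\in[0,T]$, $x\in\Sigma$, $u\in\mathcal U$, admit a unique solution $(V,m)$.
   Context: Setting. $T>0$ is fixed; $\Sigma=\{1,\dots,d\}$ is a finite set; $\mathcal U$ is a compact metric space; $\mu$ is a Borel probability measure on $\mathcal U$. $P(\mathcal U\times\Sigma)$ is the set of probability measures on $\mathcal U\times\Sigma$ with the topology of weak convergence, and $\mathcal P_\mu\subset P(\mathcal U\times\Sigma)$ is the subset of those measures $m$ with first marginal $\mu$, i.e. $m(A\times\Sigma)=\mu(A)$ for all Borel $A\subseteq\mathcal U$. An element $m\in\mathcal P_\mu$ is written $m(x,du)=m_x(u)\mu(du)$, where $(m_x(u))_{x\in\Sigma}$ is a regular version of the conditional distribution on $\Sigma$ given $u$. Data: functions $L:\Sigma\times[0,+\infty)^\Sigma\times\mathcal U\to\mathbb R$ and $F,G:\Sigma\times P(\mathcal U\times\Sigma)\times\mathcal U\to\mathbb R$, and an initial datum $m_{x,0}(u)$, measurable in $u$,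 with $(m_{x,0}(u))_{x\in\Sigma}$ a probability vector for every $u\in\mathcal U$. Notation. For $f:\Sigma\to\mathbb R$, $\nabla f(x)=(f(y)-f(x))_{y\in\Sigma}\in\mathbb R^\Sigma$; for $V(t,x,u)$, $\nabla V(t,x,u)=(V(t,y,u)-V(t,x,u))_{y\in\Sigma}$. The Hamiltonian $H:\Sigma\times\mathbb R^\Sigma\times\mathcal U\to\mathbb R$ is $$H(x,p,u)=-\inf_{a\in[0,+\infty)^\Sigma}\Big[\sum_{y\neq x}a_yp_y+L(x,a,u)\Big],$$ and $a^*(x,p,u)\in[0,+\infty)^\Sigma$ denotes the minimizer (unique under Assumption 1). In the equation for $m_x$, $a^*_x(y,\cdot,u)$ is, for $y\neq x$, the $x$-component of the minimizer $a^*(y,\cdot,u)$, i.e. the jump rate from $y$ to $x$, while the diagonal term $y=x$ is understood by the convention $a^*_x(x,\cdot,u)=-\sum_{y\neq x}a^*_y(x,\cdot,u)$; that is, the equation is the forward Kolmogorov equation $$\frac{d}{dt}m_x(t,u)=\sum_{y\ne x}\big[m_y(t,u)a^*_x(y,\nabla V(t,y,u),u)-m_x(t,u)a^*_y(x,\nabla V(t,x,u),u)\big].$$ A solution $(V,m)$ consists of a function $V:[0,T]\times\Sigma\times\mathcal U\to\mathbb R$ and a flow $m:[0,T]\to\mathcal P_\mu$, $m(t)(x,du)=m_x(t,u)\mu(du)$ with $(m_x(t,u))_x$ probability vectors measurable in $u$, such that the equations hold for every $u\in\mathcal U$. Assumption 1. $L$ is differentiable in its second variable with differential $\nabla_aL(x,a,u)$;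 both $L(x,a,u)$ and $\nabla_aL(x,a,u)$ are continuous in $u$; and there is $\gamma>0$ such that for all $x\in\Sigma$, $a,a'\in[0,+\infty)^\Sigma$, $u\in\mathcal U$, $$L(x,a',u)\ge L(x,a,u)+\nabla_aL(x,a,u)\cdot(a'-a)+\gamma\|a'-a\|^2 .$$ Assumption 2. $F$ and $G$ are bounded and, for each $x\in\Sigma$, are continuous in $(m,u)$ on $\mathcal P_\mu\times\mathcal U$. Assumption 3 (monotonicity). For $Q=F$ and for $Q=G$, for every $m,\tilde m\in\mathcal P_\mu$, $$\sum_{x\in\Sigma}\int_{\mathcal U}\big[Q(x,m,u)-Q(x,\tilde m,u)\big]\big(m_x(u)-\tilde m_x(u)\big)\,\mu(du)\ge 0 .$$ *)

(* Defs.v *)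
From HB Require Import structures.
From mathcomp Require Import all_boot all_order all_algebra.
From mathcomp Require Import all_classical all_reals all_analysis.

Set Implicit Arguments.
Unset Strict Implicit.
Unset Printing Implicit Defensive.

Import Order.TTheory GRing.Theory Num.Theory.
Import numFieldNormedType.Exports.

Local Open Scope classical_set_scope.
Local Open Scope ring_scope.

(* Measurable types are pointed in the library; a space carrying a probability
   measure is nonempty, so asking for a base point loses no generality. *)
#[short(type="pmetricType")]
HB.structure Definition PointedMetric (K : numDomainType) :=
  {M of Metric K M & Pointed M}.

Definition borel (E : ptopologicalType) := g_sigma_algebraType (@open E).

Section weak_convergence.
Variables (R : realType) (E : ptopologicalType).

Definition bounded_continuous :=
  {phi : E -> R | continuous phi /\ exists C : R, forall z, `|phi z| <= C}.

Definition integrate_test (m : probability (borel E) R) :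
    prod_topology (fun _ : bounded_continuous => R) :=
  fun phi => \int[m]_z (sval phi) z.

(* Probability measures in the library are functions on all subsets of [borel E],
   with unconstrained values off the Borel sets. Two of them that agree on Borel
   sets are topologically indistinguishable here, so a map into R that is
   continuous on a set of such measures cannot tell them apart there. *)
Definition weak_prob : Type := initial_topology integrate_test.

End weak_convergence.

(* The state space {1, ..., d} of the mathematics is ['I_d.+1] here: it is never
   empty because it carries a probability vector. *)
Definition states (d : nat) : Type := discrete_topology 'I_d.+1.

HB.instance Definition _ (d : nat) := Uniform.on (states d).
HB.instance Definition _ (d : nat) := isPointed.Build (states d) ord0.

HB.instance Definition _ (A B : ptopologicalType) := Pointed.on (A * B)%type.

Section mean_field_game.
Variables (R : realType) (d : nat) (U : pmetricType R).

Local Notation Sigma := 'I_d.+1.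
Local Notation vec := 'rV[R]_d.+1.

Definition prob_US := weak_prob R (U * states d)%type.

Definition prob_vector (p : Sigma -> R) : Prop :=
  (forall x, 0 <= p x) /\ \sum_x p x = 1.

Definition Pmu (mu : probability (borel U) R) : set prob_US :=
  [set m : probability (borel (U * states d)%type) R |
    forall A : set (borel U), measurable A -> m (A `*` [set: states d]) = mu A].

(* m(x, du) = k_x(u) mu(du), k a regular version of the conditional law given u *)
Definition disintegration (mu : probability (borel U) R)
    (m : probability (borel (U * states d)%type) R) (k : Sigma -> U -> R) : Prop :=
  [/\ forall x, measurable_fun [set: borel U] (k x : borel U -> R),
      forall u, prob_vector (k ^~ u) &
      forall x (A : set (borel U)), measurable A ->
        m (A `*` [set (x : states d)]) = (\int[mu]_(u in A) (k x u)%:E)%E].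

Definition orthant : set vec := [set a | forall y, 0 <= a 0 y].

Definition dotv (a b : vec) : R := \sum_y a 0 y * b 0 y.

(* Differentiability relative to the orthant, one-sided at its boundary. The
   gradient is unique since the orthant has nonempty interior. *)
Definition is_gradient (f : vec -> R) (a g : vec) : Prop :=
  (f a' - f a - dotv g (a' - a)) / `|a' - a|
    @[a' --> within orthant a^'] --> (0 : R).

(* [L], a function on Sigma * [0,+oo[^Sigma * U, is represented by a total
   function whose values off the orthant are never used. *)
Definition strongly_convex_cost (L : Sigma -> vec -> U -> R) : Prop :=
  exists DL : Sigma -> vec -> U -> vec,
  [/\ forall x a u, orthant a -> is_gradient (fun b => L x b u) a (DL x a u),
      forall x a, orthant a -> continuous (L x a) /\ continuous (DL x a) &
      exists2 gamma : R, 0 < gamma &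
        forall x a a' u, orthant a -> orthant a' ->
          L x a u + dotv (DL x a u) (a' - a) + gamma * dotv (a' - a) (a' - a)
            <= L x a' u].

Definition bounded_continuous_coupling (mu : probability (borel U) R)
    (Q : Sigma -> prob_US -> U -> R) : Prop :=
  (exists C : R, forall x m u, `|Q x m u| <= C) /\
  forall x, {within Pmu mu `*` [set: U],
    continuous (fun z : prob_US * U => Q x z.1 z.2)}.

Definition monotone_coupling (mu : probability (borel U) R)
    (Q : Sigma -> prob_US -> U -> R) : Prop :=
  forall (m m' : prob_US) (k k' : Sigma -> U -> R),
    Pmu mu m -> Pmu mu m' ->
    disintegration mu m k -> disintegration mu m' k' ->
    0 <= \sum_x \int[mu]_u ((Q x m u - Q x m' u) * (k x u - k' x u)).

Section control.
Variable L : Sigma -> vec -> U -> R.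

Definition cost (x : Sigma) (p : vec) (u : U) (a : vec) : R :=
  \sum_(y | y != x) a 0 y * p 0 y + L x a u.

(* When [strongly_convex_cost L] holds, the infimum is that of a nonempty set
   bounded below and the minimizer exists and is unique, so the default values
   of [inf] and [xget] play no role. *)
Definition hamiltonian (x : Sigma) (p : vec) (u : U) : R :=
  - inf [set cost x p u a | a in orthant].

Definition optimal_control (x : Sigma) (p : vec) (u : U) : vec :=
  xget 0 [set a | orthant a /\
    forall b, orthant b -> cost x p u a <= cost x p u b].

Definition grad (f : Sigma -> R) (x : Sigma) : vec := \row_y (f y - f x).

(* a^*_x(y, grad v(y), u), the jump rate from y to x, with the diagonal term
   given by the usual convention for generators *)
Definition jump_rate (v : Sigma -> R) (u : U) (y x : Sigma) : R :=
  if y == x then - \sum_(z | z != x) optimal_control x (grad v x) u 0 z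
  else optimal_control y (grad v y) u 0 x.

(* derivative relative to [0, T], one-sided at the end points *)
Definition has_derivative (T : R) (f : R -> R) (t l : R) : Prop :=
  (f s - f t) / (s - t) @[s --> within `[0, T] t^'] --> l.

Variables (mu : probability (borel U) R) (T : R).
Variables (F G : Sigma -> prob_US -> U -> R) (m0 : Sigma -> U -> R).

(* [M t] is the measure m(t) and [m t x u] its conditional probabilities
   m_x(t, u). Functions of time are total; only their values on [0, T] matter. *)
Definition mfg_solution (V : R -> Sigma -> U -> R) (M : R -> prob_US)
    (m : R -> Sigma -> U -> R) : Prop :=
  [/\ forall t, t \in `[0, T] -> Pmu mu (M t) /\ disintegration mu (M t) (m t),
      forall t x u, t \in `[0, T] ->
        exists2 dV, has_derivative T (fun s => V s x u) t dV &
          - dV = - hamiltonian x (grad (fun y => V t y u) x) u + F x (M t) u,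
      forall x u, V T x u = G x (M T) u,
      forall t x u, t \in `[0, T] ->
        has_derivative T (fun s => m s x u) t
          (\sum_y m t y u * jump_rate (fun z => V t z u) u y x) &
      forall x u, m 0 x u = m0 x u].

End control.

End mean_field_game.

(* Main.v *)
From HB Require Import structures.
Require Import Defs.
From mathcomp Require Import all_boot all_order all_algebra.
From mathcomp Require Import all_classical all_reals all_analysis.
From mathcomp Require Import measurable_realfun ring lra.

Set Implicit Arguments.
Unset Strict Implicit.
Unset Printing Implicit Defensive.

Import Order.TTheory GRing.Theory Num.Theory.
Import numFieldNormedType.Exports.

Local Open Scope classical_set_scope.
Local Open Scope ring_scope.

(** Why the system has exactly one solution.

    At a fixed [u], the value [V] answering given data [(f, g)] solves the
    Hamilton-Jacobi equation [hjb], and the flow [m] steered by [V] solves the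
    Kolmogorov equation [kolmogorov]. Both are finite systems of ordinary
    differential equations, solved by Picard iteration ([picard]); the quadratic
    growth of the Hamiltonian is dealt with by a truncation of the momentum, which
    a maximum principle shows to be inactive ([hjb_clip_bound], [hjb_exists]).

    Everything rests on a weak duality inequality, [flow_duality]. The flow [m]
    optimal for [(f, g)] is suboptimal for other data [(f', g')]; by strong
    convexity of the cost, its excess cost dominates the squared distance, at every
    time, to the flow [m'] optimal for [(f', g')]. For two solutions of the system,
    the inequality taken both ways round and integrated in [u] bounds the squared
    distance of the flows by the opposite of the quantity that monotonicity makes
    nonnegative. Hence the flows agree, then the data, then the values
    ([equilibrium_unique]).

    Existence uses the same inequality instead of a fixed point theorem. Let the
    answer [m_n] be optimal for the average of the data [F(., M_i, .)],
    [G(., M_i, .)] created by the earlier answers, [i < n]. The average moves by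
    [O(1 / n)] at each step, and the inequality, being quadratic in the flows, turns
    this into a gain of only [O(1 / n)] from one answer to the next against the newest
    datum ([leader_regret]). So the leaders pay on average hardly more than the best
    answer in hindsight. Comparing the optimal costs in hindsight at two times [N]
    and [K] ([follow_the_leader]), the costs of the answers against one another
    recombine into the expressions that monotonicity signs once integrated in [u].
    What remains says that [m_N] and [m_K] are close in mean square to most of the
    earlier answers, hence to each other, uniformly in time ([leaders_cauchy]).

    The flows of measures [M_n] therefore converge in total variation
    ([tv_limit]). The couplings, continuous for the weak topology, converge along
    them ([coupling_tvclose]), so by Cesaro's lemma the averaged data converge to the
    data of the limit flow. The answer to these limit data is the limit of the
    answers [m_n] by continuous dependence ([kolmogorov_uniform_cvg]), and
    thus disintegrates the limit flow: it is an equilibrium ([equilibrium_exists]).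

    Measurability in [u] comes from continuity: values depend continuously on [u],
    and flows are combinations, with coefficients measurable in [u], of the flows
    issued from point masses ([best_response]). Time integrals are exchanged with
    integrals in [u] through Riemann sums ([mean_prim]). *)

(** * Derivatives on a closed interval *)

Section calculus.
Context {R : realType}.
Implicit Types (T t s l : R) (f g : R -> R).

Definition clamp (T t : R) : R := Num.max 0 (Num.min t T).

Lemma clamp_itv T t : 0 <= T -> clamp T t \in `[0, T].
Proof. by move=> T0; rewrite in_itv /= /clamp le_max lexx /= ge_max T0 ge_min lexx orbT. Qed.

Lemma clamp_id T t : t \in `[0, T] -> clamp T t = t.
Proof.
by rewrite in_itv /= => /andP[t0 tT]; rewrite /clamp (min_idPl tT) (max_idPr t0).
Qed.

Lemma clamp_continuous T : continuous (clamp T).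
Proof.
move=> t; apply: (@continuous_max _ _ (fun _ => 0) (fun t => Num.min t T)); first exact: cvg_cst.
by apply: (@continuous_min _ _ id (fun _ => T)); [exact: cvg_id|exact: cvg_cst].
Qed.

(** Continuity on [[0, T]], phrased on the whole line so that two-sided calculus
    applies at the end points. *)
Definition icontinuous T f := continuous (f \o clamp T).

(** The product form has no division and holds at [s = t] as well, so that proofs
    need not exclude that point. *)
Lemma has_derivativeP T f t l :
  has_derivative T f t l <->
  forall e : R, 0 < e -> exists2 r : R, 0 < r & forall s, s \in `[0, T] -> `|s - t| < r ->
    `|f s - f t - l * (s - t)| <= e * `|s - t|.
Proof.
split.
- move=> /cvgrPdist_le H e e0.
  have /nbhs_ballP[r /= r0 Hr] := H e e0.
  exists r => // s sT st.
  have [->|neq] := eqVneq s t; first by rewrite !subrr mulr0 subr0 normr0 mulr0.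
  have := Hr s _ neq sT; rewrite -ball_normE /= distrC => /(_ st) /= {}Hr.
  have st0 : s - t != 0 by rewrite subr_eq0.
  rewrite distrC in Hr.
  have -> : f s - f t - l * (s - t) = ((f s - f t) / (s - t) - l) * (s - t) by field.
  by rewrite normrM ler_wpM2r.
- move=> H; apply/cvgrPdist_le => e e0.
  have [r r0 Hr] := H e e0.
  apply/nbhs_ballP; exists r => //= s; rewrite -ball_normE /= distrC => st neq sT.
  have st0 : s - t != 0 by rewrite subr_eq0.
  have := Hr s sT st; rewrite [X in _ -> X <= _]distrC.
  have -> : f s - f t - l * (s - t) = ((f s - f t) / (s - t) - l) * (s - t) by field.
  by rewrite normrM ler_pM2r// normr_gt0.
Qed.

Lemma has_derivative_continuous T f t l : t \in `[0, T] ->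
  has_derivative T f t l -> {for t, continuous (f \o clamp T)}.
Proof.
move=> tT /has_derivativeP H; apply/cvgrPdist_le => /= e e0.
have [r r0 Hr] := H 1 ltr01.
have T0 : 0 <= T by move: tT; rewrite in_itv /= => /andP[]; exact: le_trans.
have := @clamp_continuous T t; rewrite /continuous_at (clamp_id tT) => /cvgrPdist_lt Hc.
have q0 : 0 < Num.min r (e / (1 + `|l|)).
  by rewrite lt_min r0 divr_gt0// ltr_wpDr.
near=> s.
have : `|t - clamp T s| < Num.min r (e / (1 + `|l|)) by near: s; exact: Hc.
rewrite lt_min distrC => /andP[s1 s2].
have := Hr _ (clamp_itv s T0) s1; rewrite mul1r => Hs.
rewrite distrC.
have -> : f (clamp T s) - f t = f (clamp T s) - f t - l * (clamp T s - t) + l * (clamp T s - t) by ring.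
apply: (le_trans (ler_normD _ _)); rewrite normrM.
apply: (@le_trans _ _ ((1 + `|l|) * `|clamp T s - t|)).
  by rewrite mulrDl mul1r lerD2r.
by rewrite mulrC -ler_pdivlMr ?ltW// ltr_wpDr.
Unshelve. all: by end_near. Qed.

Lemma has_derivative_icontinuous T f : 0 < T ->
  (forall t, t \in `[0, T] -> exists l, has_derivative T f t l) -> icontinuous T f.
Proof.
move=> T0 H t; have cT := clamp_itv t (ltW T0).
have [l /has_derivative_continuous -/(_ cT) h] := H _ cT.
have {}h : (f \o clamp T) x @[x --> clamp T t] --> f (clamp T (clamp T t)) := h.
rewrite (clamp_id cT) in h.
have := @cvg_comp _ _ _ (clamp T) (f \o clamp T) _ _ _ (@clamp_continuous T t) h.
suff -> : (f \o clamp T) \o clamp T = f \o clamp T by [].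
by apply/funext => s /=; rewrite (clamp_id (clamp_itv s (ltW T0))).
Qed.

Lemma is_derive_has_derivative T f t l : is_derive t 1 f l -> has_derivative T f t l.
Proof.
move=> [df dl]; apply/has_derivativeP => e e0.
have /cvgrPdist_le/(_ _ e0)/nbhs_ballP[r /= r0 Hr] : (fun h => h^-1 *: (f (h *: 1 + t) - f t)) @ 0^' --> l.
  by move: df; rewrite /derivable -dl.
exists r => // s sT st.
have [->|neq] := eqVneq s t; first by rewrite !subrr mulr0 subr0 normr0 mulr0.
have st0 : s - t != 0 by rewrite subr_eq0.
have := Hr (s - t) _ st0; rewrite -ball_normE /= sub0r normrN => /(_ st).
rewrite /GRing.scale /= mulr1 subrK [X in X <= _ -> _]distrC.
have -> : f s - f t - l * (s - t) = ((s - t)^-1 * (f s - f t) - l) * (s - t) by field.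
by move=> Hs; rewrite normrM ler_wpM2r.
Qed.

Lemma has_derivative_is_derive T f t l : t \in `]0, T[ ->
  has_derivative T f t l -> is_derive t 1 f l.
Proof.
rewrite in_itv /= => /andP[t0 tT] /has_derivativeP H.
have hc : (fun h => h^-1 *: (f (h *: 1 + t) - f t)) @ 0^' --> l.
  apply/cvgrPdist_le => e e0; have [r r0 Hr] := H e e0.
  pose q := Num.min r (Num.min t (T - t)).
  have q0 : 0 < q by rewrite !lt_min r0 t0 subr_gt0.
  apply/nbhs_ballP; exists q => //= h; rewrite -ball_normE /= sub0r normrN => hq h0.
  move: hq; rewrite /q !lt_min => /and3P[h1 h2 h3].
  have hT : h + t \in `[0, T].
    by rewrite in_itv /=; move: h2 h3; rewrite !ltr_norml => /andP[? ?] /andP[? ?]; lra.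
  have := Hr _ hT; rewrite addrK => /(_ h1).
  rewrite /GRing.scale /= mulr1 [X in _ -> X <= _]distrC.
  have -> : f (h + t) - f t - l * h = (h^-1 * (f (h + t) - f t) - l) * h by field.
  by rewrite normrM ler_pM2r// normr_gt0.
have E : 'D_1 f t = l by apply: cvg_lim.
apply: DeriveDef => //.
by apply/cvg_ex; exists l.
Qed.

Lemma has_derivative_ext T f g t l : t \in `[0, T] ->
  (forall s, s \in `[0, T] -> f s = g s) -> has_derivative T f t l -> has_derivative T g t l.
Proof.
move=> tT fg /has_derivativeP H; apply/has_derivativeP => e e0.
by have [r r0 Hr] := H e e0; exists r => // s sT; rewrite -!fg//; exact: Hr.
Qed.

Lemma has_derivative_eq T f t l l' : l = l' -> has_derivative T f t l -> has_derivative T f t l'.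
Proof. by move=> ->. Qed.

Lemma has_derivative_eq_ext T f g t l l' : t \in `[0, T] -> l = l' ->
  (forall s, s \in `[0, T] -> f s = g s) -> has_derivative T f t l -> has_derivative T g t l'.
Proof. by move=> tT ->; exact: has_derivative_ext. Qed.

Lemma has_derivative_cst T (c t : R) : has_derivative T (fun _ => c) t 0.
Proof. by apply/has_derivativeP => e e0; exists 1 => // s _ _; rewrite subrr mul0r subr0 normr0 mulr_ge0// ltW. Qed.

Lemma has_derivative_id T t : has_derivative T id t 1.
Proof. by apply/has_derivativeP => e e0; exists 1 => // s _ _; rewrite mul1r subrr normr0 mulr_ge0// ltW. Qed.

Lemma has_derivativeD T f g t l l' : has_derivative T f t l -> has_derivative T g t l' ->
  has_derivative T (fun s => f s + g s) t (l + l').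
Proof.
move=> /has_derivativeP F /has_derivativeP G; apply/has_derivativeP => e e0.
have e20 : 0 < e / 2 by lra.
have [r r0 Hr] := F _ e20; have [q q0 Hq] := G _ e20.
exists (Num.min r q); first by rewrite lt_min r0.
move=> s sT; rewrite lt_min => /andP[s1 s2].
have -> : f s + g s - (f t + g t) - (l + l') * (s - t) =
  (f s - f t - l * (s - t)) + (g s - g t - l' * (s - t)) by ring.
apply: (le_trans (ler_normD _ _)); rewrite [e]splitr mulrDl.
by apply: lerD; [exact: Hr|exact: Hq].
Qed.

(** Every chain rule used below is an instance of this one: the outer function
    only has to be approximated to second order at the value reached. *)
Lemma has_derivative_chain T f (phi : R -> R) t l c k : t \in `[0, T] -> 0 <= k ->
  (forall y, `|phi y - phi (f t) - c * (y - f t)| <= k * (y - f t) ^+ 2) ->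
  has_derivative T f t l -> has_derivative T (fun s => phi (f s)) t (c * l).
Proof.
move=> tT k0 Hphi Hf; have := has_derivative_continuous tT Hf.
move: Hf => /has_derivativeP Hf _; apply/has_derivativeP => e e0.
pose e1 := Num.min 1 (e / (1 + `|c| + k * (1 + `|l|) ^+ 2)).
have d0 : 0 < 1 + `|c| + k * (1 + `|l|) ^+ 2.
  by rewrite -addrA ltr_pwDl// addr_ge0// mulr_ge0// sqr_ge0.
have e10 : 0 < e1 by rewrite lt_min ltr01 divr_gt0.
have [r r0 Hr] := Hf e1 e10.
exists (Num.min r e1); first by rewrite lt_min r0.
move=> s sT; rewrite lt_min => /andP[s1 s2].
have A := Hr s sT s1; have B := Hphi (f s).
have e11 : e1 <= 1 by rewrite ge_min lexx.
have e1e : e1 * (1 + `|c| + k * (1 + `|l|) ^+ 2) <= e.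
  by rewrite -ler_pdivlMr// ge_min lexx orbT.
have C : `|f s - f t| <= (1 + `|l|) * `|s - t|.
  have -> : f s - f t = (f s - f t - l * (s - t)) + l * (s - t) by ring.
  apply: (le_trans (ler_normD _ _)); rewrite normrM mulrDl lerD2r.
  by apply: (le_trans A); rewrite ler_wpM2r.
have -> : phi (f s) - phi (f t) - c * l * (s - t) =
  (phi (f s) - phi (f t) - c * (f s - f t)) + c * (f s - f t - l * (s - t)) by ring.
apply: (le_trans (ler_normD _ _)).
have C2 : (f s - f t) ^+ 2 <= (1 + `|l|) ^+ 2 * (`|s - t| * e1).
  rewrite -real_normK ?num_real//.
  apply: (@le_trans _ _ (((1 + `|l|) * `|s - t|) ^+ 2)).
    by rewrite lerXn2r ?nnegrE ?mulr_ge0 ?addr_ge0.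
  rewrite exprMn ler_wpM2l ?sqr_ge0// expr2 ler_wpM2l//; exact: ltW.
rewrite normrM.
apply: (@le_trans _ _ (k * ((1 + `|l|) ^+ 2 * (`|s - t| * e1)) + `|c| * (e1 * `|s - t|))).
  by apply: lerD; [apply: (le_trans B); rewrite ler_wpM2l|rewrite ler_wpM2l].
apply: (@le_trans _ _ (e1 * (1 + `|c| + k * (1 + `|l|) ^+ 2) * `|s - t|)); last by rewrite ler_wpM2r.
have := normr_ge0 (s - t); move: e10; nra.
Qed.

Lemma has_derivativeZ T f t l (c : R) : t \in `[0, T] -> has_derivative T f t l ->
  has_derivative T (fun s => c * f s) t (c * l).
Proof.
move=> tT; apply: (@has_derivative_chain T f (fun y => c * y) t l c 0) => // y.
by rewrite mul0r mulrBr subrr normr0.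
Qed.

Lemma has_derivativeN T f t l : t \in `[0, T] -> has_derivative T f t l ->
  has_derivative T (fun s => - f s) t (- l).
Proof.
move=> tT /(has_derivativeZ (c := -1) tT); rewrite mulN1r.
by apply: has_derivative_ext => // s _; rewrite mulN1r.
Qed.

Lemma has_derivativeB T f g t l l' : t \in `[0, T] ->
  has_derivative T f t l -> has_derivative T g t l' ->
  has_derivative T (fun s => f s - g s) t (l - l').
Proof. by move=> tT F /(has_derivativeN tT) G; exact: has_derivativeD. Qed.

Lemma has_derivative_sqr T f t l : t \in `[0, T] -> has_derivative T f t l ->
  has_derivative T (fun s => f s ^+ 2) t (2 * f t * l).
Proof.
move=> tT; apply: (@has_derivative_chain T f (fun y => y ^+ 2) t l (2 * f t) 1) => // y.
have -> : y ^+ 2 - f t ^+ 2 - 2 * f t * (y - f t) = (y - f t) ^+ 2 by ring.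
by rewrite mul1r ger0_norm// sqr_ge0.
Qed.

(** By polarization, from the rule for squares. *)
Lemma has_derivativeM T f g t l l' : t \in `[0, T] ->
  has_derivative T f t l -> has_derivative T g t l' ->
  has_derivative T (fun s => f s * g s) t (l * g t + f t * l').
Proof.
move=> tT F G.
have S := has_derivative_sqr tT (has_derivativeD F G).
have D := has_derivative_sqr tT (has_derivativeB tT F G).
have := has_derivativeZ (c := 1 / 4) tT (has_derivativeB tT S D).
apply: has_derivative_eq_ext => //; first by field.
by move=> s _ /=; field.
Qed.

Lemma has_derivative_sum (I : finType) T (f : I -> R -> R) t (l : I -> R) :
  (forall i, has_derivative T (f i) t (l i)) ->
  has_derivative T (fun s => \sum_i f i s) t (\sum_i l i).
Proof.
move=> H.
have E (r : seq I) : has_derivative T (fun s => \sum_(i <- r) f i s) t (\sum_(i <- r) l i).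
  elim: r => [|i r IH].
    rewrite big_nil; under eq_fun do rewrite big_nil; exact: has_derivative_cst.
  rewrite big_cons; under eq_fun do rewrite big_cons; exact: has_derivativeD.
exact: E.
Qed.

Lemma has_derivative_rev T f t l : t \in `[0, T] -> has_derivative T f (T - t) l ->
  has_derivative T (fun s => f (T - s)) t (- l).
Proof.
move=> tT /has_derivativeP H; apply/has_derivativeP => e e0.
have [r r0 Hr] := H e e0; exists r => // s sT st.
have sT' : T - s \in `[0, T] by move: sT; rewrite !in_itv /= => /andP[? ?]; lra.
have E : T - s - (T - t) = - (s - t) by ring.
have := Hr _ sT'; rewrite E normrN => /(_ st).
by rewrite mulNr mulrN.
Qed.

Lemma has_derivative_expR T (c t : R) : t \in `[0, T] ->
  has_derivative T (fun s => expR (c * s)) t (c * expR (c * t)).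
Proof.
move=> tT; apply: is_derive_has_derivative.
have h : is_derive t 1 (fun s : R => c * s) c.
  by apply: is_derive_eq; rewrite /GRing.scale /= mulr1.
have := @is_derive1_comp _ (@expR R) (fun s => c * s) t _ _ _ h.
by rewrite /comp => /(_ _ (is_derive_expR _)); rewrite /GRing.scale /= mulrC.
Qed.

Lemma has_derivative_nondecreasing T f (df : R -> R) a b :
  (forall t, t \in `[0, T] -> has_derivative T f t (df t)) ->
  0 <= a -> a <= b -> b <= T -> (forall t, t \in `[a, b] -> 0 <= df t) -> f a <= f b.
Proof.
move=> H a0; rewrite le_eqVlt => /predU1P[->//|ab] bT dfp.
have T0 : 0 < T by lra.
have sub t : t \in `]a, b[ -> t \in `]0, T[.
  by rewrite !in_itv /= => /andP[? ?]; lra.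
have sub' t : t \in `]a, b[ -> t \in `[0, T] by rewrite !in_itv /= => /andP[? ?]; lra.
have ic : icontinuous T f by apply: has_derivative_icontinuous => // t /H ?; exists (df t).
have aT : a \in `[0, T] by rewrite in_itv /=; lra.
have bT' : b \in `[0, T] by rewrite in_itv /=; lra.
suff : (f \o clamp T) a <= (f \o clamp T) b by rewrite /= !clamp_id.
have D x : x \in `]a, b[ -> is_derive x 1 (f \o clamp T) (df x).
  move=> xab; apply: (has_derivative_is_derive (sub _ xab)).
  apply: has_derivative_ext (H _ (sub' _ xab)); first exact: sub'.
  by move=> s sT; rewrite /= clamp_id.
apply: (@ger0_derive1_le_cc R (f \o clamp T) a b).
- by move=> x /D[].
- by move=> x xab; have [_ E] := D x xab; rewrite derive1E E dfp// ; apply: subset_itv_oo_cc.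
- exact: continuous_subspaceT.
- by rewrite in_itv /= lexx ltW.
- by rewrite in_itv /= lexx ltW.
- exact: ltW.
Qed.

Lemma has_derivative0_cst T f t : (forall s, s \in `[0, T] -> has_derivative T f s 0) ->
  t \in `[0, T] -> f t = f 0.
Proof.
move=> H tT; move: (tT); rewrite in_itv /= => /andP[t0 tT'].
apply/eqP; rewrite eq_le; apply/andP; split; last first.
  exact: (has_derivative_nondecreasing H).
rewrite -lerN2; apply: (@has_derivative_nondecreasing T (fun s => - f s) (fun _ => 0)) => // s sT.
by rewrite -oppr0; apply: has_derivativeN => //; exact: H.
Qed.

(** Gronwall's inequality: [E s * expR (- C * s) - eta * s] is nonincreasing. *)
Lemma gronwall T (E dE : R -> R) (C eta : R) t : 0 <= C -> 0 <= eta ->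
  (forall s, s \in `[0, T] -> has_derivative T E s (dE s)) ->
  (forall s, s \in `[0, T] -> dE s <= C * E s + eta) ->
  t \in `[0, T] -> E t <= (E 0 + eta * t) * expR (C * t).
Proof.
move=> C0 eta0 HE HdE tT; move: (tT); rewrite in_itv /= => /andP[t0 tT'].
pose g s := eta * s - E s * expR ((- C) * s).
pose dg s := eta * 1 - (dE s * expR (- C * s) + E s * (- C * expR (- C * s))).
have Hg s : s \in `[0, T] -> has_derivative T g s (dg s).
  move=> sT; apply: has_derivativeB => //.
    by apply: has_derivativeZ => //; exact: has_derivative_id.
  by apply: has_derivativeM => //; [exact: HE|exact: has_derivative_expR].
have : g 0 <= g t.
  apply: (has_derivative_nondecreasing Hg) => // s.
  rewrite in_itv /= => /andP[s0 st].
  have sT : s \in `[0, T] by rewrite in_itv /= s0 (le_trans st).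
  have := HdE s sT; rewrite /dg => h.
  have e0 : 0 < expR (- C * s) by exact: expR_gt0.
  have e1 : expR (- C * s) <= 1 by rewrite -expR0 ler_expR mulNr oppr_le0 mulr_ge0.
  by nra.
rewrite /g !mulr0 expR0 mulr1 sub0r => h.
rewrite -ler_pdivrMr ?expR_gt0// -expRN -mulNr; lra.
Qed.

End calculus.

(** * Antiderivatives *)

Section antiderivative.
Context {R : realType}.
Implicit Types (T t s l : R) (f g h : R -> R).

Lemma icontinuous_bounded T f : 0 <= T -> icontinuous T f ->
  exists C, forall t : R, t \in `[0, T] -> `|f t| <= C.
Proof.
move=> T0 cf.
have cn : {within `[0, T], continuous (fun t => `|(f \o clamp T) t|)}.
  apply: continuous_subspaceT => t; apply: continuous_comp; first exact: cf.
  exact: norm_continuous.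
have [c _ Hc] := EVT_max T0 cn.
exists `|(f \o clamp T) c| => t tT.
by have := Hc t tT; rewrite /= (clamp_id tT).
Qed.

(** The base point [-1] makes every time of [[0, T]] interior to the domain of
    integration, hence the derivative two-sided. *)
Definition prim T h t : R :=
  \int[lebesgue_measure]_(s in `[-1, t]) (h \o clamp T) s -
  \int[lebesgue_measure]_(s in `[-1, 0]) (h \o clamp T) s.

Lemma prim0 T h : prim T h 0 = 0. Proof. by rewrite /prim subrr. Qed.

Lemma prim_derivative T h t : icontinuous T h -> t \in `[0, T] ->
  has_derivative T (prim T h) t (h t).
Proof.
move=> ch tT; move: (tT); rewrite in_itv /= => /andP[t0 tT'].
apply: is_derive_has_derivative.
have int : (@lebesgue_measure R).-integrable [set` Interval (BLeft (-1)) (BRight (t + 1))] (EFin \o (h \o clamp T)).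
  apply: continuous_compact_integrable; first exact: segment_compact.
  exact: continuous_subspaceT.
have t1 : t < t + 1 by rewrite ltrDl.
have at1 : -1 < t by lra.
have [d1 d2] := continuous_FTC1_closed t1 int at1 (ch t).
have D : is_derive t 1 (fun x => \int[lebesgue_measure]_(s in `[-1, x]) (h \o clamp T) s) (h t).
  by apply: DeriveDef => //; rewrite -derive1E d2 /= clamp_id.
set c := \int[lebesgue_measure]_(s in `[-1, 0]) (h \o clamp T) s.
have := is_deriveB D (is_derive_cst c t 1); rewrite subr0.
exact.
Qed.

Lemma antiderivative_unique T F G h t :
  (forall s : R, s \in `[0, T] -> has_derivative T F s (h s)) ->
  (forall s : R, s \in `[0, T] -> has_derivative T G s (h s)) ->
  t \in `[0, T] -> F t - F 0 = G t - G 0.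
Proof.
move=> HF HG tT.
have := @has_derivative0_cst R T (fun s => F s - G s) t _ tT.
have H s : s \in `[0, T] -> has_derivative T (fun s => F s - G s) s 0.
  move=> sT; rewrite -(subrr (h s)); apply: has_derivativeB => //; [exact: HF|exact: HG].
by move=> /(_ H) /=; lra.
Qed.

(** Both [g - f] and [g + f] are nondecreasing. *)
Lemma derivative_bound T f df g dg :
  (forall s : R, s \in `[0, T] -> has_derivative T f s (df s)) ->
  (forall s : R, s \in `[0, T] -> has_derivative T g s (dg s)) ->
  `|f 0| <= g 0 -> (forall s : R, s \in `[0, T] -> `|df s| <= dg s) ->
  forall t : R, t \in `[0, T] -> `|f t| <= g t.
Proof.
move=> Hf Hg fg0 dfg t tT; move: (tT); rewrite in_itv /= => /andP[t0 tT'].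
have sub s : s \in `[0, t] -> s \in `[0, T] by rewrite !in_itv /= => /andP[? ?]; lra.
have A : (fun s => g s - f s) 0 <= (fun s => g s - f s) t.
  apply: (@has_derivative_nondecreasing R T (fun s => g s - f s) (fun s => dg s - df s)) => // s sT.
    by apply: has_derivativeB => //; [exact: Hg|exact: Hf].
  by have := dfg s (sub _ sT); rewrite ler_norml => /andP[? ?]; lra.
have B : (fun s => g s + f s) 0 <= (fun s => g s + f s) t.
  apply: (@has_derivative_nondecreasing R T (fun s => g s + f s) (fun s => dg s + df s)) => // s sT.
    by apply: has_derivativeD => //; [exact: Hg|exact: Hf].
  by have := dfg s (sub _ sT); rewrite ler_norml => /andP[? ?]; lra.
by move: fg0 A B; rewrite !ler_norml => /andP[? ?] /= ? ?; apply/andP; split; lra.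
Qed.

End antiderivative.

(** * Ordinary differential systems *)

Section geometric.
Context {R : realType}.

Lemma half_powers_small (D e : R) : 0 <= D -> 0 < e -> exists n : nat, D * 2^-1 ^+ n <= e.
Proof.
move=> D0 e0; have := archi_boundP (divr_ge0 D0 (ltW e0)).
set n := Num.bound _ => Hn; exists n.
rewrite exprVn ler_pdivrMr ?exprn_gt0// mulrC -ler_pdivrMr//.
apply: (le_trans (ltW Hn)); rewrite -natrX ler_nat; exact: ltnW (ltn_expl _ _).
Qed.

(** The limit is the supremum of the sequence [a] of lower bounds, which increases
    and stays below the decreasing upper bounds [b]. *)
Lemma half_powers_cauchy (u : nat -> R) (D : R) :
  (forall n, `|u n.+1 - u n| <= D * 2^-1 ^+ n) ->
  exists l, forall n, `|u n - l| <= 2 * D * 2^-1 ^+ n.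
Proof.
move=> H.
pose a n := u n - 2 * D * 2^-1 ^+ n; pose b n := u n + 2 * D * 2^-1 ^+ n.
have D0 : 0 <= D by have := H 0; rewrite expr0 mulr1; apply: le_trans.
have p n : 0 <= (2^-1 : R) ^+ n by rewrite exprn_ge0// invr_ge0.
have am : {homo a : n m / (n <= m)%N >-> n <= m}.
  apply: homo_leq => [//|x y z|n]; first exact: le_trans.
  have := H n; rewrite /a exprS ler_norml => /andP[h _].
  have -> : 2 * D * (2^-1 * 2^-1 ^+ n) = D * 2^-1 ^+ n by field.
  lra.
have bm : {homo b : n m / (n <= m)%N >-> m <= n}.
  apply: homo_leq => [//|x y z h1 h2|n]; first exact: le_trans h2 h1.
  have := H n; rewrite /b exprS ler_norml => /andP[_ h].
  have -> : 2 * D * (2^-1 * 2^-1 ^+ n) = D * 2^-1 ^+ n by field.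
  lra.
have ab n m : a n <= b m.
  apply: (le_trans (am _ _ (leq_maxl n m))); apply: (le_trans _ (bm _ _ (leq_maxr n m))).
  by rewrite /a /b lerD2l; have := mulr_ge0 D0 (p (maxn n m)); lra.
exists (sup (range a)) => n.
have hs : has_sup (range a).
  by split; [exists (a 0), 0|exists (b 0) => _ [m _ <-]].
have h1 : a n <= sup (range a) by apply: ub_le_sup; [exact: hs.2|exists n].
have h2 : sup (range a) <= b n by apply: ge_sup; [exact: hs.1|move=> _ [m _ <-]].
by move: h1 h2; rewrite /a /b ler_norml => ? ?; apply/andP; split; lra.
Qed.

End geometric.

Section systems.
Context {R : realType} {I : finType}.
Implicit Types (T K B : R).

Lemma sum_const (c : R) : \sum_(i : I) c = #|I|%:R * c.
Proof. by rewrite sumr_const mulr_natl. Qed.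

(** Second order expansion of the squared negative part, as required by
    [has_derivative_chain]. *)
Lemma negative_part_taylor (x y : R) :
  `|Num.min y 0 ^+ 2 - Num.min x 0 ^+ 2 - 2 * Num.min x 0 * (y - x)| <= (y - x) ^+ 2.
Proof.
have [hy|/ltW hy] := leP y 0; have [hx|/ltW hx] := leP x 0; rewrite ler_norml.
- have -> : y ^+ 2 - x ^+ 2 - 2 * x * (y - x) = (y - x) ^+ 2 by ring.
  by rewrite lexx andbT; have := sqr_ge0 (y - x); lra.
- have := sqr_ge0 y; have : 0 <= x * - y by rewrite mulr_ge0// oppr_ge0.
  have := sqr_ge0 x; have := sqr_ge0 (y - x); rewrite !expr2 => ? ? ? ?; apply/andP; split; lra.
- have := sqr_ge0 y; have : 0 <= y * - x by rewrite mulr_ge0// oppr_ge0.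
  have := sqr_ge0 x; have := sqr_ge0 (y - x); rewrite !expr2 => ? ? ? ?; apply/andP; split; lra.
- by have := sqr_ge0 (y - x); rewrite !expr2 => ?; apply/andP; split; lra.
Qed.

(** Invariance of the orthant, from Gronwall's inequality for the sum of the
    squares of the negative parts. *)
Lemma quasi_positive T B (w dw : R -> I -> R) (b : R -> I -> I -> R) :
  0 <= B ->
  (forall (t : R) i, t \in `[0, T] -> has_derivative T (w ^~ i) t (dw t i)) ->
  (forall (t : R) i, t \in `[0, T] -> \sum_j b t i j * w t j <= dw t i) ->
  (forall (t : R) i j, t \in `[0, T] -> i != j -> 0 <= b t i j) ->
  (forall (t : R) i j, t \in `[0, T] -> `|b t i j| <= B) ->
  (forall i, 0 <= w 0 i) ->
  forall (t : R) i, t \in `[0, T] -> 0 <= w t i.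
Proof.
move=> B0 Hw Hdw b0 bB w0 t i tT.
pose ng (y : R) := Num.min y 0.
pose E s := \sum_i ng (w s i) ^+ 2.
pose dE s := \sum_i 2 * ng (w s i) * dw s i.
have ngP (y : R) : (y <= 0 /\ ng y = y) \/ (0 <= y /\ ng y = 0).
  rewrite /ng; case: (leP y 0) => h; first by left.
  by right; split => //; exact: ltW.
have HE s : s \in `[0, T] -> has_derivative T E s (dE s).
  move=> sT; apply: has_derivative_sum => j.
  apply: (@has_derivative_chain R T (w ^~ j) (fun y => ng y ^+ 2) s (dw s j) _ 1) => //; last exact: Hw.
  by move=> y; rewrite mul1r; exact: negative_part_taylor.
have C0 : 0 <= 2 * B * #|I|%:R by rewrite !mulr_ge0.
have Hle s : s \in `[0, T] -> dE s <= 2 * B * #|I|%:R * E s + 0.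
  move=> sT; rewrite addr0.
  have -> : 2 * B * #|I|%:R * E s = \sum_i \sum_j B * (ng (w s i) ^+ 2 + ng (w s j) ^+ 2).
    rewrite (eq_bigr (fun i => #|I|%:R * (B * ng (w s i) ^+ 2) + B * E s)); last first.
      move=> j _; rewrite /E mulr_sumr -sum_const -big_split /=.
      by apply: eq_bigr => k _; rewrite mulrDr.
    rewrite big_split /= sum_const -mulr_sumr -mulr_sumr -/(E s); ring.
  apply: ler_sum => j _.
  apply: (@le_trans _ _ (2 * ng (w s j) * \sum_k b s j k * w s k)).
    have ngle : ng (w s j) <= 0 by rewrite /ng ge_min lexx orbT.
    by have := Hdw s j sT; nra.
  rewrite mulr_sumr; apply: ler_sum => k _.
  have := bB s j k sT; rewrite ler_norml => /andP[bl bu].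
  have [jk|jk] := eqVneq j k.
    rewrite -jk in bl bu *; case: (ngP (w s j)) => -[hy ->]; nra.
  have bp := b0 s j k sT jk.
  have : 0 <= (ng (w s j) - ng (w s k)) ^+ 2 := sqr_ge0 _.
  case: (ngP (w s j)) => -[hj ->]; case: (ngP (w s k)) => -[hk ->] hs.
  - apply: (@le_trans _ _ (b s j k * (w s j ^+ 2 + w s k ^+ 2))); first by nra.
    by rewrite ler_wpM2r// addr_ge0// sqr_ge0.
  - have : 0 <= w s j ^+ 2 := sqr_ge0 _.
    have : 0 <= b s j k * w s k by exact: mulr_ge0.
    by nra.
  - rewrite mulr0 mul0r mulr_ge0// addr_ge0// ?sqr_ge0//.
  - by rewrite mulr0 mul0r mulr_ge0// addr_ge0// ?sqr_ge0.
have := gronwall C0 (lexx 0) HE Hle tT.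
have -> : E 0 = 0.
  by apply: big1 => j _; rewrite /ng (min_idPr (w0 j)) expr0n.
rewrite mul0r addr0 mul0r => E0.
have Et : E t = 0 by apply/eqP; rewrite eq_le E0 sumr_ge0// => j _; exact: sqr_ge0.
have := psumr_eq0P (P := xpredT) (F := fun i => ng (w t i) ^+ 2).
move=> /(_ (fun j _ => sqr_ge0 _) Et i isT) /eqP; rewrite sqrf_eq0 => /eqP.
by case: (ngP (w t i)) => -[h1 h2] h3 //; rewrite -h2 h3.
Qed.

(** Continuous dependence of solutions, with a modulus depending only on the
    Lipschitz constant and the horizon. *)
Lemma ode_stability T K (e : R) : 0 <= T -> 0 <= K -> 0 < e ->
  exists2 del, 0 < del & forall (w dw : R -> I -> R),
  (forall (t : R) i, t \in `[0, T] -> has_derivative T (w ^~ i) t (dw t i)) ->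
  (forall i, `|w 0 i| <= del) ->
  (forall (t : R) i, t \in `[0, T] -> `|dw t i| <= K * (\sum_j `|w t j|) + del) ->
  forall (t : R) i, t \in `[0, T] -> `|w t i| <= e.
Proof.
move=> T0 K0 e0.
pose n : R := #|I|%:R; have n0 : 0 <= n by [].
pose C := 2 * K * n + 1.
have C0 : 0 <= C by rewrite addr_ge0// !mulr_ge0.
pose X := n * (1 + T) * expR (C * T).
have X0 : 0 <= X by rewrite !mulr_ge0// ?expR_ge0// addr_ge0.
have X1 : 0 < 1 + X by lra.
exists (e / (1 + X)); first by rewrite divr_gt0.
set del := e / (1 + X); move=> w dw Hw w0 Hdw t i tT.
have del0 : 0 < del by rewrite divr_gt0.
pose E s := \sum_i w s i ^+ 2.
pose dE s := \sum_i 2 * w s i * dw s i.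
have HE s : s \in `[0, T] -> has_derivative T E s (dE s).
  by move=> sT; apply: has_derivative_sum => j; apply: has_derivative_sqr => //; exact: Hw.
have eta0 : 0 <= n * del ^+ 2 by rewrite mulr_ge0// sqr_ge0.
have Hle s : s \in `[0, T] -> dE s <= C * E s + n * del ^+ 2.
  move=> sT.
  have -> : C * E s + n * del ^+ 2 =
    \sum_i ((\sum_j K * (w s i ^+ 2 + w s j ^+ 2)) + (w s i ^+ 2 + del ^+ 2)).
    rewrite big_split /= (eq_bigr (fun i => n * (K * w s i ^+ 2) + K * E s)); last first.
      move=> j _; rewrite /E mulr_sumr -sum_const -big_split /=.
      by apply: eq_bigr => k _; rewrite mulrDr.
    by rewrite !big_split /= !sum_const -!mulr_sumr -/(E s) /C /n; ring.
  apply: ler_sum => j _.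
  apply: (@le_trans _ _ (2 * `|w s j| * (K * (\sum_k `|w s k|) + del))).
    apply: (le_trans (ler_norm _)); rewrite !normrM (ger0_norm (ler0n _ 2)).
    by rewrite ler_wpM2l ?mulr_ge0//; exact: Hdw.
  have -> : 2 * `|w s j| * (K * (\sum_k `|w s k|) + del) =
    (\sum_k 2 * `|w s j| * (K * `|w s k|)) + 2 * `|w s j| * del.
    by rewrite mulrDr mulr_sumr mulr_sumr.
  have sq a : `|w s a| ^+ 2 = w s a ^+ 2 by rewrite real_normK ?num_real.
  apply: lerD; last by rewrite -sq; have := sqr_ge0 (`|w s j| - del); nra.
  apply: ler_sum => k _; rewrite -!sq.
  have := mulr_ge0 K0 (sqr_ge0 (`|w s j| - `|w s k|)); nra.
have := gronwall C0 eta0 HE Hle tT.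
have E0 : E 0 <= n * del ^+ 2.
  rewrite -sum_const; apply: ler_sum => j _.
  by rewrite -real_normK ?num_real// lerXn2r ?nnegrE// ltW.
move: (tT); rewrite in_itv /= => /andP[t0 tT'].
have h1 : (E 0 + n * del ^+ 2 * t) * expR (C * t) <= X * del ^+ 2.
  apply: (@le_trans _ _ ((n * del ^+ 2 * (1 + T)) * expR (C * T))); last by rewrite /X; nra.
  apply: ler_pM; rewrite ?expR_ge0//.
  - apply: addr_ge0; last exact: mulr_ge0.
    by rewrite /E; apply: sumr_ge0 => j _; exact: sqr_ge0.
  - by rewrite mulrDr mulr1 lerD// ler_wpM2l.
  - by rewrite ler_expR ler_wpM2l.
move=> /le_trans/(_ h1) h2.
have h3 : X * del ^+ 2 <= e ^+ 2.
  have -> : e ^+ 2 = (1 + X) ^+ 2 * del ^+ 2.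
    by rewrite -exprMn; congr (_ ^+ 2); rewrite /del mulrC divfK// gt_eqF.
  by rewrite ler_wpM2r ?sqr_ge0//; nra.
have h4 : w t i ^+ 2 <= E t.
  by rewrite /E (bigD1 i)//= lerDl sumr_ge0// => j _; exact: sqr_ge0.
rewrite -(@ler_pXn2r _ 2)// ?nnegrE ?(ltW e0)// real_normK ?num_real//.
exact: le_trans h4 (le_trans h2 h3).
Qed.

Lemma ode_unique T K (w dw : R -> I -> R) : 0 <= T -> 0 <= K ->
  (forall (t : R) i, t \in `[0, T] -> has_derivative T (w ^~ i) t (dw t i)) ->
  (forall i, w 0 i = 0) ->
  (forall (t : R) i, t \in `[0, T] -> `|dw t i| <= K * (\sum_j `|w t j|)) ->
  forall (t : R) i, t \in `[0, T] -> w t i = 0.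
Proof.
move=> T0 K0 Hw w0 Hdw t i tT; apply/eqP; rewrite -normr_le0; apply/ler_addgt0Pl => e e0.
rewrite addr0; have [del d0 H] := ode_stability T0 K0 e0.
apply: (H w dw) => // [j|s j sT]; first by rewrite w0 normr0 ltW.
by apply: (le_trans (Hdw s j sT)); rewrite lerDl ltW.
Qed.

(** Picard iteration. The successive differences are measured with the weight
    [expR (2 K t)], which makes them decrease geometrically on the whole of
    [[0, T]]. *)
Lemma picard T K (Phi : R -> (I -> R) -> I -> R) (y0 : I -> R) : 0 < T -> 0 <= K ->
  (forall y, (forall i, icontinuous T (y ^~ i)) ->
     forall i, icontinuous T (fun s => Phi s (y s) i)) ->
  (forall t y z r i, t \in `[0, T] -> (forall j, `|y j - z j| <= r) ->
     `|Phi t y i - Phi t z i| <= K * r) ->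
  exists y : R -> I -> R, (forall i, y 0 i = y0 i) /\
    forall (t : R) i, t \in `[0, T] -> has_derivative T (y ^~ i) t (Phi t (y t) i).
Proof.
move=> T0 K0 Pc PL.
have T0' := ltW T0.
have Z0 : 0 \in `[0, T] by rewrite in_itv /= lexx.
pose step (y : R -> I -> R) t i := y0 i + prim T (fun s => Phi s (y s) i) t.
have stepD y : (forall i, icontinuous T (y ^~ i)) ->
    forall (t : R) i, t \in `[0, T] -> has_derivative T (step y ^~ i) t (Phi t (y t) i).
  move=> cy t i tT; rewrite -[X in has_derivative _ _ _ X]add0r.
  apply: has_derivativeD; first exact: has_derivative_cst.
  by apply: prim_derivative => //; exact: Pc.
have stepc y : (forall i, icontinuous T (y ^~ i)) -> forall i, icontinuous T (step y ^~ i).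
  move=> cy i; apply: has_derivative_icontinuous => // t tT.
  by exists (Phi t (y t) i); exact: stepD.
pose u n := iter n step (fun _ => y0).
have uc n : forall i, icontinuous T (u n ^~ i).
  elim: n => [i|n IH]; last exact: stepc.
  by move=> t; exact: cvg_cst.
pose K1 := K + 1.
have [C C0 HC] : exists2 C, 0 <= C & forall (t : R) i, t \in `[0, T] -> `|u 1 t i - u 0 t i| <= C.
  have /choice[c Hc] : forall i, exists C, forall t : R, t \in `[0, T] -> `|u 1 t i - u 0 t i| <= C.
    move=> i; apply: (icontinuous_bounded (f := fun t => u 1 t i - u 0 t i)) => // t.
    by apply: cvgB; [exact: (uc 1%N i t)|exact: (uc 0%N i t)].
  exists (\sum_i `|c i|) => [|t i tT]; first exact: sumr_ge0.
  apply: (le_trans (Hc i t tT)).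
  by rewrite (bigD1 i)//= (le_trans (ler_norm _))// lerDl sumr_ge0.
have Hd n : forall (t : R) i, t \in `[0, T] -> `|u n.+1 t i - u n t i| <= C * 2^-1 ^+ n * expR (2 * K1 * t).
  elim: n => [|n IH] t i tT.
    rewrite expr0 mulr1; apply: (le_trans (HC t i tT)).
    rewrite ler_peMr// -expR0 ler_expR mulr_ge0// ?mulr_ge0// /K1 ?addr_ge0//.
    by move: tT; rewrite in_itv => /andP[].
  have c0 : 0 <= C * 2^-1 ^+ n.+1 by rewrite mulr_ge0// exprn_ge0// invr_ge0.
  pose f t := u n.+2 t i - u n.+1 t i.
  pose df t := Phi t (u n.+1 t) i - Phi t (u n t) i.
  pose g t := (C * 2^-1 ^+ n.+1) * expR ((2 * K1) * t).
  pose dg t := (C * 2^-1 ^+ n.+1) * ((2 * K1) * expR ((2 * K1) * t)).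
  apply: (@derivative_bound R T f df g dg) => //.
  - by move=> s sT; apply: has_derivativeB => //; exact: (stepD _ (uc _)).
  - move=> s sT; apply: has_derivativeZ => //; exact: has_derivative_expR.
  - by rewrite /f /u !iterS /step !prim0 subrr normr0 /g mulr_ge0// expR_ge0.
  - move=> s sT; apply: (le_trans (PL s _ _ _ i sT (fun j => IH s j sT))).
    rewrite /dg /K1 exprS; have := expR_gt0 (2 * (K + 1) * s).
    set E := expR _ => E0.
    have p : 0 <= C * 2^-1 ^+ n by rewrite mulr_ge0// exprn_ge0// invr_ge0.
    have -> : C * (2^-1 * 2^-1 ^+ n) * (2 * (K + 1) * E) = (K + 1) * (C * 2^-1 ^+ n * E) by field.
    by rewrite ler_wpM2r ?lerDl// mulr_ge0// ltW.
pose D := C * expR (2 * K1 * T).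
have Hd2 n t i : t \in `[0, T] -> `|u n.+1 t i - u n t i| <= D * 2^-1 ^+ n.
  move=> tT; apply: (le_trans (Hd n t i tT)).
  rewrite /D [X in _ <= X]mulrAC ler_wpM2l//.
    by rewrite mulr_ge0// exprn_ge0// invr_ge0.
  rewrite ler_expR ler_wpM2l// ?mulr_ge0// /K1 ?addr_ge0//.
  by move: tT; rewrite in_itv => /andP[].
have /choice[y' Hy'] : forall p : R * I, exists l, p.1 \in `[0, T] ->
    forall n, `|u n p.1 p.2 - l| <= 2 * D * 2^-1 ^+ n.
  move=> [t i]; case: (boolP (t \in `[0, T])) => tT; last by exists 0.
  have [l Hl] := half_powers_cauchy (fun n => Hd2 n t i tT).
  by exists l.
pose y t i := y' (t, i).
have Hy t i n : t \in `[0, T] -> `|u n t i - y t i| <= 2 * D * 2^-1 ^+ n.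
  by move=> tT; exact: (Hy' (t, i) tT n).
have D0 : 0 <= 2 * D by rewrite !mulr_ge0// expR_ge0.
have yc i : icontinuous T (y ^~ i).
  move=> t; apply/cvgrPdist_le => /= e e0.
  have e3 : 0 < e / 3 by lra.
  have [n Hn] := half_powers_small D0 e3.
  have /cvgrPdist_le/(_ _ e3) := uc n i t.
  apply: filterS => s /= Hs.
  have cs := clamp_itv s T0'; have ct := clamp_itv t T0'.
  have h1 := le_trans (Hy _ i n cs) Hn; have h2 := le_trans (Hy _ i n ct) Hn.
  move: h1 h2 Hs; rewrite !ler_norml => /andP[? ?] /andP[? ?] /andP[? ?].
  by apply/andP; split; lra.
have fixy t i : t \in `[0, T] -> step y t i = y t i.
  move=> tT; apply/eqP; rewrite -subr_eq0 -normr_le0; apply/ler_addgt0Pl => e e0; rewrite addr0.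
  have D2 : 0 <= K * (2 * D) * T + 2 * D by rewrite addr_ge0 ?mulr_ge0// D0.
  have [n Hn] := half_powers_small D2 e0.
  have h1 : `|step y t i - u n.+1 t i| <= K * (2 * D * 2^-1 ^+ n) * t.
    pose c := K * (2 * D * 2^-1 ^+ n).
    apply: (@derivative_bound R T (fun t => step y t i - u n.+1 t i) (fun t => Phi t (y t) i - Phi t (u n t) i)
      (fun t => c * t) (fun _ => c * 1)) => //.
    - by move=> s sT; apply: has_derivativeB => //; [exact: stepD|exact: (stepD _ (uc _))].
    - by move=> s sT; apply: has_derivativeZ => //; exact: has_derivative_id.
    - by rewrite /u iterS /step !prim0 subrr normr0 mulr0.
    - move=> s sT; rewrite mulr1; apply: PL => // j; rewrite distrC; exact: Hy.
  have h2 := Hy t i n.+1 tT.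
  have h3 : K * (2 * D * 2^-1 ^+ n) * t <= K * (2 * D * 2^-1 ^+ n) * T.
    rewrite ler_wpM2l ?mulr_ge0// ?exprn_ge0 ?invr_ge0 ?expR_ge0//.
    by move: tT; rewrite in_itv => /andP[].
  have h4 : 2 * D * 2^-1 ^+ n.+1 <= 2 * D * 2^-1 ^+ n.
    rewrite ler_wpM2l ?D0// exprS ler_piMl ?exprn_ge0 ?invr_ge0//; lra.
  have -> : step y t i - y t i = (step y t i - u n.+1 t i) + (u n.+1 t i - y t i) by ring.
  apply: (le_trans (ler_normD _ _)); apply: (le_trans (lerD h1 h2)); apply: (le_trans _ Hn).
  have -> : (K * (2 * D) * T + 2 * D) * 2^-1 ^+ n = K * (2 * D * 2^-1 ^+ n) * T + 2 * D * 2^-1 ^+ n.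
    by ring.
  exact: lerD.
exists y; split; first by move=> i; rewrite -fixy// /step prim0 addr0.
move=> t i tT; apply: has_derivative_ext (stepD y yc t i tT) => // s sT; exact: fixy.
Qed.

End systems.

(** * Calculus of the antiderivative *)

Section prim_algebra.
Context {R : realType} (T : R).
Hypothesis T0 : 0 < T.
Implicit Types (t s c : R) (f g h : R -> R).

Lemma prim_unique F h t : icontinuous T h ->
  (forall s : R, s \in `[0, T] -> has_derivative T F s (h s)) ->
  t \in `[0, T] -> prim T h t = F t - F 0.
Proof.
move=> ch HF tT; rewrite -[LHS]subr0 -[X in _ - X = _](prim0 T h).
apply: antiderivative_unique tT; last exact: HF.
by move=> s sT; exact: prim_derivative.
Qed.

Lemma prim_ext f g t : (forall s : R, s \in `[0, T] -> f s = g s) -> prim T f t = prim T g t.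
Proof.
move=> fg; rewrite /prim (_ : f \o clamp T = g \o clamp T)//.
by apply/funext => s /=; rewrite fg// clamp_itv// ltW.
Qed.

Lemma icontinuous_cst c : icontinuous T (fun _ => c).
Proof. by move=> t; exact: cvg_cst. Qed.

Lemma icontinuousD f g : icontinuous T f -> icontinuous T g -> icontinuous T (fun s => f s + g s).
Proof. by move=> cf cg t; apply: cvgD; [exact: cf|exact: cg]. Qed.

Lemma icontinuousM f g : icontinuous T f -> icontinuous T g -> icontinuous T (fun s => f s * g s).
Proof. by move=> cf cg t; apply: cvgM; [exact: cf|exact: cg]. Qed.

Lemma icontinuousZ c g : icontinuous T g -> icontinuous T (fun s => c * g s).
Proof. by apply: icontinuousM; exact: icontinuous_cst. Qed.

Lemma icontinuousN g : icontinuous T g -> icontinuous T (fun s => - g s).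
Proof. by move=> cg t; apply: cvgN; exact: cg. Qed.

Lemma icontinuousB f g : icontinuous T f -> icontinuous T g -> icontinuous T (fun s => f s - g s).
Proof. by move=> cf cg; apply: icontinuousD => //; exact: icontinuousN. Qed.

Lemma icontinuous_sum (J : Type) (r : seq J) (P : pred J) (f : J -> R -> R) :
  (forall i, icontinuous T (f i)) -> icontinuous T (fun s => \sum_(i <- r | P i) f i s).
Proof.
move=> cf; elim: r => [|i r IH].
  by under eq_fun do rewrite big_nil; exact: icontinuous_cst.
under eq_fun do rewrite big_cons; case: (P i) => //.
exact: icontinuousD.
Qed.

Lemma primD f g t : icontinuous T f -> icontinuous T g -> t \in `[0, T] ->
  prim T (fun s => f s + g s) t = prim T f t + prim T g t.
Proof.
move=> cf cg tT; rewrite (prim_unique (F := fun s => prim T f s + prim T g s)) ?prim0 ?addr0 ?subr0//.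
  exact: icontinuousD.
by move=> s sT; apply: has_derivativeD; exact: prim_derivative.
Qed.

Lemma primZ c f t : icontinuous T f -> t \in `[0, T] ->
  prim T (fun s => c * f s) t = c * prim T f t.
Proof.
move=> cf tT; rewrite (prim_unique (F := fun s => c * prim T f s)) ?prim0 ?mulr0 ?subr0//.
  exact: icontinuousZ.
by move=> s sT; apply: has_derivativeZ => //; exact: prim_derivative.
Qed.

Lemma primB f g t : icontinuous T f -> icontinuous T g -> t \in `[0, T] ->
  prim T (fun s => f s - g s) t = prim T f t - prim T g t.
Proof.
move=> cf cg tT; rewrite primD//; last exact: icontinuousN.
rewrite -[in RHS]mulN1r -primZ//; congr (_ + _); apply: prim_ext => s _.
by rewrite mulN1r.
Qed.

Lemma prim_sum (J : Type) (r : seq J) (f : J -> R -> R) t :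
  (forall i, icontinuous T (f i)) -> t \in `[0, T] ->
  prim T (fun s => \sum_(i <- r) f i s) t = \sum_(i <- r) prim T (f i) t.
Proof.
move=> cf tT; elim: r => [|i r IH].
  rewrite big_nil (prim_unique (F := fun _ => 0)) ?subr0//; last first.
    by move=> s _; under eq_bigr do []; rewrite big_nil; exact: has_derivative_cst.
  by under eq_fun do rewrite big_nil; exact: icontinuous_cst.
rewrite big_cons -IH -primD//; last exact: icontinuous_sum.
by apply: prim_ext => s _; rewrite big_cons.
Qed.

Lemma prim_bound f C : icontinuous T f -> (forall s : R, s \in `[0, T] -> `|f s| <= C) ->
  `|prim T f T| <= C * T.
Proof.
move=> cf fC; have TT : T \in `[0, T] by rewrite in_itv /= lexx ltW.
apply: (@derivative_bound R T (prim T f) f (fun s => C * s) (fun _ => C)) => //.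
- by move=> s sT; exact: prim_derivative.
- move=> s sT; rewrite -[X in has_derivative _ _ _ X]mulr1.
  by apply: has_derivativeZ => //; exact: has_derivative_id.
- by rewrite prim0 normr0 mulr0.
Qed.

(** Compactness of [[0, T]]. The uniform convergence that the stability of the
    equations asks for is obtained from joint convergence at each time. *)
Lemma uniform_near (J : Type) (F : set_system J) (h : R -> J -> R) : Filter F ->
  (forall t, t \in `[0, T] -> forall e, 0 < e ->
     \forall z \near filter_prod (nbhs t) F, `|h z.1 z.2| < e) ->
  forall e, 0 < e -> \forall j \near F, forall t, t \in `[0, T] -> `|h t j| < e.
Proof.
move=> FF H e e0.
have /compact_near_coveringP/(_ J F (fun j t => `|h t j| < e) FF) : compact `[0 : R, T].
  exact: segment_compact.
move=> /(_ _)/filterS; apply.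
  by move=> j Hj t tT; apply: Hj; move: tT.
by move=> t tT; have := H t tT e e0.
Qed.

Lemma icontinuous_uniform k e : icontinuous T k -> 0 < e ->
  exists2 r : R, 0 < r & forall s t, s \in `[0, T] -> t \in `[0, T] -> `|s - t| < r ->
    `|k s - k t| <= e.
Proof.
move=> ck e0.
have /compact_near_coveringP H : compact `[0 : R, T] by exact: segment_compact.
have := H R (at_right 0) (fun r x => forall s, `|s - x| < r -> `|(k \o clamp T) s - (k \o clamp T) x| <= e).
move=> /(_ _ _) [].
  move=> t tT; have e2 : 0 < e / 2 by lra.
  have /cvgrPdist_lt/(_ _ e2)/nbhs_ballP[r /= r0 Hr] := ck t.
  have r2 : 0 < r / 2 by lra.
  exists (ball t (r / 2), [set x | x < r / 2]) => /=.
    split; first exact: nbhsx_ballx.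
    exact: nbhs_right_lt.
  move=> [x q] /= []; rewrite -ball_normE /= => xt qr s sx.
  have h1 := Hr x; have h2 := Hr s.
  rewrite -ball_normE /= in h1 h2.
  have {}h1 : `|k (clamp T t) - k (clamp T x)| < e / 2 by apply: h1; lra.
  have {}h2 : `|k (clamp T t) - k (clamp T s)| < e / 2.
    apply: h2; have -> : t - s = (t - x) - (s - x) by ring.
    by apply: (le_lt_trans (ler_normB _ _)); lra.
  have -> : k (clamp T s) - k (clamp T x) = (k (clamp T t) - k (clamp T x)) - (k (clamp T t) - k (clamp T s)) by ring.
  by apply: (le_trans (ler_normB _ _)); lra.
move=> r /= r0 Hr; exists (r / 2); first by lra.
move=> s t sT tT st; have := Hr (r / 2); rewrite /ball_ /= sub0r normrN gtr0_norm; last by lra.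
move=> /(_ _ _ t tT s st); rewrite /= !clamp_id//; apply; lra.
Qed.

(** On each cell, [F s - (k a - e / T) * s] and [(k a + e / T) * s - F s] are
    nondecreasing, which bounds the increment of [F] on both sides. *)
Lemma riemann_sum_cvg k (F : R -> R) : icontinuous T k ->
  (forall s : R, s \in `[0, T] -> has_derivative T F s (k s)) ->
  (fun n => \sum_(i < n.+1) T / n.+1%:R * k (i%:R * (T / n.+1%:R))) @ \oo --> F T - F 0.
Proof.
move=> ck HF; apply/cvgrPdist_le => /= e e0.
have eT : 0 < e / T by rewrite divr_gt0.
have [r r0 Hr] := icontinuous_uniform ck eT.
near=> n.
pose q := T / n.+1%:R; have n0 : 0 < n.+1%:R :> R by [].
have q0 : 0 < q by rewrite divr_gt0.
have qr : q < r.
  rewrite ltr_pdivrMr// mulrC -ltr_pdivrMr//.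
  apply: (@lt_trans _ _ n%:R); last by rewrite ltr_nat.
  near: n; exact: nbhs_infty_gtr.
have nq : n.+1%:R * q = T by rewrite /q mulrC divfK// gt_eqF.
have -> : F T - F 0 = \sum_(i < n.+1) (F (i.+1%:R * q) - F (i%:R * q)).
  rewrite -(big_mkord xpredT (fun i => F (i.+1%:R * q) - F (i%:R * q))).
  by rewrite telescope_sumr// nq mul0r.
rewrite -sumrB; apply: (le_trans (ler_norm_sum _ _ _)).
have -> : e = \sum_(i < n.+1) (q * (e / T)).
  by rewrite sumr_const card_ord -mulr_natl mulrA nq mulrC divfK// gt_eqF.
apply: ler_sum => i _.
pose a := i%:R * q; pose b := i.+1%:R * q.
have ba : b = a + q by rewrite /b /a -natr1 mulrDl mul1r.
have a0 : 0 <= a by rewrite mulr_ge0// ltW.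
have in_ : (i.+1%:R : R) <= n.+1%:R by rewrite ler_nat.
have bT : b <= T by rewrite -[leRHS]nq /b; apply: ler_wpM2r => //; exact: ltW.
have ab : a <= b by rewrite ba; lra.
have aT : a \in `[0, T] by rewrite in_itv /=; lra.
have sub s : s \in `[a, b] -> s \in `[0, T] /\ `|k s - k a| <= e / T.
  rewrite in_itv /= => /andP[as_ sb].
  have sT : s \in `[0, T] by rewrite in_itv /=; lra.
  split => //; apply: Hr => //; rewrite ger0_norm; lra.
have lo : F a - (k a - e / T) * a <= F b - (k a - e / T) * b.
  apply: (@has_derivative_nondecreasing R T (fun s => F s - (k a - e / T) * s) (fun s => k s - (k a - e / T) * 1)) => //.
    move=> s sT; apply: has_derivativeB => //; first exact: HF.
    by apply: has_derivativeZ => //; exact: has_derivative_id.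
  by move=> s /sub[_]; rewrite ler_norml => /andP[? ?]; lra.
have up : (k a + e / T) * a - F a <= (k a + e / T) * b - F b.
  apply: (@has_derivative_nondecreasing R T (fun s => (k a + e / T) * s - F s) (fun s => (k a + e / T) * 1 - k s)) => //.
    move=> s sT; apply: has_derivativeB => //; last exact: HF.
    by apply: has_derivativeZ => //; exact: has_derivative_id.
  by move=> s /sub[_]; rewrite ler_norml => /andP[? ?]; lra.
rewrite -/q -/a -/b; move: lo up; rewrite ba ler_norml => lo up.
apply/andP; split; lra.
Unshelve. all: by end_near. Qed.

End prim_algebra.

(** * Means of bounded measurable functions *)

Section bounded_measurable.
Context {R : realType} {disp : measure_display} {X : measurableType disp}.
Variable mu : probability X R.
Implicit Types (h g : X -> R) (A : set X).

Definition bounded_measurable h :=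
  measurable_fun [set: X] h /\ exists C, forall u, `|h u| <= C.

Lemma bm_integrable h A : bounded_measurable h -> measurable A ->
  mu.-integrable A (EFin \o h).
Proof.
move=> [mh [C hC]] mA; apply: measurable_bounded_integrable => //.
- by apply: (@le_lt_trans _ _ 1%E); [exact: probability_le1|rewrite ltry].
- exact: measurable_funS mh.
- by exists C; split; [exact: num_real|move=> M CM u _; apply: le_trans (hC u) (ltW CM)].
Qed.

Lemma bm_cst c : bounded_measurable (fun _ => c).
Proof. by split; [exact: measurable_cst|exists `|c|]. Qed.

Lemma bmD h g : bounded_measurable h -> bounded_measurable g -> bounded_measurable (fun u => h u + g u).
Proof.
move=> [mh [C hC]] [mg [D gD]]; split; first exact: measurable_funD.
by exists (C + D) => u; apply: (le_trans (ler_normD _ _)); apply: lerD.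
Qed.

Lemma bmM h g : bounded_measurable h -> bounded_measurable g -> bounded_measurable (fun u => h u * g u).
Proof.
move=> [mh [C hC]] [mg [D gD]]; split; first exact: measurable_funM.
by exists (C * D) => u; rewrite normrM; apply: ler_pM.
Qed.

Lemma bmZ c h : bounded_measurable h -> bounded_measurable (fun u => c * h u).
Proof. by apply: bmM; exact: bm_cst. Qed.

Lemma bmB h g : bounded_measurable h -> bounded_measurable g -> bounded_measurable (fun u => h u - g u).
Proof.
move=> bh bg; have := bmD bh (bmZ (-1) bg).
by congr bounded_measurable; apply/funext => u; rewrite mulN1r.
Qed.

Lemma bm_sqr h : bounded_measurable h -> bounded_measurable (fun u => h u ^+ 2).
Proof. by move=> bh; have := bmM bh bh. Qed.

Lemma bm_norm h : bounded_measurable h -> bounded_measurable (fun u => `|h u|).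
Proof.
move=> [mh [C hC]]; split; first exact: (measurableT_comp (@normr_measurable R setT) mh).
by exists C => u; rewrite normr_id.
Qed.

Lemma bm_sum (J : Type) (r : seq J) (P : pred J) (h : J -> X -> R) :
  (forall i, bounded_measurable (h i)) -> bounded_measurable (fun u => \sum_(i <- r | P i) h i u).
Proof.
move=> bh; elim: r => [|i r IH].
  by under eq_fun do rewrite big_nil; exact: bm_cst.
under eq_fun do rewrite big_cons; case: (P i) => //.
exact: bmD.
Qed.

Definition mean h : R := \int[mu]_u h u.

Lemma meanD h g : bounded_measurable h -> bounded_measurable g ->
  mean (fun u => h u + g u) = mean h + mean g.
Proof. by move=> bh bg; rewrite /mean RintegralD//; exact: bm_integrable. Qed.

Lemma meanB h g : bounded_measurable h -> bounded_measurable g ->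
  mean (fun u => h u - g u) = mean h - mean g.
Proof. by move=> bh bg; rewrite /mean RintegralB//; exact: bm_integrable. Qed.

Lemma meanZ c h : bounded_measurable h -> mean (fun u => c * h u) = c * mean h.
Proof. by move=> bh; rewrite /mean RintegralZl//; exact: bm_integrable. Qed.

Lemma mean_cst c : mean (fun _ => c) = c.
Proof. by rewrite /mean Rintegral_cst// (_ : fine _ = 1) ?mulr1// -[RHS]/(fine 1%E); congr fine; exact: probability_setT. Qed.

Lemma mean_sum (J : Type) (r : seq J) (h : J -> X -> R) :
  (forall i, bounded_measurable (h i)) ->
  mean (fun u => \sum_(i <- r) h i u) = \sum_(i <- r) mean (h i).
Proof.
move=> bh; elim: r => [|i r IH].
  by under [LHS]eq_Rintegral do rewrite big_nil; rewrite big_nil -/(mean _) mean_cst.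
rewrite big_cons -IH -meanD//; last exact: bm_sum.
by congr mean; apply/funext => u; rewrite big_cons.
Qed.

Lemma mean_le h g : bounded_measurable h -> bounded_measurable g ->
  (forall u, h u <= g u) -> mean h <= mean g.
Proof. by move=> bh bg hg; apply: le_Rintegral => //; exact: bm_integrable. Qed.

Lemma mean_ge0 h : (forall u, 0 <= h u) -> 0 <= mean h.
Proof. by move=> h0; apply: Rintegral_ge0. Qed.

Lemma bm_cvg (h_ : nat -> X -> R) h C : (forall n, measurable_fun [set: X] (h_ n)) ->
  (forall n u, `|h_ n u| <= C) -> (forall u, h_ n u @[n --> \oo] --> h u) ->
  bounded_measurable h.
Proof.
move=> mh hC hc; split; first by apply: (measurable_fun_cvg mh) => u _; exact: hc.
exists C => u; have H : `|h_ n u| @[n --> \oo] --> `|h u| by apply: cvg_norm; exact: hc.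
by rewrite -(cvg_lim _ H)//; apply: limr_le; [apply/cvg_ex; exists (`|h u|)|near=> n].
Unshelve. all: by end_near. Qed.

Lemma mean_cvg (h_ : nat -> X -> R) h C A : measurable A ->
  (forall n, measurable_fun [set: X] (h_ n)) ->
  (forall n u, `|h_ n u| <= C) -> (forall u, h_ n u @[n --> \oo] --> h u) ->
  \int[mu]_(u in A) h_ n u @[n --> \oo] --> \int[mu]_(u in A) h u.
Proof.
move=> mA mh hC hc.
have bh := bm_cvg mh hC hc.
have bh_ n : bounded_measurable (h_ n) by split => //; exists C.
have fin (g : X -> R) : bounded_measurable g -> ((\int[mu]_(u in A) (g u)%:E)%E \is a fin_num).
  by move=> bg; apply: integrable_fin_num => //; exact: bm_integrable.
rewrite /Rintegral; apply: fine_cvg; rewrite fineK; last exact: fin.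
apply: (@dominated_cvg _ _ _ mu A mA (fun n u => (h_ n u)%:E) (fun u => (h u)%:E) (fun _ => C%:E)) => //.
- by move=> n; apply/measurable_EFinP; exact: measurable_funS (mh n).
- by move=> u _; apply: cvg_EFin; [near=> n|exact: hc].
- exact: (bm_integrable (bm_cst C)).
- by move=> n u _; rewrite lee_fin.
Unshelve. all: by end_near. Qed.

(** Riemann sums carry both the measurability in [u] and the sign of the mean from
    each time to the time integral. *)
Lemma mean_prim T (h : R -> X -> R) C : 0 < T ->
  (forall u, icontinuous T (h ^~ u)) ->
  (forall t, t \in `[0, T] -> measurable_fun [set: X] (h t)) ->
  (forall t u, t \in `[0, T] -> `|h t u| <= C) ->
  bounded_measurable (fun u => prim T (h ^~ u) T) /\
  ((forall t, t \in `[0, T] -> 0 <= mean (h t)) -> 0 <= mean (fun u => prim T (h ^~ u) T)).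
Proof.
move=> T0 hc hm hC; have TT : T \in `[0, T] by rewrite in_itv /= lexx ltW.
pose S n u := \sum_(i < n.+1) T / n.+1%:R * h (i%:R * (T / n.+1%:R)) u.
have node n (i : 'I_n.+1) : i%:R * (T / n.+1%:R) \in `[0, T].
  have n0 : 0 <= T / n.+1%:R by rewrite divr_ge0// ltW.
  rewrite in_itv /= mulr_ge0//= mulrA ler_pdivrMr// mulrC.
  by apply: ler_wpM2l; [exact: ltW|rewrite ler_nat ltnW].
have bh t : t \in `[0, T] -> bounded_measurable (h t).
  by move=> tT; split; [exact: hm|exists C => u; exact: hC].
have bS n : bounded_measurable (S n).
  by apply: bm_sum => i; apply: bmZ; apply: bh; exact: node.
have SC n u : `|S n u| <= T * C.
  apply: (le_trans (ler_norm_sum _ _ _)).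
  apply: (@le_trans _ _ (\sum_(i < n.+1) T / n.+1%:R * C)).
    have n0 : 0 <= T / n.+1%:R by rewrite divr_ge0// ltW.
    apply: ler_sum => i _; rewrite normrM (ger0_norm n0).
    by apply: ler_wpM2l => //; apply: hC; exact: node.
  rewrite sumr_const card_ord -[leLHS]mulr_natr mulrAC divfK//.
have Sc u : S n u @[n --> \oo] --> prim T (h ^~ u) T.
  rewrite -[X in _ --> X]subr0 -(prim0 T (h ^~ u)).
  apply: (@riemann_sum_cvg R T T0 (h ^~ u) (prim T (h ^~ u))); first exact: hc.
  by move=> s sT; apply: prim_derivative => //; exact: hc.
split; first by apply: (bm_cvg (fun n => (bS n).1) SC Sc).
move=> h0; have Hc := mean_cvg measurableT (fun n => (bS n).1) SC Sc.
rewrite /mean -(cvg_lim _ Hc)//; apply: limr_ge; first by apply/cvg_ex; eexists; exact: Hc.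
near=> n; rewrite -/(mean (S n)) mean_sum; last by move=> i; apply: bmZ; apply: bh; exact: node.
apply: sumr_ge0 => i _; rewrite meanZ; last by apply: bh; exact: node.
by apply: mulr_ge0; [rewrite divr_ge0// ltW|apply: h0; exact: node].
Unshelve. all: by end_near. Qed.

End bounded_measurable.

(** * The control problem at a single state *)

Section quadratic.
Context {R : realType} {I : finType}.

(** By completing the square in each coordinate. In the applications [v] gives the
    sizes of the rates, or of their variations, of a control that does at least as
    well as the one with [v = 0], and [c] bounds the slope there. *)
Lemma quadratic_sublevel (g c : R) (v : I -> R) z : 0 < g -> 0 <= c ->
  \sum_y (g * v y ^+ 2 - c * v y) <= 0 -> v z <= c * ((1 + #|I|%:R) / (2 * g)).
Proof.
move=> g0 c0 Hs; pose k := c / (2 * g).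
have k0 : 0 <= k by rewrite divr_ge0// mulr_ge0// ltW.
have E : \sum_y (g * v y ^+ 2 - c * v y) = g * (\sum_y (v y - k) ^+ 2) - g * (#|I|%:R * k ^+ 2).
  rewrite -sum_const -mulrBr -sumrB mulr_sumr; apply: eq_bigr => y _.
  by rewrite /k; field; rewrite gt_eqF.
have h1 : \sum_y (v y - k) ^+ 2 <= #|I|%:R * k ^+ 2.
  by move: Hs; rewrite E -mulrBr pmulr_rle0// subr_le0.
have h2 : (v z - k) ^+ 2 <= #|I|%:R * k ^+ 2.
  apply: le_trans h1; rewrite (bigD1 z)//= lerDl sumr_ge0// => y _; exact: sqr_ge0.
have n1 : 1 <= #|I|%:R :> R by rewrite ler1n; apply/card_gt0P; exists z.
have -> : c * ((1 + #|I|%:R) / (2 * g)) = k + #|I|%:R * k.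
  by rewrite /k; field; rewrite gt_eqF.
rewrite -lerBlDl; have nk : 0 <= #|I|%:R * k by rewrite mulr_ge0.
rewrite leNgt; apply/negP => h3.
have h4 : (#|I|%:R * k) ^+ 2 < (v z - k) ^+ 2.
  by rewrite ltr_pXn2r ?nnegrE// (le_trans nk)// ltW.
have h5 : #|I|%:R * k ^+ 2 <= (#|I|%:R * k) ^+ 2.
  rewrite (exprMn _ #|I|%:R k); apply: ler_wpM2r; first exact: sqr_ge0.
  by rewrite expr2 ler_peMl.
lra.
Qed.

Lemma cvg_fin_sum (J : Type) (F : set_system J) (FF : Filter F) (f : I -> J -> R) (l : I -> R) :
  (forall i, f i j @[j --> F] --> l i) -> \sum_i f i j @[j --> F] --> \sum_i l i.
Proof.
move=> H; have E (r : seq I) : \sum_(i <- r) f i j @[j --> F] --> \sum_(i <- r) l i.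
  elim: r => [|i r IH].
    by rewrite big_nil; under eq_cvg do rewrite big_nil; exact: cvg_cst.
  by rewrite big_cons; under eq_cvg do rewrite big_cons; apply: cvgD.
exact: E.
Qed.

End quadratic.

Section control.
Context {R : realType} {d : nat} {U : pmetricType R}.
Local Notation Sigma := 'I_d.+1.
Local Notation vec := 'rV[R]_d.+1.
Variables (L : Sigma -> vec -> U -> R) (DL : Sigma -> vec -> U -> vec) (gam : R).
Hypothesis gam0 : 0 < gam.
Hypothesis DLgrad : forall x a u, orthant a -> is_gradient (fun b => L x b u) a (DL x a u).
Hypothesis Lconv : forall x a a' u, orthant a -> orthant a' ->
  L x a u + dotv (DL x a u) (a' - a) + gam * dotv (a' - a) (a' - a) <= L x a' u.
Hypothesis Lcont : forall x a, orthant a -> continuous (L x a) /\ continuous (DL x a).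

Implicit Types (x y z : Sigma) (p a b : vec) (u : U).

Local Notation astar := (optimal_control L).

(** The sum over [y != x] in the cost becomes a scalar product once the diagonal
    entry of the momentum is erased. *)
Definition offdiag x p : vec := \row_y (if y == x then 0 else p 0 y).

Lemma costE x p u a : cost L x p u a = dotv (offdiag x p) a + L x a u.
Proof.
rewrite /cost /dotv; congr (_ + _); rewrite [RHS](bigID (pred1 x))/= big_pred1_eq mxE eqxx mul0r add0r.
by apply: eq_bigr => y yx; rewrite mxE (negbTE yx) mulrC.
Qed.

Lemma dotvDl (a b c : vec) : dotv (a + b) c = dotv a c + dotv b c.
Proof. by rewrite /dotv -big_split /=; apply: eq_bigr => y _; rewrite !mxE mulrDl. Qed.

Lemma dotvBl (a b c : vec) : dotv (a - b) c = dotv a c - dotv b c.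
Proof. by rewrite /dotv -sumrB; apply: eq_bigr => y _; rewrite !mxE mulrBl. Qed.

Lemma dotvBr (a b c : vec) : dotv a (b - c) = dotv a b - dotv a c.
Proof. by rewrite /dotv -sumrB; apply: eq_bigr => y _; rewrite !mxE mulrBr. Qed.

Lemma dotvZr (k : R) (a b : vec) : dotv a (k *: b) = k * dotv a b.
Proof. by rewrite /dotv mulr_sumr; apply: eq_bigr => y _; rewrite !mxE mulrCA. Qed.

Lemma entry_le_norm (v : vec) y : `|v 0 y| <= `|v|.
Proof. by rewrite [leRHS]/Num.Def.normr /= mx_normrE; apply/bigmax_geP; right => /=; exists (ord0, y). Qed.

Lemma orthant0 : @orthant R d 0. Proof. by move=> y; rewrite mxE. Qed.

Lemma cost_convex x p u a b : orthant a -> orthant b ->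
  cost L x p u a + dotv (offdiag x p + DL x a u) (b - a) + gam * dotv (b - a) (b - a)
    <= cost L x p u b.
Proof.
move=> oa ob; have := Lconv x u oa ob; rewrite !costE (dotvDl (offdiag x p)) (dotvBr (offdiag x p)) => h.
by lra.
Qed.

Lemma cost_sublevel_bounded x p u b c z : 0 <= c -> orthant b ->
  (forall y, - c <= (offdiag x p + DL x 0 u) 0 y) ->
  cost L x p u b <= cost L x p u 0 -> b 0 z <= c * ((1 + d.+1%:R) / (2 * gam)).
Proof.
move=> c0 ob hc hb; have := @quadratic_sublevel _ _ gam c (fun y => b 0 y) z gam0 c0.
rewrite card_ord; apply.
have := le_trans (cost_convex x p u orthant0 ob) hb.
rewrite subr0 -(addrA (cost L x p u 0)) gerDl; apply: le_trans.
rewrite /dotv mulr_sumr -big_split /=; apply: ler_sum => y _.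
have := hc y; have := ob y; set w := (offdiag x p + DL x 0 u) 0 y => bw cw.
by rewrite addrC expr2; have := mulr_ge0 bw (_ : 0 <= w + c); move=> /(_ _); lra.
Qed.

(** A minimizing filter in a box that contains every control better than [0] has a
    cluster point [a]. The tangent inequality at [a] then plays the part of lower
    semicontinuity: it bounds the costs near [a] from below by the cost at [a]. *)
Lemma cost_minimizer x p u : exists a, orthant a /\ forall b, orthant b -> cost L x p u a <= cost L x p u b.
Proof.
pose c := \sum_y `|(offdiag x p + DL x 0 u) 0 y|.
have c0 : 0 <= c by exact: sumr_ge0.
have hc y : - c <= (offdiag x p + DL x 0 u) 0 y.
  rewrite lerNl; apply: (le_trans (ler_norm _)); rewrite normrN /c (bigD1 y)//= lerDl.
  exact: sumr_ge0.
pose r := c * ((1 + d.+1%:R) / (2 * gam)).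
have r0 : 0 <= r by rewrite mulr_ge0// divr_ge0 ?mulr_ge0 ?(ltW gam0)// addr_ge0.
pose box : set vec := [set a | forall y, `[0, r]%classic (a 0 y)].
have cbox : compact box by apply: (@rV_compact _ _ (fun _ => `[0, r]%classic)) => y; exact: segment_compact.
have box_orthant a : box a -> orthant a.
  by move=> ba y; have := ba y; rewrite /= in_itv /= => /andP[].
have box0 : box 0 by move=> y; rewrite mxE /= in_itv /= lexx.
pose img := [set cost L x p u a | a in box].
have hinf : has_inf img.
  split; first by exists (cost L x p u 0), 0.
  exists (cost L x p u 0 - d.+1%:R * (c * r)) => _ [b bb <-].
  apply: le_trans (cost_convex x p u orthant0 (box_orthant _ bb)).
  rewrite subr0 -(addrA (cost L x p u 0)) lerD2l.
  apply: (@le_trans _ _ (dotv (offdiag x p + DL x 0 u) b)); last first.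
    rewrite lerDl mulr_ge0 ?(ltW gam0)//; apply: sumr_ge0 => y _; rewrite -expr2; exact: sqr_ge0.
  have -> : - (d.+1%:R * (c * r)) = \sum_(y < d.+1) - (c * r) by rewrite sum_const card_ord mulrN.
  apply: ler_sum => y _.
  have := hc y; have := bb y; rewrite /= in_itv /= => /andP[b0 br]; set w := (offdiag x p + DL x 0 u) 0 y => cw.
  have : 0 <= (w + c) * b 0 y by rewrite mulr_ge0//; lra.
  have : 0 <= c * (r - b 0 y) by rewrite mulr_ge0//; lra.
  by lra.
pose m := inf img.
pose F := filter_from [set e : R | 0 < e] (fun e => [set a | box a /\ cost L x p u a <= m + e]).
have FF : ProperFilter F.
  apply: filter_from_proper; last first.
    move=> e /= e0; have [_ [a ba <-] ae] := inf_adherent e0 hinf.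
    by exists a; split => //; exact: ltW.
  apply: filter_from_filter; first by exists 1 => /=.
  move=> e e' /= e0 e0'; exists (Num.min e e'); first by rewrite /= lt_min e0.
  move=> a [ba ca]; split; split => //; apply: (le_trans ca).
    by rewrite lerD2l ge_min lexx.
  by rewrite lerD2l ge_min lexx orbT.
have Fbox : F box by exists 1 => //= a [].
have [a [ba Ha]] := cbox F FF Fbox.
have oa := box_orthant a ba.
have am : cost L x p u a <= m.
  apply/ler_addgt0Pl => e e0.
  pose q := offdiag x p + DL x a u.
  pose s := \sum_y `|q 0 y|; have s0 : 0 < 1 + s by rewrite ltr_pwDl// sumr_ge0.
  have e2 : 0 < e / 2 by lra.
  have e3 : 0 < e / 2 / (1 + s) by rewrite divr_gt0.
  have [b [[bb cb] bab]] := Ha _ _ (ex_intro2 _ _ (e / 2) e2 (@subset_refl _ _)) (nbhsx_ballx a _ e3).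
  have := cost_convex x p u oa (box_orthant _ bb).
  have : 0 <= gam * dotv (b - a) (b - a).
    by rewrite mulr_ge0 ?(ltW gam0)//; apply: sumr_ge0 => y _; rewrite -expr2; exact: sqr_ge0.
  have : `|dotv q (b - a)| <= e / 2.
    apply: (@le_trans _ _ (s * (e / 2 / (1 + s)))).
      apply: (le_trans (ler_norm_sum _ _ _)); rewrite /s mulr_suml; apply: ler_sum => y _.
      rewrite normrM; apply: ler_wpM2l => //; apply: (le_trans (entry_le_norm _ _)).
      by move: bab; rewrite mx_norm_ball /ball_ /= distrC => /ltW.
    by rewrite mulrCA ler_piMr ?(ltW e2)// ler_pdivrMr// mul1r; lra.
  rewrite -/q ler_norml => /andP[? ?] ? ?; lra.
exists a; split => // b ob.
case: (lerP (cost L x p u b) (cost L x p u 0)) => hb.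
  have bb : box b.
    by move=> y; rewrite /= in_itv /= (ob y)/=; exact: (cost_sublevel_bounded _ c0 ob hc hb).
  by apply: (le_trans am); apply: ge_inf; [exact: hinf.2|exists b].
apply: (le_trans am); apply: (le_trans _ (ltW hb)).
by apply: ge_inf; [exact: hinf.2|exists 0].
Qed.

Lemma astarP x p u : orthant (astar x p u) /\
  forall b, orthant b -> cost L x p u (astar x p u) <= cost L x p u b.
Proof. by have := xgetPex 0 (cost_minimizer x p u). Qed.

Lemma astar_ge0 x p u y : 0 <= astar x p u 0 y.
Proof. exact: (astarP x p u).1. Qed.

(** Otherwise a small step from the minimizer towards [b], which stays in the
    orthant by convexity, would lower the cost. *)
Lemma first_order x p u b : orthant b ->
  0 <= dotv (offdiag x p + DL x (astar x p u) u) (b - astar x p u).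
Proof.
move=> ob; set a := astar x p u; have [oa am] := astarP x p u; rewrite -/a in oa am.
set q := offdiag x p + _; rewrite leNgt; apply/negP => neg.
have ba : b - a != 0.
  by apply: contraTneq neg => ->; rewrite -leNgt -[0 : vec](scale0r 0) dotvZr mul0r.
have nba : 0 < `|b - a| by rewrite normr_gt0.
have e0 : 0 < - dotv q (b - a) / (2 * `|b - a|) by rewrite divr_gt0 ?oppr_gt0// mulr_gt0.
have /cvgrPdist_lt/(_ _ e0)/nbhs_ballP[r /= r0 Hr] := DLgrad x u oa.
pose s := Num.min 1 (r / (2 * `|b - a|)).
have s0 : 0 < s by rewrite lt_min ltr01 divr_gt0// mulr_gt0.
have s1 : s <= 1 by rewrite ge_min lexx.
have sr : s * `|b - a| < r.
  apply: (@le_lt_trans _ _ (r / (2 * `|b - a|) * `|b - a|)).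
    by rewrite ler_wpM2r// ge_min lexx orbT.
  have -> : r / (2 * `|b - a|) * `|b - a| = r / 2 by field; rewrite gt_eqF.
  lra.
pose a' := a + s *: (b - a).
have oa' : orthant a'.
  move=> y; rewrite !mxE; have := oa y; have := ob y; nra.
have a'a : a' - a = s *: (b - a) by rewrite /a' addrAC subrr add0r.
have na' : `|a' - a| = s * `|b - a| by rewrite a'a normrZ gtr0_norm.
have ne : a' != a by rewrite -subr_eq0 -normr_gt0 na' mulr_gt0.
have := Hr a' _ ne oa'; rewrite -ball_normE /= distrC na' => /(_ sr).
rewrite sub0r normrN a'a dotvZr => h.
have := am a' oa'; rewrite !costE => h2.
have E : dotv (offdiag x p) a' - dotv (offdiag x p) a = s * dotv (offdiag x p) (b - a).
  by rewrite -dotvBr a'a dotvZr.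
have E2 : dotv q (b - a) = dotv (offdiag x p) (b - a) + dotv (DL x a u) (b - a) by rewrite /q dotvDl.
have sn : 0 < s * `|b - a| by rewrite mulr_gt0.
have h3 : L x a' u - L x a u - s * dotv (DL x a u) (b - a) < - dotv q (b - a) / 2 * s.
  have := le_lt_trans (ler_norm _) h; rewrite ltr_pdivrMr//.
  have -> // : - dotv q (b - a) / (2 * `|b - a|) * (s * `|b - a|) = - dotv q (b - a) / 2 * s.
  by field; rewrite gt_eqF.
have : 0 < s * - dotv q (b - a) by rewrite mulr_gt0// oppr_gt0.
by rewrite E2 in h3 *; lra.
Qed.

(** This turns suboptimality into a distance between controls; it is the source of
    the quadratic term of [flow_duality]. *)
Lemma cost_growth x p u b : orthant b ->
  cost L x p u (astar x p u) + gam * dotv (b - astar x p u) (b - astar x p u) <= cost L x p u b.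
Proof.
move=> ob; have := cost_convex x p u (astarP x p u).1 ob.
by have := first_order x p u ob; lra.
Qed.

Lemma hamiltonianE x p u : hamiltonian L x p u = - cost L x p u (astar x p u).
Proof.
rewrite /hamiltonian; congr (- _); have [oa am] := astarP x p u.
apply/eqP; rewrite eq_le; apply/andP; split.
  by apply: ge_inf; [exists (cost L x p u (astar x p u)) => _ [b ob <-]; exact: am|exists (astar x p u)].
apply: lb_le_inf; first by exists (cost L x p u (astar x p u)), (astar x p u).
by move=> _ [b ob <-]; exact: am.
Qed.

Lemma hamiltonian_ge x p u a : orthant a -> - cost L x p u a <= hamiltonian L x p u.
Proof. by move=> oa; rewrite hamiltonianE lerN2; exact: (astarP x p u).2. Qed.

(** The minimizer moves at most proportionally to the perturbation of the first
    order condition at the old minimizer. *)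
Lemma astar_perturbation x p p' u u' eta : 0 <= eta ->
  (forall y, `|(offdiag x p' + DL x (astar x p u) u') 0 y -
               (offdiag x p + DL x (astar x p u) u) 0 y| <= eta) ->
  forall z, `|astar x p' u' 0 z - astar x p u 0 z| <= eta * ((1 + d.+1%:R) / (2 * gam)).
Proof.
move=> eta0; set a := astar x p u; set a' := astar x p' u' => He z.
have oa : orthant a := (astarP x p u).1; have oa' : orthant a' := (astarP x p' u').1.
have := @quadratic_sublevel _ _ gam eta (fun y => `|a' 0 y - a 0 y|) z gam0 eta0.
rewrite card_ord; apply.
have h1 := cost_convex x p' u' oa oa'.
have h2 := (astarP x p' u').2 a oa; rewrite -/a' in h2.
have h3 := first_order x p u oa'; rewrite -/a in h3.
set q := offdiag x p + _ in h3 He; set q' := offdiag x p' + _ in h1 He.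
have : gam * dotv (a' - a) (a' - a) + dotv (q' - q) (a' - a) <= 0 by rewrite (dotvBl q'); lra.
apply: le_trans; rewrite /dotv mulr_sumr -big_split /=; apply: ler_sum => y _.
rewrite !mxE real_normK ?num_real// -expr2 lerD2l.
have := He y; rewrite !mxE => hy; rewrite lerNl; apply: (le_trans (ler_norm _)).
by rewrite normrN normrM ler_wpM2r.
Qed.

Lemma offdiag_dist x p p' y : `|offdiag x p' 0 y - offdiag x p 0 y| <= `|p' 0 y - p 0 y|.
Proof. by rewrite !mxE; case: ifP => // _; rewrite subrr normr0. Qed.

Lemma astar_cvg (J : Type) (F : set_system J) (FF : Filter F) x (p_ : J -> vec) (u_ : J -> U) p u :
  (forall y, p_ j 0 y @[j --> F] --> p 0 y) -> u_ @ F --> u ->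
  forall z, astar x (p_ j) (u_ j) 0 z @[j --> F] --> astar x p u 0 z.
Proof.
move=> hp hu z; apply/cvgrPdist_le => e e0.
pose k := (1 + d.+1%:R) / (2 * gam) : R.
have k0 : 0 < k by rewrite divr_gt0 ?mulr_gt0// ltr_pwDl.
pose eta := e / k / 2; have eta0 : 0 < eta by apply: divr_gt0 => //; exact: divr_gt0.
have oa := (astarP x p u).1.
have H1 : \forall j \near F, forall y, `|p 0 y - p_ j 0 y| <= eta.
  apply: filter_forall => y.
  have /cvgrPdist_le/(_ _ eta0) := hp y; exact.
have H2 : \forall j \near F, `|DL x (astar x p u) u - DL x (astar x p u) (u_ j)| < eta.
  have : DL x (astar x p u) (u_ j) @[j --> F] --> DL x (astar x p u) u.
    by apply: cvg_comp hu _; exact: ((Lcont x oa).2 u).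
  by move=> /cvgrPdist_lt/(_ _ eta0).
near=> j.
have h1 : forall y, `|p 0 y - p_ j 0 y| <= eta by near: j.
have h2 : `|DL x (astar x p u) u - DL x (astar x p u) (u_ j)| < eta by near: j.
rewrite distrC; have -> : e = (eta + eta) * k.
  by rewrite -splitr divfK// gt_eqF.
apply: astar_perturbation; first by rewrite addr_ge0// ltW.
move=> y; rewrite [X in `|X - _|]mxE [X in `|_ - X|]mxE opprD addrACA.
apply: (le_trans (ler_normD _ _)); apply: lerD.
  by apply: (le_trans (offdiag_dist _ _ _ _)); rewrite distrC.
apply: le_trans (ltW h2).
rewrite -opprB normrN.
have := entry_le_norm (DL x (astar x p u) u - DL x (astar x p u) (u_ j)) y.
by rewrite !mxE.
Unshelve. all: by end_near. Qed.

Lemma dotv_cvg (J : Type) (F : set_system J) (FF : Filter F) (a_ b_ : J -> vec) a b :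
  (forall y, a_ j 0 y @[j --> F] --> a 0 y) -> (forall y, b_ j 0 y @[j --> F] --> b 0 y) ->
  dotv (a_ j) (b_ j) @[j --> F] --> dotv a b.
Proof.
move=> ha hb; rewrite /dotv; apply: cvg_fin_sum => y.
by apply: cvgM; [exact: ha|exact: hb].
Qed.

Lemma entry_cvg (J : Type) (F : set_system J) (FF : Filter F) (a_ : J -> vec) a y :
  a_ @ F --> a -> a_ j 0 y @[j --> F] --> a 0 y.
Proof.
move=> ha; apply/cvgrPdist_le => e e0; have /cvgrPdist_le/(_ _ e0) := ha.
apply: filterS => j; apply: le_trans.
by have := entry_le_norm (a - a_ j) y; rewrite !mxE.
Qed.

(** Joint continuity of the Hamiltonian, although [L] is only separately
    continuous: the cost of the fixed control [a = astar x p u] is an upper bound,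
    and convexity at [a] gives a lower bound with the same limit. *)
Lemma hamiltonian_cvg (J : Type) (F : set_system J) (FF : Filter F) x (p_ : J -> vec) (u_ : J -> U) p u :
  (forall y, p_ j 0 y @[j --> F] --> p 0 y) -> u_ @ F --> u ->
  hamiltonian L x (p_ j) (u_ j) @[j --> F] --> hamiltonian L x p u.
Proof.
move=> hp hu; set a := astar x p u; have oa : orthant a := (astarP x p u).1.
have hoff y : offdiag x (p_ j) 0 y @[j --> F] --> offdiag x p 0 y.
  apply/cvgrPdist_le => e e0; have /cvgrPdist_le/(_ _ e0) := hp y.
  by apply: filterS => j; apply: le_trans; exact: offdiag_dist.
have hcost : cost L x (p_ j) (u_ j) a @[j --> F] --> cost L x p u a.
  rewrite costE; under eq_cvg do rewrite costE.
  apply: cvgD; last exact: (cvg_comp _ _ hu ((Lcont x oa).1 u)).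
  by apply: dotv_cvg => // y; exact: cvg_cst.
have hDL y : DL x a (u_ j) 0 y @[j --> F] --> DL x a u 0 y.
  by apply: entry_cvg; exact: (cvg_comp _ _ hu ((Lcont x oa).2 u)).
pose r j := dotv (offdiag x (p_ j) + DL x a (u_ j)) (astar x (p_ j) (u_ j) - a).
have hr : r @ F --> (0 : R).
  have -> : (0 : R) = dotv (offdiag x p + DL x a u) (a - a).
    by rewrite subrr /dotv; under eq_bigr do rewrite [(0 : vec) _ _]mxE mulr0; rewrite big1.
  apply: dotv_cvg => y.
    by rewrite mxE; under eq_cvg do rewrite mxE; apply: cvgD.
  rewrite [(a - a) _ _]mxE; under eq_cvg do rewrite mxE; rewrite [(- a) _ _]mxE.
  by apply: cvgD; [exact: astar_cvg|exact: cvg_cst].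
rewrite [hamiltonian L x p u]hamiltonianE -/a.
apply: (@squeeze_cvgr _ _ _ _ (fun j => - cost L x (p_ j) (u_ j) a) (fun j => - cost L x (p_ j) (u_ j) a - r j)).
- near=> j; rewrite hamiltonian_ge//= hamiltonianE.
  have := cost_convex x (p_ j) (u_ j) oa (astarP x (p_ j) (u_ j)).1.
  set v := (astar x (p_ j) (u_ j) - a).
  have : 0 <= gam * dotv v v.
    by rewrite mulr_ge0 ?(ltW gam0)//; apply: sumr_ge0 => y _; rewrite -expr2; exact: sqr_ge0.
  by rewrite /r -/v; lra.
- by apply: cvgN.
- by rewrite -[X in _ --> X]subr0; apply: cvgB => //; apply: cvgN.
Unshelve. all: by end_near. Qed.

Section bounds.
Hypothesis U_compact : compact [set: U].

Lemma compact_bounded_fun (W : normedModType R) (f : U -> W) : continuous f ->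
  exists2 C, 0 <= C & forall u, `|f u| <= C.
Proof.
move=> cf; have [M [_ HM]] := compact_bounded (continuous_compact (continuous_subspaceT cf) U_compact).
exists (Num.max 0 (M + 1)) => [|u]; first by rewrite le_max lexx.
rewrite le_max; apply/orP; right; apply: (HM (M + 1)); first by rewrite ltrDl.
by exists u.
Qed.

Lemma gradient_bounded : exists2 C, 0 <= C & forall x u y, `|DL x 0 u 0 y| <= C.
Proof.
have /choice[c Hc] : forall x, exists C, 0 <= C /\ forall u, `|DL x 0 u| <= C.
  by move=> x; have [C C0 HC] := compact_bounded_fun (Lcont x orthant0).2; exists C.
exists (\sum_x c x) => [|x u y]; first by apply: sumr_ge0 => x _; exact: (Hc x).1.
apply: (le_trans (entry_le_norm _ _)); apply: (le_trans ((Hc x).2 u)).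
by rewrite (bigD1 x)//= lerDl sumr_ge0// => z _; exact: (Hc z).1.
Qed.

(** A lower bound on the momentum suffices: where [p 0 y] is large, jumping to [y] is
    expensive and the optimal rate stays small. *)
Lemma astar_bounded K : 0 <= K -> exists2 A, 0 <= A &
  forall x p u, (forall y, y != x -> - K <= p 0 y) -> forall z, `|astar x p u 0 z| <= A.
Proof.
move=> K0; have [C C0 HC] := gradient_bounded.
exists ((K + C) * ((1 + d.+1%:R) / (2 * gam))).
  by rewrite mulr_ge0 ?addr_ge0// divr_ge0 ?mulr_ge0 ?(ltW gam0)// addr_ge0.
move=> x p u hp z; rewrite ger0_norm ?astar_ge0//.
apply: (@cost_sublevel_bounded x p u) => //.
- by rewrite addr_ge0.
- exact: (astarP x p u).1.
- move=> y; rewrite !mxE; have := HC x u y; rewrite ler_norml => /andP[? ?].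
  by case: eqVneq => [_|/hp ?]; lra.
- by apply: (astarP x p u).2; exact: orthant0.
Qed.

(** Resting costs at most a constant, and the cost of an arbitrary control is bounded
    below by the minimum of a quadratic function. *)
Lemma running_cost_bounded : exists2 C, 0 <= C & forall x u,
  (forall p, - C <= hamiltonian L x p u) /\ (forall a, orthant a -> - C <= L x a u).
Proof.
have [B B0 HB] := gradient_bounded.
have /choice[c Hc] : forall x, exists C, 0 <= C /\ forall u, `|L x 0 u| <= C.
  by move=> x; have [C C0 HC] := compact_bounded_fun (Lcont x orthant0).1; exists C.
pose C1 := \sum_x c x; pose C2 := d.+1%:R * (B ^+ 2 / (4 * gam)).
have C10 : 0 <= C1 by apply: sumr_ge0 => x _; exact: (Hc x).1.
have C20 : 0 <= C2 by rewrite mulr_ge0// divr_ge0 ?sqr_ge0// mulr_ge0// ltW.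
have HL0 x u : `|L x 0 u| <= C1.
  apply: (le_trans ((Hc x).2 u)).
  by rewrite /C1 (bigD1 x)//= lerDl sumr_ge0// => z _; exact: (Hc z).1.
exists (C1 + C2) => [|x u]; first by rewrite addr_ge0.
have := HL0 x u; rewrite ler_norml => /andP[h1 h2].
split => [p|a oa].
  apply: le_trans (hamiltonian_ge x p u orthant0).
  rewrite /cost big1 ?add0r; last by move=> y _; rewrite mxE mul0r.
  by lra.
have := Lconv x u orthant0 oa; rewrite subr0 => h3.
suff : - C2 <= dotv (DL x 0 u) a + gam * dotv a a by lra.
have -> : - C2 = \sum_(y < d.+1) - (B ^+ 2 / (4 * gam)) by rewrite sum_const card_ord mulrN.
rewrite /dotv mulr_sumr -big_split /=; apply: ler_sum => y _.
have := HB x u y; rewrite ler_norml => /andP[h4 h5]; have ay := oa y.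
have : 0 <= gam * (a 0 y - B / (2 * gam)) ^+ 2 by rewrite mulr_ge0 ?sqr_ge0// ltW.
have -> : gam * (a 0 y - B / (2 * gam)) ^+ 2 = gam * (a 0 y * a 0 y) - B * a 0 y + B ^+ 2 / (4 * gam).
  by field; rewrite gt_eqF.
have : 0 <= (DL x 0 u 0 y + B) * a 0 y by rewrite mulr_ge0//; lra.
by lra.
Qed.

End bounds.

(** The control optimal for one momentum is a candidate for the other, and its cost
    changes at a speed bounded by its size. *)
Lemma hamiltonian_lipschitz A x p p' u :
  (forall z, `|astar x p u 0 z| <= A) -> (forall z, `|astar x p' u 0 z| <= A) ->
  `|hamiltonian L x p u - hamiltonian L x p' u| <= A * \sum_y `|p 0 y - p' 0 y|.
Proof.
have half q q' : (forall z, `|astar x q u 0 z| <= A) ->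
    hamiltonian L x q u - hamiltonian L x q' u <= A * \sum_y `|q 0 y - q' 0 y|.
  move=> hA; have := hamiltonian_ge x q' u (astarP x q u).1.
  rewrite [hamiltonian L x q u]hamiltonianE => h.
  apply: (@le_trans _ _ (cost L x q' u (astar x q u) - cost L x q u (astar x q u))); first by lra.
  rewrite /cost opprD addrACA subrr addr0 -sumrB mulr_sumr [leRHS](bigID (fun y => y != x))/=.
  apply: ler_wpDr; first by apply: sumr_ge0 => y _; rewrite mulr_ge0// (le_trans _ (hA y)).
  apply: ler_sum => y _; rewrite -mulrBr; apply: (le_trans (ler_norm _)).
  by rewrite normrM distrC ler_wpM2r.
move=> h1 h2; rewrite ler_norml half// andbT lerNl opprB.
apply: (le_trans (half p' p h2)).
by under eq_bigr do rewrite distrC.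
Qed.

End control.

Section regular_control.
Context {R : realType} {d : nat} {U : pmetricType R}.
Local Notation Sigma := 'I_d.+1.
Local Notation vec := 'rV[R]_d.+1.
Implicit Types (x y z : Sigma) (p a b : vec) (u : U).

(** The properties of the minimizer and of the Hamiltonian through which alone the
    running cost enters the analysis of the two equations; the gradient of the cost
    is eliminated here. *)
Record regular_control (L : Sigma -> vec -> U -> R) (gam CL : R) : Prop := {
  rc_gam_gt0 : 0 < gam;
  rc_CL_ge0 : 0 <= CL;
  rc_orthant : forall x p u, orthant (optimal_control L x p u);
  rc_growth : forall x p u b, orthant b ->
    cost L x p u (optimal_control L x p u) +
      gam * dotv (b - optimal_control L x p u) (b - optimal_control L x p u)
    <= cost L x p u b;
  rc_hamiltonian : forall x p u, hamiltonian L x p u = - cost L x p u (optimal_control L x p u);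
  rc_control_cvg : forall (J : Type) (F : set_system J) (FF : Filter F) x (p_ : J -> vec)
      (u_ : J -> U) p u,
    (forall y, p_ j 0 y @[j --> F] --> p 0 y) -> u_ @ F --> u ->
    forall z, optimal_control L x (p_ j) (u_ j) 0 z @[j --> F] --> optimal_control L x p u 0 z;
  rc_hamiltonian_cvg : forall (J : Type) (F : set_system J) (FF : Filter F) x (p_ : J -> vec)
      (u_ : J -> U) p u,
    (forall y, p_ j 0 y @[j --> F] --> p 0 y) -> u_ @ F --> u ->
    hamiltonian L x (p_ j) (u_ j) @[j --> F] --> hamiltonian L x p u;
  rc_bounded : forall K, 0 <= K -> exists2 A, 0 <= A & forall x p u,
    (forall y, y != x -> - K <= p 0 y) -> forall z, `|optimal_control L x p u 0 z| <= A;
  rc_hamiltonian_lipschitz : forall A x p (p' : vec) u,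
    (forall z, `|optimal_control L x p u 0 z| <= A) ->
    (forall z, `|optimal_control L x p' u 0 z| <= A) ->
    `|hamiltonian L x p u - hamiltonian L x p' u| <= A * \sum_y `|p 0 y - p' 0 y|;
  rc_hamiltonian_lb : forall x p u, - CL <= hamiltonian L x p u;
  rc_cost_lb : forall x a u, orthant a -> - CL <= L x a u }.

Lemma strongly_convex_regular (L : Sigma -> vec -> U -> R) :
  compact [set: U] -> strongly_convex_cost L ->
  exists gam CL, regular_control L gam CL.
Proof.
move=> cU [DL [DLgrad Lcont [gam gam0 Lconv]]].
have [CL CL0 HCL] := running_cost_bounded gam0 Lconv Lcont cU.
exists gam, CL; split => //.
- by move=> x p u; exact: (astarP gam0 Lconv x p u).1.
- by move=> x p u b; exact: (cost_growth gam0 DLgrad Lconv).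
- by move=> x p u; exact: (hamiltonianE gam0 Lconv).
- by move=> J F FF x p_ u_ p u; exact: (astar_cvg gam0 DLgrad Lconv Lcont).
- by move=> J F FF x p_ u_ p u; exact: (hamiltonian_cvg gam0 DLgrad Lconv Lcont).
- by move=> K; exact: (astar_bounded gam0 Lconv Lcont cU).
- by move=> A x p p' u; exact: (hamiltonian_lipschitz gam0 Lconv).
- by move=> x p u; exact: (HCL x u).1.
- by move=> x a u; exact: (HCL x u).2.
Qed.

End regular_control.

(** * The Hamilton-Jacobi equation *)

Section generator.
Context {R : realType} {d : nat} {U : pmetricType R}.
Local Notation Sigma := 'I_d.+1.
Local Notation vec := 'rV[R]_d.+1.
Implicit Types (x y z : Sigma) (a b : vec) (w : Sigma -> R).

(** Row [x] of the generator of the Markov chain that leaves [x] with rates [a]. *)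
Definition generator a x y : R := if x == y then - \sum_(z | z != y) a 0 z else a 0 y.

Lemma jump_rateE (L : Sigma -> vec -> U -> R) (v : Sigma -> R) (u : U) x y :
  jump_rate L v u x y = generator (optimal_control L x (grad v x) u) x y.
Proof. by rewrite /jump_rate /generator; case: eqP => // ->. Qed.

Lemma generator_sum a x w : \sum_y generator a x y * w y = \sum_(y | y != x) a 0 y * (w y - w x).
Proof.
rewrite (bigD1 x)//= {1}/generator eqxx mulNr mulr_suml -sumrN -big_split /=.
by apply: eq_bigr => y yx; rewrite /generator eq_sym (negbTE yx) mulrBr addrC.
Qed.

Lemma generator_sum0 a x : \sum_y generator a x y = 0.
Proof.
have := generator_sum a x (fun _ => 1); under eq_bigr do rewrite mulr1.
by move=> ->; apply: big1 => y _; rewrite subrr mulr0.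
Qed.

Lemma generator_bound A a x y : 0 <= A -> (forall z, `|a 0 z| <= A) ->
  `|generator a x y| <= d.+1%:R * A.
Proof.
move=> A0 aA; have h : A <= d.+1%:R * A by rewrite ler_peMl// ler1n.
rewrite /generator; case: ifP => _; last exact: le_trans (aA y) h.
rewrite normrN; apply: (le_trans (ler_norm_sum _ _ _)).
apply: (@le_trans _ _ (\sum_(z < d.+1) A)); last by rewrite sum_const card_ord.
rewrite [leRHS](bigID (fun z => z != y))/= ler_wpDr//; first exact: sumr_ge0.
exact: ler_sum.
Qed.

Lemma generatorB a b x y : generator a x y - generator b x y = generator (a - b) x y.
Proof.
rewrite /generator; case: ifP => _; last by rewrite !mxE.
rewrite -opprD; congr (- _); rewrite -sumrN -big_split /=; apply: eq_bigr => z _.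
by rewrite !mxE.
Qed.

Lemma generator_ge0 a x y : orthant a -> x != y -> 0 <= generator a x y.
Proof. by rewrite /generator => oa /negbTE ->; exact: oa. Qed.

(** Cauchy-Schwarz against the indicator of [P]. *)
Lemma sqr_sum_le (I : finType) (P : pred I) (c : I -> R) :
  (\sum_(i | P i) c i) ^+ 2 <= #|I|%:R * \sum_i c i ^+ 2.
Proof.
pose c' i := if P i then c i else 0.
have -> : \sum_(i | P i) c i = \sum_i c' i by rewrite big_mkcond.
apply: (@le_trans _ _ (#|I|%:R * \sum_i c' i ^+ 2)); last first.
  rewrite ler_wpM2l//; apply: ler_sum => i _; rewrite /c'; case: ifP => _ //.
  by rewrite expr0n sqr_ge0.
rewrite expr2 mulr_suml.
have -> : #|I|%:R * (\sum_i c' i ^+ 2) = \sum_i \sum_j (c' i ^+ 2 / 2 + c' j ^+ 2 / 2).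
  rewrite [RHS](eq_bigr (fun i => #|I|%:R * (c' i ^+ 2 / 2) + \sum_j c' j ^+ 2 / 2)); last first.
    by move=> i _; rewrite big_split /= sum_const.
  by rewrite big_split /= sum_const -mulr_sumr -mulr_suml; lra.
apply: ler_sum => i _; rewrite mulr_sumr; apply: ler_sum => j _.
by have := sqr_ge0 (c' i - c' j); rewrite !expr2; lra.
Qed.

Lemma generator_sqr a x y : generator a x y ^+ 2 <= d.+1%:R * dotv a a.
Proof.
have E : dotv a a = \sum_z a 0 z ^+ 2 by apply: eq_bigr => z _; rewrite expr2.
rewrite E -[X in X%:R * _](card_ord d.+1) /generator; case: ifP => _.
  by rewrite sqrrN; exact: sqr_sum_le.
apply: le_trans (sqr_sum_le (pred1 y) (fun z => a 0 z)).
by rewrite big_pred1_eq.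
Qed.

End generator.

Section equations.
Context {R : realType} {d : nat} {U : pmetricType R}.
Local Notation Sigma := 'I_d.+1.
Local Notation vec := 'rV[R]_d.+1.
Variables (L : Sigma -> vec -> U -> R) (gam CL T CF : R).
Hypothesis rc : regular_control L gam CL.
Hypothesis T0 : 0 < T.
Hypothesis CF0 : 0 <= CF.
Implicit Types (x y z : Sigma) (u : U) (V f m : R -> Sigma -> R) (g v : Sigma -> R) (t s : R).

Local Notation astar := (optimal_control L).
Local Notation H := (hamiltonian L).

Definition coupling_data f g :=
  (forall t x, t \in `[0, T] -> `|f t x| <= CF) /\ forall x, `|g x| <= CF.

Definition hjb u f g V :=
  (forall x, V T x = g x) /\
  forall t x, t \in `[0, T] -> has_derivative T (V ^~ x) t (H x (grad (V t) x) u - f t x).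

Definition clip (K : R) (p : vec) : vec := \row_y Num.max (- K) (p 0 y).

(** By [rc_bounded], momenta bounded below have bounded optimal rates, so the
    truncated right-hand side is globally Lipschitz. *)
Definition hjb_clip K u f g V :=
  (forall x, V T x = g x) /\
  forall t x, t \in `[0, T] -> has_derivative T (V ^~ x) t (H x (clip K (grad (V t) x)) u - f t x).

Definition kolmogorov u V (m0 : Sigma -> R) m :=
  (forall x, m 0 x = m0 x) /\
  forall t x, t \in `[0, T] -> has_derivative T (m ^~ x) t (\sum_y m t y * jump_rate L (V t) u y x).

Let T0' : 0 <= T. Proof. exact: ltW. Qed.
Let inrev t : t \in `[0, T] -> T - t \in `[0, T].
Proof. by rewrite !in_itv /= => /andP[? ?]; lra. Qed.

Lemma icontinuous_rev (h : R -> R) : icontinuous T h -> icontinuous T (fun s => h (T - s)).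
Proof.
move=> ch t.
have -> : (fun s => h (T - s)) \o clamp T = (h \o clamp T) \o (fun s => T - clamp T s).
  by apply/funext => s /=; rewrite [in RHS](clamp_id (inrev (clamp_itv s T0'))).
apply: continuous_comp; last exact: ch.
by apply: cvgB; [exact: cvg_cst|exact: clamp_continuous].
Qed.

Lemma hjb_icontinuous u f g V : hjb u f g V -> forall x, icontinuous T (V ^~ x).
Proof. by move=> [_ hV] x; apply: has_derivative_icontinuous => // t tT; eexists; exact: hV. Qed.

Definition value_bound : R := CF + (CL + CF) * T.

Lemma value_bound_ge0 : 0 <= value_bound.
Proof. by rewrite addr_ge0// mulr_ge0// addr_ge0// (rc_CL_ge0 rc). Qed.

(** Maximum principle, with a bound independent of the level [K] of truncation. From
    above, resting is always possible. From below, the function [w] in the proof is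
    a supersolution of a linear system with nonnegative off-diagonal coefficients,
    because truncation only increases the momentum. *)
Lemma hjb_clip_bound K u f g V : 0 <= K -> coupling_data f g -> hjb_clip K u f g V ->
  forall t x, t \in `[0, T] -> `|V t x| <= value_bound.
Proof.
move=> K0 [fb gb] [VT HV] t x tT.
have CL0 := rc_CL_ge0 rc.
have clipK p y : - K <= clip K p 0 y by rewrite mxE le_max lexx.
have [A A0 HA] := rc_bounded rc K0.
have up : V t x <= value_bound.
  have := @has_derivative_nondecreasing R T (fun s => V s x + (CL + CF) * s)
    (fun s => (H x (clip K (grad (V s) x)) u - f s x) + (CL + CF) * 1) t T.
  move: (tT); rewrite in_itv /= => /andP[t0 tT'] /(_ _ t0 tT' (lexx T)) h.
  have : V t x + (CL + CF) * t <= V T x + (CL + CF) * T.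
    apply: h => s sT.
      apply: has_derivativeD; first exact: HV.
      by apply: has_derivativeZ => //; exact: has_derivative_id.
    have sT' : s \in `[0, T] by move: sT; rewrite !in_itv /= => /andP[? ?]; lra.
    have := fb s x sT'; rewrite ler_norml => /andP[? ?].
    by have := rc_hamiltonian_lb rc x (clip K (grad (V s) x)) u; lra.
  have := gb x; rewrite -VT ler_norml => /andP[? ?].
  have : 0 <= (CL + CF) * t by rewrite mulr_ge0// addr_ge0.
  by rewrite /value_bound; lra.
have low : - value_bound <= V t x; last by rewrite ler_norml low up.
pose w s z := V (T - s) z + (CF + (CL + CF) * s).
pose a s z := astar z (clip K (grad (V (T - s)) z)) u.
pose dw s z := - (H z (clip K (grad (V (T - s)) z)) u - f (T - s) z) + (CL + CF).
have wpos : forall s z, s \in `[0, T] -> 0 <= w s z.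
  apply: (@quasi_positive R 'I_d.+1 T (d.+1%:R * A) w dw (fun s z y => generator (a s z) z y)).
  - by rewrite mulr_ge0.
  - move=> s z sT; apply: has_derivativeD.
      by apply: (@has_derivative_rev R T (V ^~ z)) => //; apply: HV; exact: inrev.
    rewrite -[X in has_derivative _ _ _ X]add0r; apply: has_derivativeD; first exact: has_derivative_cst.
    rewrite -[X in has_derivative _ _ _ X]mulr1; apply: has_derivativeZ => //; exact: has_derivative_id.
  - move=> s z sT; rewrite generator_sum /dw (rc_hamiltonian rc) /cost -/(a s z).
    have := fb _ z (inrev sT); rewrite ler_norml => /andP[? ?].
    have := rc_cost_lb rc z u (rc_orthant rc z (clip K (grad (V (T - s)) z)) u); rewrite -/(a s z) => ?.
    suff : \sum_(y | y != z) a s z 0 y * (w s y - w s z) <=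
      \sum_(y | y != z) a s z 0 y * clip K (grad (V (T - s)) z) 0 y by lra.
    apply: ler_sum => y _; apply: ler_wpM2l; first exact: (rc_orthant rc).
    by rewrite !mxE le_max; apply/orP; right; rewrite /w; lra.
  - by move=> s z y _ zy; apply: generator_ge0 => //; exact: (rc_orthant rc).
  - by move=> s z y _; apply: generator_bound => // k; apply: HA.
  - move=> z; rewrite /w subr0 VT mulr0 addr0.
    by have := gb z; rewrite ler_norml => /andP[? ?]; lra.
have := wpos (T - t) x (inrev tT); rewrite /w subKr => h.
move: tT; rewrite in_itv /= => /andP[t0 tT'].
have : (CL + CF) * (T - t) <= (CL + CF) * T by rewrite ler_wpM2l ?addr_ge0//; lra.
by rewrite /value_bound; lra.
Qed.

Lemma clip_id K v x : (forall y, `|v y| <= K) -> clip (2 * K) (grad v x) = grad v x.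
Proof.
move=> vK; apply/rowP => y; rewrite !mxE; apply/max_idPr.
have := vK x; have := vK y; rewrite !ler_norml => /andP[? ?] /andP[? ?]; lra.
Qed.

(** A solution is bounded by continuity, hence solves the equation truncated at some
    level, and the bound of [hjb_clip_bound] does not depend on that level. *)
Lemma hjb_bound u f g V : coupling_data f g -> hjb u f g V ->
  forall t x, t \in `[0, T] -> `|V t x| <= value_bound.
Proof.
move=> fg hV.
have /choice[B HB] : forall x, exists B, forall t : R, t \in `[0, T] -> `|V t x| <= B.
  by move=> x; apply: (icontinuous_bounded (f := V ^~ x)) => //; exact: (hjb_icontinuous hV).
pose K := \sum_x `|B x|.
have VK t x : t \in `[0, T] -> `|V t x| <= K.
  move=> tT; apply: (le_trans (HB x t tT)); apply: (le_trans (ler_norm _)).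
  by rewrite /K (bigD1 x)//= lerDl sumr_ge0.
have K0 : 0 <= K by exact: sumr_ge0.
apply: (@hjb_clip_bound (2 * K) u f g V) => //; first by rewrite mulr_ge0.
case: hV => VT HV; split => // t x tT; rewrite clip_id; first exact: HV.
by move=> y; exact: VK.
Qed.

Lemma gradB_sum v v' x : \sum_y `|grad v x 0 y - grad v' x 0 y| <=
  d.+2%:R * \sum_y `|v y - v' y|.
Proof.
apply: (@le_trans _ _ (\sum_y (`|v y - v' y| + `|v x - v' x|))).
  apply: ler_sum => y _; rewrite !mxE.
  have -> : v y - v x - (v' y - v' x) = (v y - v' y) - (v x - v' x) by ring.
  exact: ler_normB.
rewrite big_split /= sum_const card_ord -(natr1 d.+1) mulrDl mul1r addrC lerD2r ler_wpM2l//.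
by rewrite (bigD1 x)//= lerDl sumr_ge0.
Qed.

Lemma clipB K (p p' : vec) y : `|clip K p 0 y - clip K p' 0 y| <= `|p 0 y - p' 0 y|.
Proof.
rewrite !mxE; have [h1|h1] := leP (- K) (p 0 y); have [h2|h2] := leP (- K) (p' 0 y) => //.
- by rewrite !ger0_norm; lra.
- by rewrite ler0_norm ?[X in _ <= X]ler0_norm; lra.
- by rewrite subrr normr0.
Qed.

Lemma grad_cvg (J : Type) (F : set_system J) (FF : Filter F) (v_ : J -> Sigma -> R) v x :
  (forall y, v_ j y @[j --> F] --> v y) ->
  forall y, grad (v_ j) x 0 y @[j --> F] --> grad v x 0 y.
Proof. by move=> hv y; rewrite mxE; under eq_cvg do rewrite mxE; apply: cvgB. Qed.

(** Picard iteration backwards in time for the equation truncated at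
    [2 * value_bound], a level that the a priori bound keeps from being reached. *)
Lemma hjb_exists u f g : (forall x, icontinuous T (f ^~ x)) -> coupling_data f g ->
  exists V, hjb u f g V.
Proof.
move=> fc fg.
pose K := 2 * value_bound; have K0 : 0 <= K by rewrite mulr_ge0// value_bound_ge0.
have [A A0 HA] := rc_bounded rc K0.
have clipK p y : - K <= clip K p 0 y by rewrite mxE le_max lexx.
have [||||W [W0 HW]] := @picard R 'I_d.+1 T (A * (d.+2%:R * d.+1%:R))
  (fun s (v : Sigma -> R) x => - (H x (clip K (grad v x)) u - f (T - s) x)) g.
- exact: T0.
- by rewrite !mulr_ge0.
- move=> y cy x; apply: icontinuousN; apply: icontinuousB; last exact: (@icontinuous_rev (f ^~ x) (fc x)).
  move=> t; apply: (rc_hamiltonian_cvg rc) => //; last exact: cvg_cst.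
  move=> z; apply/cvgrPdist_le => e e0.
  have : grad (y (clamp T s)) x 0 z @[s --> nbhs t] --> grad (y (clamp T t)) x 0 z.
    by apply: grad_cvg => k; exact: (cy k t).
  by move=> /cvgrPdist_le/(_ _ e0); apply: filterS => s; apply: le_trans; exact: clipB.
- move=> t y z r x tT yz.
  have -> : - (H x (clip K (grad y x)) u - f (T - t) x) - - (H x (clip K (grad z x)) u - f (T - t) x)
    = - (H x (clip K (grad y x)) u - H x (clip K (grad z x)) u) by ring.
  rewrite normrN; apply: (le_trans (rc_hamiltonian_lipschitz rc (A := A) _ _)).
  + by move=> k; apply: HA => j _; exact: clipK.
  + by move=> k; apply: HA => j _; exact: clipK.
  rewrite -mulrA ler_wpM2l//.
  apply: (@le_trans _ _ (\sum_k `|grad y x 0 k - grad z x 0 k|)).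
    by apply: ler_sum => k _; exact: clipB.
  apply: (le_trans (gradB_sum _ _ _)); rewrite -mulrA ler_wpM2l//.
  by rewrite -[in leRHS](card_ord d.+1) -sum_const; apply: ler_sum.
pose V t x := W (T - t) x.
have hV : hjb_clip K u f g V.
  split; first by move=> x; rewrite /V subrr W0.
  move=> t x tT; have h := has_derivative_rev tT (HW _ x (inrev tT)).
  by move: h; rewrite opprK subKr.
exists V; split => [x|t x tT]; first exact: hV.1.
rewrite -(@clip_id value_bound (V t) x); first exact: hV.2.
by move=> y; apply: (hjb_clip_bound K0 fg hV).
Qed.

(** The bound is the same for all [u] and all data; this uniformity is what makes the
    constants below independent of [u]. *)
Lemma hjb_rate_bound : exists2 A, 0 <= A & forall u v, (forall y, `|v y| <= value_bound) ->
  forall x z, `|astar x (grad v x) u 0 z| <= A.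
Proof.
have K0 : 0 <= 2 * value_bound by rewrite mulr_ge0// value_bound_ge0.
have [A A0 HA] := rc_bounded rc K0; exists A => // u v vb x z.
by apply: HA => y _; rewrite -(clip_id x vb) mxE le_max lexx.
Qed.

Lemma hjb_stability e : 0 < e -> exists2 del, 0 < del & forall u u' f f' g g' V V',
  coupling_data f g -> coupling_data f' g' -> hjb u f g V -> hjb u' f' g' V' ->
  (forall t x, t \in `[0, T] -> `|f' t x - f t x| <= del) ->
  (forall x, `|g' x - g x| <= del) ->
  (forall t x, t \in `[0, T] -> `|H x (grad (V t) x) u' - H x (grad (V t) x) u| <= del) ->
  forall t x, t \in `[0, T] -> `|V' t x - V t x| <= e.
Proof.
move=> e0; have [A A0 HA] := hjb_rate_bound.
have K0 : 0 <= A * d.+2%:R by rewrite mulr_ge0.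
have [del d0 Hdel] := @ode_stability R 'I_d.+1 T (A * d.+2%:R) e T0' K0 e0.
exists (del / 2); first by rewrite divr_gt0.
move=> u u' f f' g g' V V' fg fg' hV hV' ff gg hh t x tT.
have b := hjb_bound fg hV; have b' := hjb_bound fg' hV'.
have := Hdel (fun s x => V' (T - s) x - V (T - s) x)
  (fun s x => - (H x (grad (V' (T - s)) x) u' - f' (T - s) x) - - (H x (grad (V (T - s)) x) u - f (T - s) x)).
move=> /(_ _ _ _ (T - t) x (inrev tT)); rewrite !subKr; apply.
- move=> s y sT; apply: has_derivativeB => //.
    by apply: (@has_derivative_rev R T (V' ^~ y)) => //; apply: hV'.2; exact: inrev.
  by apply: (@has_derivative_rev R T (V ^~ y)) => //; apply: hV.2; exact: inrev.
- move=> y; rewrite !subr0 hV.1 hV'.1; apply: (le_trans (gg y)); lra.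
- move=> s y /inrev sT.
  set V1 := V' (T - s); set V2 := V (T - s).
  have -> : - (H y (grad V1 y) u' - f' (T - s) y) - - (H y (grad V2 y) u - f (T - s) y) =
    - (H y (grad V1 y) u' - H y (grad V2 y) u') - (H y (grad V2 y) u' - H y (grad V2 y) u)
    + (f' (T - s) y - f (T - s) y) by ring.
  have h1 := ff _ y sT; have h2 := hh _ y sT; rewrite -/V2 in h2.
  have h3 : `|H y (grad V1 y) u' - H y (grad V2 y) u'| <= A * d.+2%:R * \sum_j `|V1 j - V2 j|.
    apply: (le_trans (rc_hamiltonian_lipschitz rc (A := A) _ _)).
    + by move=> z; apply: HA => k; exact: b'.
    + by move=> z; apply: HA => k; exact: b.
    by rewrite -mulrA ler_wpM2l// gradB_sum.
  apply: (le_trans (ler_normD _ _)); rewrite [del]splitr addrA; apply: lerD => //.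
  by apply: (le_trans (ler_normB _ _)); rewrite normrN; apply: lerD.
Qed.

Lemma hjb_unique u f g V V' : coupling_data f g -> hjb u f g V -> hjb u f g V' ->
  forall t x, t \in `[0, T] -> V' t x = V t x.
Proof.
move=> fg hV hV' t x tT; apply/eqP; rewrite -subr_eq0 -normr_le0; apply/ler_addgt0Pl => e e0.
rewrite addr0; have [del d0 Hd] := hjb_stability e0.
by apply: (Hd u u f f g g) => // *; rewrite subrr normr0 ltW.
Qed.

End equations.

(** * The Kolmogorov equation and weak duality *)

Section flows.
Context {R : realType} {d : nat} {U : pmetricType R}.
Local Notation Sigma := 'I_d.+1.
Local Notation vec := 'rV[R]_d.+1.
Variables (L : Sigma -> vec -> U -> R) (gam CL T CF : R).
Hypothesis rc : regular_control L gam CL.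
Hypothesis T0 : 0 < T.
Hypothesis CF0 : 0 <= CF.
Implicit Types (x y z : Sigma) (u : U) (V f m : R -> Sigma -> R) (g v ini : Sigma -> R) (t s : R).

Local Notation astar := (optimal_control L).
Local Notation H := (hamiltonian L).
Local Notation data := (coupling_data T CF).

Let T0' : 0 <= T. Proof. exact: ltW. Qed.

Lemma jump_rate_bound : exists2 B, 0 <= B & forall u f g V, data f g -> hjb L T u f g V ->
  forall t y x, t \in `[0, T] -> `|jump_rate L (V t) u y x| <= B.
Proof.
have [A A0 HA] := hjb_rate_bound rc T0 CF0.
exists (d.+1%:R * A); first by rewrite mulr_ge0.
move=> u f g V fg hV t y x tT; rewrite jump_rateE; apply: generator_bound => // z.
by apply: HA => k; exact: (hjb_bound rc T0 CF0 fg hV).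
Qed.

Lemma kolmogorov_icontinuous u V ini m : kolmogorov L T u V ini m -> forall x, icontinuous T (m ^~ x).
Proof. by move=> [_ hm] x; apply: has_derivative_icontinuous => // t tT; eexists; exact: hm. Qed.

Lemma hjb_astar_icontinuous u f g V : hjb L T u f g V ->
  forall x z, icontinuous T (fun s => astar x (grad (V s) x) u 0 z).
Proof.
move=> hV x z t; apply: (rc_control_cvg rc); last exact: cvg_cst.
have cV := hjb_icontinuous T0 hV.
apply: (@grad_cvg _ _ _ _ _ (fun j => V (clamp T j))) => y.
exact: (cV y t).
Qed.

Lemma jump_rate_icontinuous u f g V : hjb L T u f g V ->
  forall y x, icontinuous T (fun s => jump_rate L (V s) u y x).
Proof.
move=> hV y x; under eq_fun do rewrite jump_rateE /generator.
case: eqP => _; last exact: (hjb_astar_icontinuous hV).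
by apply: icontinuousN; apply: icontinuous_sum => z; exact: (hjb_astar_icontinuous hV).
Qed.

Lemma kolmogorov_exists u f g V ini : data f g -> hjb L T u f g V ->
  exists m, kolmogorov L T u V ini m.
Proof.
move=> fg hV; have [B B0 HB] := jump_rate_bound.
have [||||m [h1 h2]] := @picard R 'I_d.+1 T (d.+1%:R * B)
  (fun s (m : Sigma -> R) x => \sum_y m y * jump_rate L (V s) u y x) ini.
- exact: T0.
- by rewrite mulr_ge0.
- move=> m cm x; apply: icontinuous_sum => y; apply: icontinuousM => //.
  exact: (jump_rate_icontinuous hV).
- move=> t m m' r x tT mr; rewrite -sumrB; apply: (le_trans (ler_norm_sum _ _ _)).
  rewrite -mulrA -[X in X%:R * _](card_ord d.+1) -sum_const; apply: ler_sum => y _.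
  rewrite -mulrBl normrM mulrC; apply: ler_pM => //; exact: (HB _ _ _ _ fg hV).
by exists m.
Qed.

(** The off-diagonal jump rates are nonnegative, and each row of the generator sums
    to zero. *)
Lemma kolmogorov_prob u f g V ini m : data f g -> hjb L T u f g V ->
  kolmogorov L T u V ini m -> prob_vector ini ->
  forall t, t \in `[0, T] -> prob_vector (m t).
Proof.
move=> fg hV [hm0 hm] [p0 p1] t tT; have [B B0 HB] := jump_rate_bound; split.
  move=> x; apply: (@quasi_positive R 'I_d.+1 T B m
    (fun t x => \sum_y m t y * jump_rate L (V t) u y x) (fun t x y => jump_rate L (V t) u y x)) => //.
  - by move=> s y _; under eq_bigr do rewrite mulrC.
  - move=> s y z _ yz; rewrite jump_rateE; apply: generator_ge0; first exact: (rc_orthant rc).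
    by rewrite eq_sym.
  - by move=> s y z sT; exact: (HB _ _ _ _ fg hV).
  - by move=> y; rewrite hm0.
have := @has_derivative0_cst R T (fun s => \sum_x m s x) t _ tT.
rewrite /= (eq_bigr _ (fun x _ => hm0 x)) p1; apply => s sT.
have := has_derivative_sum (fun x => hm s x sT); apply: has_derivative_eq.
rewrite exchange_big /= big1// => y _; rewrite -mulr_sumr.
by under eq_bigr do rewrite jump_rateE; rewrite generator_sum0 mulr0.
Qed.

Lemma kolmogorov_lipschitz : exists2 B, 0 <= B & forall u f g V ini m, data f g ->
  hjb L T u f g V -> kolmogorov L T u V ini m -> prob_vector ini ->
  forall s t x, s \in `[0, T] -> t \in `[0, T] -> `|m t x - m s x| <= B * `|t - s|.
Proof.
have [B B0 HB] := jump_rate_bound; exists B => // u f g V ini m fg hV hm p0.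
have P := kolmogorov_prob fg hV hm p0.
have D t x : t \in `[0, T] -> `|\sum_y m t y * jump_rate L (V t) u y x| <= B.
  move=> tT; have [p1 p2] := P t tT; apply: (le_trans (ler_norm_sum _ _ _)).
  rewrite -[leRHS]mul1r -p2 mulr_suml; apply: ler_sum => y _.
  by rewrite normrM (ger0_norm (p1 y)) ler_wpM2l//; exact: (HB _ _ _ _ fg hV).
have main s t x : s <= t -> s \in `[0, T] -> t \in `[0, T] -> `|m t x - m s x| <= B * `|t - s|.
  move=> st; rewrite !in_itv /= => /andP[s0 sT] /andP[t0 tT].
  have sub r : r \in `[s, t] -> r \in `[0, T] by rewrite !in_itv /= => /andP[? ?]; lra.
  have lo := @has_derivative_nondecreasing R T (fun r => m r x + B * r)
    (fun r => \sum_y m r y * jump_rate L (V r) u y x + B * 1) s t _ s0 st tT.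
  have up := @has_derivative_nondecreasing R T (fun r => B * r - m r x)
    (fun r => B * 1 - \sum_y m r y * jump_rate L (V r) u y x) s t _ s0 st tT.
  have {}lo : m s x + B * s <= m t x + B * t.
    apply: lo => [r rT|r /sub/(D _ x)]; last by rewrite ler_norml => /andP[? ?]; lra.
    by apply: has_derivativeD; [exact: hm.2|apply: has_derivativeZ => //; exact: has_derivative_id].
  have {}up : B * s - m s x <= B * t - m t x.
    apply: up => [r rT|r /sub/(D _ x)]; last by rewrite ler_norml => /andP[? ?]; lra.
    by apply: has_derivativeB => //; [apply: has_derivativeZ => //; exact: has_derivative_id|exact: hm.2].
  by rewrite (ger0_norm (_ : 0 <= t - s)) ?subr_ge0// ler_norml; apply/andP; split; lra.
move=> s t x sT tT; have [st|/ltW ts] := leP s t; first exact: main.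
by rewrite distrC (distrC t); exact: main.
Qed.

Lemma kolmogorov_stability e : 0 < e -> exists2 del, 0 < del & forall u u' f f' g g' V V' ini m m',
  data f g -> data f' g' -> hjb L T u f g V -> hjb L T u' f' g' V' ->
  kolmogorov L T u V ini m -> kolmogorov L T u' V' ini m' -> prob_vector ini ->
  (forall t y z, t \in `[0, T] ->
     `|astar y (grad (V' t) y) u' 0 z - astar y (grad (V t) y) u 0 z| <= del) ->
  forall t x, t \in `[0, T] -> `|m' t x - m t x| <= e.
Proof.
move=> e0; have [B B0 HB] := jump_rate_bound.
have [del d0 Hdel] := @ode_stability R 'I_d.+1 T B e T0' B0 e0.
have n0 : 0 < d.+1%:R :> R by [].
exists (del / d.+1%:R); first by rewrite divr_gt0.
move=> u u' f f' g g' V V' ini m m' fg fg' hV hV' hm hm' p0 ha t x tT.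
apply: (Hdel (fun s x => m' s x - m s x) (fun s x =>
  \sum_y m' s y * jump_rate L (V' s) u' y x - \sum_y m s y * jump_rate L (V s) u y x)) => //.
- by move=> s y sT; apply: has_derivativeB => //; [exact: hm'.2|exact: hm.2].
- by move=> y; rewrite hm.1 hm'.1 subrr normr0 ltW.
move=> s y sT.
have -> : \sum_z m' s z * jump_rate L (V' s) u' z y - \sum_z m s z * jump_rate L (V s) u z y =
  \sum_z (m' s z - m s z) * jump_rate L (V' s) u' z y +
  \sum_z m s z * (jump_rate L (V' s) u' z y - jump_rate L (V s) u z y).
  by rewrite -big_split -sumrB; apply: eq_bigr => z _ /=; ring.
apply: (le_trans (ler_normD _ _)); apply: lerD; apply: (le_trans (ler_norm_sum _ _ _)).
  rewrite mulr_sumr; apply: ler_sum => z _; rewrite normrM mulrC ler_wpM2r//.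
  exact: (HB _ _ _ _ fg' hV').
have [p1 p2] := kolmogorov_prob fg hV hm p0 sT.
rewrite -[leRHS]mul1r -p2 mulr_suml; apply: ler_sum => z _.
rewrite normrM (ger0_norm (p1 z)) ler_wpM2l// !jump_rateE generatorB.
have -> : del = d.+1%:R * (del / d.+1%:R) by field.
by apply: generator_bound; [rewrite divr_ge0 ?ltW|move=> k; rewrite !mxE; exact: ha].
Qed.

Lemma kolmogorov_unique u f g V ini m m' : data f g -> hjb L T u f g V ->
  kolmogorov L T u V ini m -> kolmogorov L T u V ini m' ->
  forall t x, t \in `[0, T] -> m' t x = m t x.
Proof.
move=> fg hV hm hm' t x tT; have [B B0 HB] := jump_rate_bound.
apply/eqP; rewrite -subr_eq0; apply/eqP.
apply: (@ode_unique R 'I_d.+1 T B (fun s x => m' s x - m s x) (fun s x =>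
  \sum_y m' s y * jump_rate L (V s) u y x - \sum_y m s y * jump_rate L (V s) u y x)) => //.
- by move=> s y sT; apply: has_derivativeB => //; [exact: hm'.2|exact: hm.2].
- by move=> y; rewrite hm.1 hm'.1 subrr.
move=> s y sT; rewrite -sumrB mulr_sumr; apply: (le_trans (ler_norm_sum _ _ _)).
apply: ler_sum => z _; rewrite -mulrBl normrM mulrC ler_wpM2r//; exact: (HB _ _ _ _ fg hV).
Qed.

Lemma kolmogorov_eq u V V' ini m : (forall t x, t \in `[0, T] -> V' t x = V t x) ->
  kolmogorov L T u V ini m -> kolmogorov L T u V' ini m.
Proof.
move=> E [h1 h2]; split => // t x tT; apply: has_derivative_eq (h2 t x tT).
by have -> : V' t = V t by apply/funext => y; exact: E.
Qed.

(** Quadratic growth of the cost with momentum [grad v'] at its minimizer, evaluated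
    at the control that is optimal for [grad v]. *)
Lemma hamiltonian_gain u v v' y :
  gam * dotv (astar y (grad v y) u - astar y (grad v' y) u) (astar y (grad v y) u - astar y (grad v' y) u)
  <= \sum_(x | x != y) astar y (grad v y) u 0 x * ((v' x - v x) - (v' y - v y))
     + H y (grad v' y) u - H y (grad v y) u.
Proof.
set a := astar y (grad v y) u; set a' := astar y (grad v' y) u.
have := rc_growth rc y (grad v' y) u (rc_orthant rc y (grad v y) u).
rewrite -/a -/a' !(rc_hamiltonian rc) -/a -/a' => h.
have : cost L y (grad v' y) u a - cost L y (grad v y) u a =
    \sum_(x | x != y) a 0 x * ((v' x - v x) - (v' y - v y)).
  rewrite /cost opprD addrACA subrr addr0 -sumrB; apply: eq_bigr => x _.
  by rewrite !mxE; ring.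
by move=> <-; lra.
Qed.

(** The weak duality inequality that drives both uniqueness and existence:
    the flow [m], optimal for the data [(f, g)], is suboptimal for [(f', g')], and
    its excess cost controls its distance to the optimal flow [m']. The derivative
    of [\sum_x m x * (V' x - V x)] produces the excess, and Gronwall's inequality
    bounds the distance of the flows by the distance of the controls. *)
Lemma flow_duality : exists2 kap, 0 < kap & forall u f f' g g' V V' ini m m',
  (forall x, icontinuous T (f ^~ x)) -> (forall x, icontinuous T (f' ^~ x)) ->
  data f g -> data f' g' -> hjb L T u f g V -> hjb L T u f' g' V' ->
  kolmogorov L T u V ini m -> kolmogorov L T u V' ini m' -> prob_vector ini ->
  forall t, t \in `[0, T] ->
  \sum_x ini x * (V' 0 x - V 0 x) + kap * (\sum_x (m t x - m' t x) ^+ 2) <=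
  prim T (fun s => \sum_x m s x * (f' s x - f s x)) T + \sum_x m T x * (g' x - g x).
Proof.
have [B B0 HB] := jump_rate_bound.
pose n : R := d.+1%:R; have n0 : 0 < n by [].
pose C := 2 * n * B + 1; have C0 : 0 <= C by rewrite addr_ge0// !mulr_ge0// ltW.
have gam0 := rc_gam_gt0 rc.
pose k0 := gam / n ^+ 2; have k00 : 0 < k0 by rewrite divr_gt0// exprn_gt0.
exists (k0 * expR (- C * T)); first by rewrite mulr_gt0// expR_gt0.
move=> u f f' g g' V V' ini m m' fc fc' fg fg' hV hV' hm hm' p0 t tT.
pose a s y := astar y (grad (V s) y) u; pose a' s y := astar y (grad (V' s) y) u.
pose J s y x := jump_rate L (V s) u y x; pose J' s y x := jump_rate L (V' s) u y x.
pose S s := \sum_y m s y * dotv (a s y - a' s y) (a s y - a' s y).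
pose E s := \sum_x (m s x - m' s x) ^+ 2.
pose dE s := \sum_x 2 * (m s x - m' s x) * (\sum_y m s y * J s y x - \sum_y m' s y * J' s y x).
pose h s := \sum_x m s x * (f' s x - f s x).
pose Y s := \sum_x m s x * (V' s x - V s x).
pose dY s := \sum_x ((\sum_y m s y * J s y x) * (V' s x - V s x) +
  m s x * ((H x (grad (V' s) x) u - f' s x) - (H x (grad (V s) x) u - f s x))).
have cm := kolmogorov_icontinuous hm.
have hc : icontinuous T h.
  by apply: icontinuous_sum => x; apply: icontinuousM => //; exact: icontinuousB.
have HE s : s \in `[0, T] -> has_derivative T E s (dE s).
  move=> sT; apply: has_derivative_sum => x; apply: has_derivative_sqr => //.
  by apply: has_derivativeB => //; [exact: hm.2|exact: hm'.2].
have HY s : s \in `[0, T] -> has_derivative T Y s (dY s).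
  move=> sT; apply: has_derivative_sum => x; apply: has_derivativeM => //; first exact: hm.2.
  by apply: has_derivativeB => //; [exact: hV'.2|exact: hV.2].
have Sge0 s : s \in `[0, T] -> 0 <= S s.
  move=> sT; apply: sumr_ge0 => y _; rewrite mulr_ge0 ?(kolmogorov_prob fg hV hm p0 sT).1//.
  by apply: sumr_ge0 => z _; rewrite -expr2 sqr_ge0.
have dYge s : s \in `[0, T] -> gam * S s - h s <= dY s.
  move=> sT; have [p1 _] := kolmogorov_prob fg hV hm p0 sT.
  have -> : dY s = \sum_y m s y * (\sum_(x | x != y) a s y 0 x * ((V' s x - V s x) - (V' s y - V s y))
      + H y (grad (V' s) y) u - H y (grad (V s) y) u) - h s.
    rewrite /dY big_split /=.
    have -> : \sum_x (\sum_y m s y * J s y x) * (V' s x - V s x) =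
        \sum_y m s y * \sum_(x | x != y) a s y 0 x * ((V' s x - V s x) - (V' s y - V s y)).
      transitivity (\sum_x \sum_y m s y * (J s y x * (V' s x - V s x))).
        by apply: eq_bigr => x _; rewrite mulr_suml; apply: eq_bigr => y _; rewrite mulrA.
      rewrite exchange_big /=; apply: eq_bigr => y _; rewrite -mulr_sumr -generator_sum.
      by congr (_ * _); apply: eq_bigr => x _; rewrite /J jump_rateE.
    by rewrite /h -big_split -sumrB; apply: eq_bigr => x _ /=; ring.
  rewrite lerD2r /S mulr_sumr; apply: ler_sum => y _; rewrite mulrCA ler_wpM2l ?p1//.
  exact: hamiltonian_gain.
have dEle s : s \in `[0, T] -> dE s <= C * E s + n ^+ 2 * S s.
  move=> sT; have [p1 p2] := kolmogorov_prob fg hV hm p0 sT.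
  pose w x := m s x - m' s x.
  have h1 : dE s = \sum_x ((\sum_y 2 * w x * w y * J' s y x) + \sum_y m s y * (2 * w x * (J s y x - J' s y x))).
    apply: eq_bigr => x _; rewrite -sumrB mulr_sumr -big_split; apply: eq_bigr => y _ /=.
    by rewrite /w; ring.
  have h2 : C * E s + n ^+ 2 * S s =
    \sum_x ((\sum_y B * (w x ^+ 2 + w y ^+ 2)) + (w x ^+ 2 + n * S s)).
    rewrite (eq_bigr (fun x => (n * (B * w x ^+ 2) + B * E s) + (w x ^+ 2 + n * S s))); last first.
      move=> x _; congr (_ + _); rewrite -mulr_sumr big_split /= sum_const card_ord -/(E s) /n; ring.
    by rewrite !big_split /= !sum_const !card_ord -!mulr_sumr -/(E s) /C -/n; ring.
  rewrite h1 h2; apply: ler_sum => x _; apply: lerD.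
    apply: ler_sum => y _; have := HB _ _ _ _ fg' hV' s y x sT; rewrite -/(J' s y x) => hJ.
    apply: (le_trans (ler_norm _)); rewrite !normrM (ger0_norm (ler0n _ 2)) mulrC.
    apply: (@le_trans _ _ (B * (2 * `|w x| * `|w y|))); first by rewrite ler_wpM2r// !mulr_ge0.
    rewrite ler_wpM2l// -(real_normK (num_real (w x))) -(real_normK (num_real (w y))).
    by have := sqr_ge0 (`|w x| - `|w y|); rewrite !expr2; lra.
  have -> : w x ^+ 2 + n * S s = \sum_y m s y * (w x ^+ 2 + n * dotv (a s y - a' s y) (a s y - a' s y)).
    under eq_bigr do rewrite mulrDr; rewrite big_split /= -mulr_suml p2 mul1r; congr (_ + _).
    by rewrite /S mulr_sumr; apply: eq_bigr => y _; rewrite mulrCA.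
  apply: ler_sum => y _; apply: ler_wpM2l; first exact: p1.
  have := generator_sqr (a s y - a' s y) y x; rewrite -generatorB /J /J' !jump_rateE -/(a s y) -/(a' s y) -/n.
  set D := generator _ _ _ - _ => hD.
  by have := sqr_ge0 (w x - D); rewrite !expr2 in hD *; lra.
(* The dissipation [gam * S] of [Y] pays for the growth of [E], the squared distance
   of the flows, once [E] carries the weight of Gronwall's inequality. *)
pose Z s := Y s + prim T h s - k0 * (E s * expR (- C * s)).
have Z0t : Z 0 <= Z t.
  move: (tT); rewrite in_itv /= => /andP[t0 tT'].
  apply: (@has_derivative_nondecreasing R T Z
    (fun s => dY s + h s - k0 * (dE s * expR (- C * s) + E s * (- C * expR (- C * s))))) => //.
    move=> s sT; apply: has_derivativeB => //.
      by apply: has_derivativeD; [exact: HY|exact: prim_derivative].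
    apply: has_derivativeZ => //; apply: has_derivativeM => //; first exact: HE.
    exact: has_derivative_expR.
  move=> s; rewrite in_itv /= => /andP[s0 st].
  have sT : s \in `[0, T] by rewrite in_itv /= s0 (le_trans st).
  have A1 := dYge s sT; have A2 := dEle s sT; have A3 := Sge0 s sT.
  have X0 : 0 < expR (- C * s) := expR_gt0 _.
  have X1 : expR (- C * s) <= 1 by rewrite -expR0 ler_expR mulNr oppr_le0 mulr_ge0.
  set X := expR (- C * s) in X0 X1 *.
  have A4 : k0 * (X * (dE s - C * E s)) <= gam * S s.
    apply: (@le_trans _ _ (k0 * (n ^+ 2 * S s))).
      rewrite ler_wpM2l ?(ltW k00)//; apply: (@le_trans _ _ (X * (n ^+ 2 * S s))).
        by rewrite ler_wpM2l ?(ltW X0)//; lra.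
      by rewrite ler_piMl// mulr_ge0// sqr_ge0.
    by rewrite mulrA /k0 divfK// expf_neq0// gt_eqF.
  have -> : dE s * X + E s * (- C * X) = X * (dE s - C * E s) by ring.
  by lra.
have Et0 : E 0 = 0 by apply: big1 => x _; rewrite hm.1 hm'.1 subrr expr0n.
have YT : Y t + prim T h t <= Y T + prim T h T.
  move: (tT); rewrite in_itv /= => /andP[t0 tT'].
  apply: (@has_derivative_nondecreasing R T (fun s => Y s + prim T h s) (fun s => dY s + h s)) => //.
    by move=> s sT; apply: has_derivativeD; [exact: HY|exact: prim_derivative].
  move=> s; rewrite in_itv /= => /andP[ts sT'].
  have sT : s \in `[0, T] by rewrite in_itv /= sT' (le_trans t0).
  by have := dYge s sT; have := mulr_ge0 (ltW gam0) (Sge0 s sT); lra.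
have Ege0 : 0 <= E t by apply: sumr_ge0 => x _; exact: sqr_ge0.
have expT : k0 * expR (- C * T) * E t <= k0 * (E t * expR (- C * t)).
  rewrite -mulrA ler_wpM2l ?(ltW k00)// mulrC ler_wpM2l// ler_expR.
  by move: (tT); rewrite in_itv /= => /andP[t0 tT']; rewrite !mulNr lerN2 ler_wpM2l.
have Y0 : Y 0 = \sum_x ini x * (V' 0 x - V 0 x) by apply: eq_bigr => x _; rewrite hm.1.
have YTe : Y T = \sum_x m T x * (g' x - g x) by apply: eq_bigr => x _; rewrite hV.1 hV'.1.
move: Z0t; rewrite /Z Et0 mul0r mulr0 prim0 -Y0 -YTe -/(E t); lra.
Qed.

End flows.

(** * Continuous and measurable dependence on the parameter *)

Section borel_functions.
Context {R : realType} {E : ptopologicalType}.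

Lemma borel_open (A : set E) : open A -> measurable (A : set (borel E)).
Proof. by move=> oA; exact: sub_sigma_algebra. Qed.

Lemma continuous_borel (h : E -> R) : continuous h -> measurable_fun [set: borel E] (h : borel E -> R).
Proof.
move=> /continuousP ch; apply: (measurability _ (RGenOInfty.measurableE R)).
move=> _ [_ [x ->] <-]; rewrite setTI; apply: borel_open.
by apply: ch; exact: interval_open.
Qed.

End borel_functions.

Section continuous_dependence.
Context {R : realType} {d : nat} {U : pmetricType R}.
Local Notation Sigma := 'I_d.+1.
Local Notation vec := 'rV[R]_d.+1.
Variables (L : Sigma -> vec -> U -> R) (gam CL T CF : R).
Hypothesis rc : regular_control L gam CL.
Hypothesis T0 : 0 < T.
Hypothesis CF0 : 0 <= CF.

Local Notation astar := (optimal_control L).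
Local Notation H := (hamiltonian L).
Local Notation data := (coupling_data T CF).
Let T0' : 0 <= T. Proof. exact: ltW. Qed.

Section along_filter.
Variables (J : Type) (F : set_system J) (FF : Filter F) (u_ : J -> U) (u : U).
Hypothesis hu : u_ @ F --> u.
Variables (f_ : J -> R -> Sigma -> R) (g_ : J -> Sigma -> R) (V_ : J -> R -> Sigma -> R).
Variables (f : R -> Sigma -> R) (g : Sigma -> R) (V : R -> Sigma -> R).
Hypothesis fg_ : forall j, data (f_ j) (g_ j).
Hypothesis fg : data f g.
Hypothesis hV_ : forall j, hjb L T (u_ j) (f_ j) (g_ j) (V_ j).
Hypothesis hV : hjb L T u f g V.
Hypothesis f_cvg : forall x e, 0 < e -> \forall j \near F, forall t, t \in `[0, T] -> `|f_ j t x - f t x| < e.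
Hypothesis g_cvg : forall x, g_ j x @[j --> F] --> g x.

Let cV x : icontinuous T (V ^~ x). Proof. exact: (hjb_icontinuous T0 hV). Qed.

(** Along an arbitrary filter, so as to cover both continuity in [u], along the
    neighbourhoods of [u], and convergence of sequences of data at a fixed [u]. *)
Lemma hjb_uniform_cvg e : 0 < e ->
  \forall j \near F, forall t x, t \in `[0, T] -> `|V_ j t x - V t x| <= e.
Proof.
move=> e0; have [del d0 Hd] := hjb_stability rc T0 CF0 e0.
have H1 : \forall j \near F, forall x t, t \in `[0, T] -> `|f_ j t x - f t x| < del.
  by apply: filter_forall => x; exact: f_cvg.
have H2 : \forall j \near F, forall x, `|g_ j x - g x| <= del.
  apply: filter_forall => x; have /cvgrPdist_le/(_ _ d0) := @g_cvg x.
  by apply: filterS => j; rewrite distrC.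
have H3 : \forall j \near F, forall x t, t \in `[0, T] ->
    `|H x (grad (V (clamp T t)) x) (u_ j) - H x (grad (V (clamp T t)) x) u| < del.
  apply: filter_forall => x; apply: (uniform_near (h := fun t j =>
    H x (grad (V (clamp T t)) x) (u_ j) - H x (grad (V (clamp T t)) x) u)) => // t tT e' e'0.
  have FP : Filter (filter_prod (nbhs t) F) by exact: filter_prod_filter.
  have cu : u @[z --> filter_prod (nbhs t) F] --> u by exact: cvg_cst.
  have c1 y : grad (V (clamp T z.1)) x 0 y @[z --> filter_prod (nbhs t) F] --> grad (V (clamp T t)) x 0 y.
    apply: (@grad_cvg R d _ _ FP (fun z : R * J => V (clamp T z.1))) => k.
    apply: (@cvg_comp _ _ _ fst (fun s => V (clamp T s) k) _ (nbhs t) _ cvg_fst).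
    exact: (@cV k t).
  have c2 : u_ z.2 @[z --> filter_prod (nbhs t) F] --> u by exact: (cvg_comp _ _ cvg_snd hu).
  have h1 := rc_hamiltonian_cvg rc (x := x) (p_ := fun z : R * J => grad (V (clamp T z.1)) x) FP c1 c2.
  have h2 := rc_hamiltonian_cvg rc (x := x) (p_ := fun z : R * J => grad (V (clamp T z.1)) x) FP c1 cu.
  have /cvgrPdist_lt/(_ _ e'0) : H x (grad (V (clamp T z.1)) x) (u_ z.2) - H x (grad (V (clamp T z.1)) x) u
      @[z --> filter_prod (nbhs t) F] --> (0 : R).
    by rewrite -(subrr (H x (grad (V (clamp T t)) x) u)); exact: cvgB.
  by apply: filterS => z; rewrite sub0r normrN.
near=> j.
have h1 : forall x t, t \in `[0, T] -> `|f_ j t x - f t x| < del by near: j.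
have h2 : forall x, `|g_ j x - g x| <= del by near: j.
have h3 : forall x t, t \in `[0, T] -> `|H x (grad (V (clamp T t)) x) (u_ j) - H x (grad (V (clamp T t)) x) u| < del by near: j.
apply: (Hd _ _ _ _ _ _ _ _ fg (fg_ j) hV (hV_ j)) => // [t x tT|t x tT].
  exact: ltW (h1 x t tT).
by have := h3 x t tT; rewrite clamp_id// => /ltW.
Unshelve. all: by end_near. Qed.

Variables (ini : Sigma -> R) (m_ : J -> R -> Sigma -> R) (m : R -> Sigma -> R).
Hypothesis p0 : prob_vector ini.
Hypothesis hm_ : forall j, kolmogorov L T (u_ j) (V_ j) ini (m_ j).
Hypothesis hm : kolmogorov L T u V ini m.

Lemma kolmogorov_uniform_cvg e : 0 < e ->
  \forall j \near F, forall t x, t \in `[0, T] -> `|m_ j t x - m t x| <= e.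
Proof.
move=> e0; have [del d0 Hd] := kolmogorov_stability rc T0 CF0 e0.
have H3 : \forall j \near F, forall x y t, t \in `[0, T] ->
    `|astar x (grad (V_ j (clamp T t)) x) (u_ j) 0 y - astar x (grad (V (clamp T t)) x) u 0 y| < del.
  apply: filter_forall => x; apply: filter_forall => y; apply: (uniform_near (h := fun t j =>
    astar x (grad (V_ j (clamp T t)) x) (u_ j) 0 y - astar x (grad (V (clamp T t)) x) u 0 y)) => // t tT e' e'0.
  have FP : Filter (filter_prod (nbhs t) F) by exact: filter_prod_filter.
  have cu : u @[z --> filter_prod (nbhs t) F] --> u by exact: cvg_cst.
  have c0 k : V (clamp T z.1) k @[z --> filter_prod (nbhs t) F] --> V (clamp T t) k.
    apply: (@cvg_comp _ _ _ fst (fun s => V (clamp T s) k) _ (nbhs t) _ cvg_fst).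
    exact: (@cV k t).
  have c1 k : V_ z.2 (clamp T z.1) k @[z --> filter_prod (nbhs t) F] --> V (clamp T t) k.
    apply/cvgrPdist_le => r r0; have r2 : 0 < r / 2 by rewrite divr_gt0.
    have n1 : \forall z \near filter_prod (nbhs t) F, `|V (clamp T t) k - V (clamp T z.1) k| <= r / 2.
      by have /cvgrPdist_le/(_ _ r2) := @c0 k.
    have n2 : \forall z \near filter_prod (nbhs t) F, forall s y, s \in `[0, T] -> `|V_ z.2 s y - V s y| <= r / 2.
      exact: (@cvg_snd _ _ (nbhs t) F _ _ (hjb_uniform_cvg r2)).
    near=> z.
    have z1 : `|V (clamp T t) k - V (clamp T z.1) k| <= r / 2 by near: z.
    have z2 : forall s y, s \in `[0, T] -> `|V_ z.2 s y - V s y| <= r / 2 by near: z.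
    rewrite [r]splitr; have {}z2 := z2 _ k (clamp_itv z.1 T0').
    have -> : V (clamp T t) k - V_ z.2 (clamp T z.1) k = (V (clamp T t) k - V (clamp T z.1) k) - (V_ z.2 (clamp T z.1) k - V (clamp T z.1) k) by ring.
    by apply: (le_trans (ler_normB _ _)); apply: lerD.
  have c2 : u_ z.2 @[z --> filter_prod (nbhs t) F] --> u by exact: (cvg_comp _ _ cvg_snd hu).
  have g1 k := @grad_cvg R d _ _ FP (fun z : R * J => V_ z.2 (clamp T z.1)) _ x c1 k.
  have g0 k := @grad_cvg R d _ _ FP (fun z : R * J => V (clamp T z.1)) _ x c0 k.
  have h1 := rc_control_cvg rc (x := x) (z := y) (p_ := fun z : R * J => grad (V_ z.2 (clamp T z.1)) x) FP g1 c2.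
  have h2 := rc_control_cvg rc (x := x) (z := y) (p_ := fun z : R * J => grad (V (clamp T z.1)) x) FP g0 cu.
  have /cvgrPdist_lt/(_ _ e'0) : astar x (grad (V_ z.2 (clamp T z.1)) x) (u_ z.2) 0 y -
      astar x (grad (V (clamp T z.1)) x) u 0 y @[z --> filter_prod (nbhs t) F] --> (0 : R).
    by rewrite -(subrr (astar x (grad (V (clamp T t)) x) u 0 y)); exact: cvgB.
  by apply: filterS => z; rewrite sub0r normrN.
near=> j.
have h3 : forall x y t, t \in `[0, T] ->
    `|astar x (grad (V_ j (clamp T t)) x) (u_ j) 0 y - astar x (grad (V (clamp T t)) x) u 0 y| < del by near: j.
apply: (Hd _ _ _ _ _ _ _ _ _ _ _ fg (fg_ j) hV (hV_ j) hm (hm_ j) p0) => // t y z tT.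
by have := h3 y z t tT; rewrite clamp_id// => /ltW.
Unshelve. all: by end_near. Qed.

End along_filter.

Definition continuous_data (f : R -> Sigma -> U -> R) (g : Sigma -> U -> R) :=
  [/\ forall u, data (fun t x => f t x u) (g ^~ u),
      forall u x, icontinuous T (fun t => f t x u),
      forall x u e, 0 < e -> \forall u' \near u, forall t, t \in `[0, T] -> `|f t x u' - f t x u| < e &
      forall x, continuous (g x)].

(** The flow is only measurable in [u], through its initial datum; by linearity it
    is a combination of the flows issued from the point masses, which are
    continuous in [u]. *)
Lemma best_response (m0 : Sigma -> U -> R) f g :
  (forall x, measurable_fun [set: borel U] (m0 x : borel U -> R)) ->
  continuous_data f g -> exists (V m : R -> Sigma -> U -> R),
  [/\ forall u, hjb L T u (fun t x => f t x u) (g ^~ u) (fun t x => V t x u),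
      forall u, kolmogorov L T u (fun t x => V t x u) (m0 ^~ u) (fun t x => m t x u) &
      forall t x, t \in `[0, T] -> measurable_fun [set: borel U] (m t x : borel U -> R)].
Proof.
move=> mm0 [fg ft fc gc].
have /choice[V hV] : forall u, exists V, hjb L T u (fun t x => f t x u) (g ^~ u) V.
  by move=> u; exact: (hjb_exists rc T0 CF0 u (ft u) (fg u)).
pose delta (y : Sigma) : Sigma -> R := fun x => (x == y)%:R.
have delta_prob y : prob_vector (delta y).
  split => [x|]; first by rewrite ler0n.
  by rewrite (bigD1 y)//= /delta eqxx big1 ?addr0// => x /negbTE ->.
have /choice[P hP] : forall p : U * Sigma, exists P, kolmogorov L T p.1 (V p.1) (delta p.2) P.
  by move=> [u y]; exact: (kolmogorov_exists rc T0 CF0 (delta y) (fg u) (hV u)).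
have Pc y t x : t \in `[0, T] -> continuous (fun u => P (u, y) t x).
  move=> tT u; apply/cvgrPdist_le => e e0.
  have := @kolmogorov_uniform_cvg U (nbhs u) (nbhs_filter u) id u cvg_id (fun u t x => f t x u) (fun u => g ^~ u) V
    (fun t x => f t x u) (g ^~ u) (V u) fg (fg u) hV (hV u)
    (fun x e => fc x u e) (fun x => gc x u) (delta y) (fun u => P (u, y)) (P (u, y)) (delta_prob y)
    (fun u => hP (u, y)) (hP (u, y)) e e0.
  by apply: filterS => u' /(_ t x tT); rewrite distrC.
exists (fun t x u => V u t x), (fun t x u => \sum_y m0 y u * P (u, y) t x); split.
- exact: hV.
- move=> u; split => [x|t x tT].
    rewrite (bigD1 x)//= (hP (u, x)).1 /delta eqxx mulr1 big1 ?addr0// => y yx.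
    by rewrite (hP (u, y)).1 /delta eq_sym (negbTE yx) mulr0.
  have h := has_derivative_sum (fun y => has_derivativeZ (c := m0 y u) tT ((hP (u, y)).2 t x tT)).
  apply: has_derivative_eq h.
  under [RHS]eq_bigr do rewrite mulr_suml; rewrite exchange_big /=; apply: eq_bigr => y _.
  by rewrite mulr_sumr; apply: eq_bigr => z _; rewrite mulrA.
- move=> t x tT.
  have E (r : seq Sigma) : measurable_fun [set: borel U] (fun u : borel U => \sum_(y <- r) m0 y u * P (u, y) t x).
    elim: r => [|y r IH].
      by under eq_fun do rewrite big_nil; exact: measurable_cst.
    under eq_fun do rewrite big_cons; apply: measurable_funD => //.
    by apply: measurable_funM => //; exact: (continuous_borel (Pc y t x tT)).
  exact: E.
Qed.

End continuous_dependence.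

(** * Measures on the product and total variation *)

Section weak_convergence_lemmas.

Lemma initial_cvg {S : choiceType} {T : topologicalType} (f : S -> T) (F : set_system S) (FF : Filter F) (s : S) :
  f @ F --> f s -> F --> (s : initial_topology f).
Proof.
move=> H A; rewrite nbhsE => -[B [[C oC CB] Bs] BA].
apply: (@filterS _ F _ _ _ BA); rewrite -CB; apply: H.
by apply: open_nbhs_nbhs; split => //; move: Bs; rewrite -CB.
Qed.

Lemma prod_topology_cvg {J : Type} {T : J -> topologicalType} (F : set_system (prod_topology T)) (FF : Filter F)
  (g : prod_topology T) : (forall j, h j @[h --> F] --> g j) -> F --> g.
Proof.
move=> H; apply/cvg_sup => j; apply: initial_cvg; exact: H.
Qed.

End weak_convergence_lemmas.

Section product_with_states.
Context {R : realType} {d : nat} {U : pmetricType R}.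
Local Notation Sigma := 'I_d.+1.
Local Notation E := (U * states d)%type.
Implicit Types (x : Sigma) (A : set (borel U)) (B : set (borel E)).

Definition slice (x : Sigma) (B : set E) : set U := [set u | B (u, x)].
Definition layer (x : Sigma) (A : set U) : set E := A `*` [set (x : states d)].

Lemma measurable_slice x B : measurable B -> measurable (slice x B : set (borel U)).
Proof.
move=> mB; have : measurable_fun [set: borel U] ((fun u => (u, x)) : borel U -> borel E).
  apply: (@measurability _ _ (borel U) (borel E) setT _ (@open E) erefl) => _ [C oC <-]; rewrite setTI; apply: borel_open.
  apply: (@open_comp _ _ (fun u : U => (u, x : states d)) C) => // u _.
  exact: (cvg_pair (@cvg_id _ (nbhs u)) (@cvg_cst (states d) (x : states d) _ (nbhs u) _)).
by move=> /(_ measurableT B mB); rewrite setTI.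
Qed.

Lemma measurable_projection : measurable_fun [set: borel E] (fst : borel E -> borel U).
Proof.
apply: (@measurability _ _ (borel E) (borel U) setT _ (@open U) erefl) => _ [C oC <-].
rewrite setTI; apply: borel_open; by apply: open_comp => // z _; exact: cvg_fst.
Qed.

Lemma measurable_cylinder A : measurable A -> measurable (A `*` [set: states d] : set (borel E)).
Proof.
move=> mA; have := measurable_projection measurableT mA; rewrite setTI.
by congr measurable; apply/seteqP; split => z // [].
Qed.

Lemma measurable_layer x A : measurable A -> measurable (layer x A : set (borel E)).
Proof.
move=> mA.
have m1 := measurable_projection.
have m2 : measurable ([set z : E | z.2 = x] : set (borel E)).
  apply: borel_open; apply: (@open_comp _ _ (snd : E -> states d) [set (x : states d)]).
    by move=> z _; exact: cvg_snd.
  exact: discrete_open.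
rewrite (_ : layer x A = ((fst : borel E -> borel U) @^-1` A) `&` [set z : E | z.2 = x])//.
by apply: measurableI => //; rewrite -[X in measurable X]setTI; exact: m1.
Qed.

Lemma measure_layers (m : probability (borel E) R) B : measurable B ->
  m B = (\sum_(x < d.+1) m (layer x (slice x B)))%E.
Proof.
move=> mB; rewrite -measure_bigsetU_ord; last first.
- apply/trivIsetP => i j _ _ ij; apply/seteqP; split => // -[u y] /= [[_ yi] [_ yj]].
  by move: ij; rewrite -yi -yj eqxx.
- by move=> x; apply: measurable_layer; exact: measurable_slice.
congr (m _); apply/seteqP; split => [[u y] By|[u y]].
  by rewrite -bigcup_mkord_ord; exists (val y) => /=; [exact: ltn_ord|rewrite inord_val].
by rewrite -bigcup_mkord_ord => -[i _ [/= Bi ->]].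
Qed.

(** Finite additivity suffices: the tails of a disjoint union have vanishing mass for
    [mu], which dominates [nu], and this gives countable additivity. *)
Lemma measure_of_layers (mu : probability (borel U) R) (nu : Sigma -> set (borel U) -> R) :
  (forall x A, measurable A -> 0 <= nu x A) ->
  (forall x A A', measurable A -> measurable A' -> A `&` A' = set0 -> nu x (A `|` A') = nu x A + nu x A') ->
  (forall A, measurable A -> (\sum_x nu x A)%:E = mu A) ->
  exists m : probability (borel E) R, forall x A, measurable A -> m (layer x A) = (nu x A)%:E.
Proof.
move=> nu0 nuU numu.
have nu_set0 x : nu x set0 = 0.
  have := nuU x set0 set0 measurable0 measurable0 (setI0 _); rewrite setU0; lra.
have mufin A : measurable A -> (fine (mu A))%:E = mu A.
  by move=> mA; rewrite fineK// fin_num_measure.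
have nule x A : measurable A -> nu x A <= fine (mu A).
  move=> mA; rewrite -lee_fin mufin// -numu// lee_fin (bigD1 x)//= lerDl.
  by apply: sumr_ge0 => y _; exact: nu0.
pose S (B : set (borel E)) := \sum_x nu x (slice x B).
pose Lam (B : set (borel E)) : \bar R := (Num.max 0 (S B))%:E.
have S0 B : measurable B -> 0 <= S B.
  by move=> mB; apply: sumr_ge0 => x _; apply: nu0; exact: measurable_slice.
have LamE B : measurable B -> Lam B = (S B)%:E.
  by move=> mB; rewrite /Lam (max_idPr (S0 B mB)).
have SU B B' : measurable B -> measurable B' -> B `&` B' = set0 -> S (B `|` B') = S B + S B'.
  move=> mB mB' BB'; rewrite /S -big_split; apply: eq_bigr => x _ /=.
  rewrite -(nuU x (slice x B) (slice x B')) //; try exact: measurable_slice.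
  by apply/seteqP; split => // u [? ?]; have : (B `&` B') (u, x) by []; rewrite BB'.
have Lam_set0 : Lam set0 = 0%E.
  rewrite LamE// /S big1// => x _; rewrite -[RHS](nu_set0 x); congr (nu x _); exact/seteqP.
have Lam_ge0 B : (0 <= Lam B)%E by rewrite lee_fin le_max lexx.
have Lam_sigma : semi_sigma_additive Lam.
  move=> F mF tF mUF.
  pose tail n := \bigcup_i F (n + i)%N.
  have mtail n : measurable (tail n) by exact: bigcupT_measurable.
  have tailS n : tail n = F n `|` tail n.+1.
    apply/seteqP; split => z.
      by move=> [[|i] _]; rewrite ?addn0 ?addnS -?addSn => h; [left|right; exists i].
    by move=> [h|[i _ h]]; [exists 0%N; rewrite ?addn0|exists i.+1; rewrite // addnS -addSn].
  have dis n : F n `&` tail n.+1 = set0.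
    apply/seteqP; split => // z [h1 [i _ h2]].
    have := tF n (n.+1 + i)%N Logic.I Logic.I; rewrite /= => -/(_ _)/eqP.
    move=> H; have : n = (n.+1 + i)%N by apply: (tF _ _ Logic.I Logic.I); exists z.
    by move/eqP; rewrite addSn -addnS -[X in X == _]addn0 eqn_add2l.
  have sumE n : (\sum_(0 <= i < n) Lam (F i) = (S (\bigcup_i F i) - S (tail n))%:E)%E.
    elim: n => [|n IH].
      rewrite big_nil (_ : tail 0%N = \bigcup_i F i) ?subrr//.
    rewrite big_nat_recr//= IH LamE// tailS SU// -EFinD; congr EFin; ring.
  rewrite LamE// -[X in _ --> X]sube0.
  have -> : (fun n => \sum_(0 <= i < n) Lam (F i))%E = (fun n => (S (\bigcup_i F i) - S (tail n))%:E).
    by apply/funext => n; exact: sumE.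
  rewrite sube0; apply: cvg_EFin; first by near=> n.
  rewrite /comp/= -[X in _ --> X]subr0; apply: cvgB; first exact: cvg_cst.
  have slc x : fine (mu (slice x (tail n))) @[n --> \oo] --> (0 : R).
    have mu0 : mu set0 = 0%:E := measure0 mu.
    apply: fine_cvg; rewrite -mu0.
    have -> : (set0 : set (borel U)) = \bigcap_n slice x (tail n).
      apply/seteqP; split => // u H; have [i _ hi] := H 0%N Logic.I.
      have [j _ hj] := H (i.+1) Logic.I; rewrite add0n in hi.
      have : i = (i.+1 + j)%N by apply: (tF _ _ Logic.I Logic.I); exists (u, x).
      by move/eqP; rewrite addSn -addnS -[X in X == _]addn0 eqn_add2l.
    apply: nonincreasing_cvg_mu.
    - by rewrite ltey_eq fin_num_measure//; exact: measurable_slice.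
    - by move=> i; exact: measurable_slice.
    - by apply: bigcapT_measurable => i; exact: measurable_slice.
    - move=> n k nk; apply/subsetPset => u [i _ h]; exists (k - n + i)%N => //.
      by rewrite addnA subnKC.
  apply: (@squeeze_cvgr _ _ _ _ (fun _ => 0) (fun n => \sum_(x < d.+1) fine (mu (slice x (tail n))))).
  - near=> n; rewrite S0//=; apply: ler_sum => x _; apply: nule; exact: measurable_slice.
  - exact: cvg_cst.
  - have E0 : \sum_(x : Sigma) (0 : R) = 0 by rewrite big1.
    by rewrite -[X in _ --> X]E0; apply: cvg_fin_sum => x; exact: slc.
have LamT : Lam setT = 1%E.
  by rewrite LamE// (_ : S setT = \sum_x nu x setT)// numu//; exact: probability_setT.
pose M : {measure set (borel E) -> \bar R} := HB.pack Lam (isMeasure.Build _ _ _ Lam Lam_set0 Lam_ge0 Lam_sigma).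
pose P : probability (borel E) R := HB.pack Lam (Measure.class M) (Measure_isProbability.Build _ _ _ M LamT).
exists P => x A mA; rewrite /= LamE; last exact: measurable_layer.
congr EFin; rewrite /S (bigD1 x)//= big1 ?addr0.
  by congr nu; apply/seteqP; split => // u [].
move=> y yx; rewrite -[RHS](nu_set0 y); congr nu; apply/seteqP; split => // u [_ /= yx'].
by move: yx; rewrite yx' eqxx.
Unshelve. all: by end_near. Qed.

Variable mu : probability (borel U) R.
Implicit Types (m : probability (borel E) R) (k : Sigma -> U -> R).

Lemma layers_Pmu m : (forall A, measurable A -> (\sum_(x < d.+1) m (layer x A))%E = mu A) -> Pmu mu m.
Proof.
move=> H A mA; rewrite measure_layers; last exact: measurable_cylinder.
rewrite -H//; apply: eq_bigr => x _; congr (m (layer x _)).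
by apply/seteqP; split => u // [].
Qed.

Lemma prob_vector_le1 (p : Sigma -> R) x : prob_vector p -> `|p x| <= 1.
Proof. by move=> [p0 p1]; rewrite ger0_norm// -p1 (bigD1 x)//= lerDl sumr_ge0. Qed.

Lemma kernel_bm k : (forall x, measurable_fun [set: borel U] (k x : borel U -> R)) ->
  (forall u, prob_vector (k ^~ u)) -> forall x, bounded_measurable (k x : borel U -> R).
Proof.
by move=> mk pk x; split => //; exists 1 => u; exact: prob_vector_le1 x (pk u).
Qed.

Lemma EFin_Rintegral (h : borel U -> R) A : bounded_measurable h -> measurable A ->
  (\int[mu]_(u in A) (h u)%:E)%E = (\int[mu]_(u in A) h u)%:E.
Proof.
by move=> bh mA; rewrite /Rintegral fineK//; apply: integrable_fin_num => //; exact: bm_integrable.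
Qed.

Lemma kernel_total k A : (forall x, measurable_fun [set: borel U] (k x : borel U -> R)) ->
  (forall u, prob_vector (k ^~ u)) -> measurable A ->
  (\sum_x \int[mu]_(u in A) k x u)%:E = mu A.
Proof.
move=> mk pk mA; have bk := kernel_bm mk pk.
have E (r : seq Sigma) : \sum_(x <- r) \int[mu]_(u in A) k x u = \int[mu]_(u in A) \sum_(x <- r) k x u.
  elim: r => [|x r IH].
    by rewrite big_nil; under eq_Rintegral do rewrite big_nil; rewrite Rintegral_cst// mul0r.
  rewrite big_cons IH -RintegralD//; [|exact: bm_integrable|by apply: bm_integrable => //; exact: bm_sum].
  by apply: eq_Rintegral => u _; rewrite big_cons.
rewrite E (_ : \int[mu]_(u in A) _ = \int[mu]_(u in A) 1).
  by rewrite Rintegral_cst// mul1r fineK// fin_num_measure.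
by apply: eq_Rintegral => u _; exact: (pk u).2.
Qed.

Lemma kernel_measure k : (forall x, measurable_fun [set: borel U] (k x : borel U -> R)) ->
  (forall u, prob_vector (k ^~ u)) -> exists m, disintegration mu m k.
Proof.
move=> mk pk; have bk := kernel_bm mk pk.
have [|||m Hm] := @measure_of_layers mu (fun x A => \int[mu]_(u in A) k x u).
- by move=> x A mA; apply: Rintegral_ge0 => u _; exact: (pk u).1.
- move=> x A A' mA mA' AA'; apply: Rintegral_setU => //.
    by apply: bm_integrable => //; exact: measurableU.
  by apply/disj_setPS => u; rewrite AA'.
- by move=> A mA; exact: kernel_total.
- by exists m; split => // x A mA; rewrite EFin_Rintegral//; exact: Hm.
Qed.

Lemma disintegration_layer m k x A : disintegration mu m k -> measurable A ->
  fine (m (layer x A)) = \int[mu]_(u in A) k x u.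
Proof.
move=> [mk pk Hm] mA; rewrite /layer Hm// EFin_Rintegral//; exact: kernel_bm.
Qed.

Lemma disintegration_Pmu m k : disintegration mu m k -> Pmu mu m.
Proof.
move=> [mk pk Hm]; apply: layers_Pmu => A mA; rewrite -(kernel_total mk pk mA).
rewrite -sumEFin; apply: eq_bigr => x _; rewrite /layer Hm// EFin_Rintegral//.
exact: kernel_bm.
Qed.

(** Closeness in total variation, up to a constant factor. *)
Definition tvclose (m m' : probability (borel E) R) (eta : R) :=
  forall x A, measurable A -> `|fine (m (layer x A)) - fine (m' (layer x A))| <= eta.

Lemma norm_Rintegral_le_mean (h : borel U -> R) A : bounded_measurable h -> measurable A ->
  `|\int[mu]_(u in A) h u| <= mean mu (fun u => `|h u|).
Proof.
move=> bh mA; have bn := bm_norm bh.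
apply: (le_trans (le_normr_Rintegral mA (bm_integrable mu bh mA))).
rewrite /mean -lee_fin -!EFin_Rintegral//.
apply: ge0_subset_integral; [exact: mA|exact: measurableT| | |].
- by apply/measurable_EFinP; exact: bn.1.
- by move=> u _; rewrite lee_fin.
- exact: subsetT.
Qed.

Lemma tvclose_mean m m' k k' eta : disintegration mu m k -> disintegration mu m' k' ->
  (forall x, mean mu (fun u : borel U => `|k x u - k' x u|) <= eta) -> tvclose m m' eta.
Proof.
move=> dk dk' H x A mA; have [mk pk _] := dk; have [mk' pk' _] := dk'.
have b := kernel_bm mk pk x; have b' := kernel_bm mk' pk' x.
rewrite (disintegration_layer x dk mA) (disintegration_layer x dk' mA).
rewrite -RintegralB//; [|exact: bm_integrable|exact: bm_integrable].
by apply: (le_trans _ (H x)); apply: norm_Rintegral_le_mean => //; exact: bmB.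
Qed.

Lemma tvclose_set m m' eta B : tvclose m m' eta -> measurable B ->
  `|fine (m B) - fine (m' B)| <= d.+1%:R * eta.
Proof.
move=> H mB; have E (P : probability (borel E) R) : fine (P B) = \sum_(x < d.+1) fine (P (layer x (slice x B))).
  rewrite (measure_layers P mB) -sum_fine// => x _; rewrite fin_num_measure//.
  by apply: measurable_layer; exact: measurable_slice.
rewrite !E -sumrB; apply: (le_trans (ler_norm_sum _ _ _)).
rewrite -[X in X%:R * _](card_ord d.+1) -sum_const; apply: ler_sum => x _; apply: H.
exact: measurable_slice.
Qed.

End product_with_states.

(** * Total variation is finer than weak convergence *)

Section layer_cake.
Context {R : realType}.

(** The sum counts the levels, spaced by [delta], that [y] reaches; it is the staircase
    function just below the identity, up to the height [N%:R * delta]. *)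
Lemma staircase (delta y : R) (N : nat) : 0 < delta -> 0 <= y ->
  let S := \sum_(j < N) delta * ((j.+1%:R * delta <= y)%R)%:R in
  [/\ S <= y, y <= N%:R * delta -> y - delta <= S & N%:R * delta <= y -> S = N%:R * delta].
Proof.
move=> d0 y0 /=; elim: N => [|N [IH1 IH2 IH3]].
  by rewrite big_ord0 mul0r; split => //; lra.
rewrite big_ord_recr /= -natr1 mulrDl mul1r.
have [h|h] := lerP (N%:R * delta + delta) y; rewrite ?mulr1 ?mulr0 ?addr0; split => //.
- by rewrite IH3//; lra.
- by rewrite IH3//; lra.
- by rewrite IH3//; lra.
- by move=> _; have [/IH2//|h2] := lerP y (N%:R * delta); rewrite IH3; lra.
Qed.

End layer_cake.

Section weak_from_total_variation.
Context {R : realType} {d : nat} {U : pmetricType R}.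
Local Notation Sigma := 'I_d.+1.
Local Notation E := (U * states d)%type.
Variable mu : probability (borel U) R.

(** Up to [delta], a bounded continuous function is a staircase, that is, a finite
    combination of indicators of measurable sets. *)
Lemma mean_tvclose (phi : E -> R) C e : continuous phi -> (forall z, `|phi z| <= C) -> 0 < e ->
  exists2 eta, 0 < eta & forall m m' : probability (borel E) R, tvclose m m' eta ->
    `|mean m (phi : borel E -> R) - mean m' (phi : borel E -> R)| <= e.
Proof.
move=> cphi phiC e0; have C0 : 0 <= C by exact: le_trans (phiC point).
pose delta := e / 4; have d0 : 0 < delta by rewrite divr_gt0.
pose N := Num.bound (2 * C / delta).
have NC : 2 * C <= N%:R * delta.
  by rewrite -ler_pdivrMr// ltW// archi_boundP// divr_ge0// ?mulr_ge0// ltW.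
pose K := N%:R * delta * d.+1%:R; have K0 : 0 <= K by rewrite !mulr_ge0// ltW.
exists (e / (2 * (K + 1))); first by rewrite divr_gt0// mulr_gt0// ltr_wpDl.
set eta := e / _ => m m' H.
pose S j : set (borel E) := [set z | j.+1%:R * delta <= phi z + C].
have mphi := continuous_borel cphi.
have mS j : measurable (S j).
  rewrite (_ : S j = phi @^-1` `[j.+1%:R * delta - C, +oo[).
    by rewrite -[X in measurable X]setTI; apply: mphi.
  by apply/seteqP; split => z /=; rewrite in_itv /= andbT lerBlDr.
pose st (z : borel E) : R := \sum_(j < N) delta * \1_(S j) z.
have bind j : bounded_measurable (\1_(S j) : borel E -> R).
  split; first exact: measurable_indic.
  by exists 1 => z; rewrite indicE; case: (_ \in _); rewrite ?normr0 ?normr1.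
have bst : bounded_measurable st by apply: bm_sum => j; apply: bmZ.
have bphi : bounded_measurable (phi : borel E -> R) by split => //; exists C.
have st1 z : `|phi z + C - st z| <= delta.
  have := phiC z; rewrite ler_norml => /andP[p1 p2].
  have y0 : 0 <= phi z + C by lra.
  have -> : st z = \sum_(j < N) delta * ((j.+1%:R * delta <= phi z + C)%R)%:R.
    apply: eq_bigr => j _; rewrite indicE; congr (_ * (nat_of_bool _)%:R).
    by apply/idP/idP => h; [move: h; rewrite inE|rewrite inE].
  have [s1 s2 _] := staircase N d0 y0.
  have s3 := s2 (_ : phi z + C <= N%:R * delta).
  by rewrite ler_norml; apply/andP; split; [lra|have := s3 ltac:(lra); lra].
have mean_st (P : probability (borel E) R) : `|mean P (phi : borel E -> R) + C - mean P st| <= delta.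
  rewrite -[X in _ + X - _](mean_cst P C) -meanD//; last exact: bm_cst.
  rewrite -meanB//; last by apply: bmD => //; exact: bm_cst.
  have b : bounded_measurable (fun z : borel E => phi z + C - st z).
    by apply: bmB => //; apply: bmD => //; exact: bm_cst.
  rewrite ler_norml; apply/andP; split.
    rewrite -(mean_cst P (- delta)); apply: mean_le => //; first exact: bm_cst.
    by move=> z; have := st1 z; rewrite ler_norml => /andP[].
  rewrite -(mean_cst P delta); apply: mean_le => //; first exact: bm_cst.
  by move=> z; have := st1 z; rewrite ler_norml => /andP[].
have st_sum (P : probability (borel E) R) : mean P st = \sum_(j < N) delta * fine (P (S j)).
  rewrite mean_sum; last by move=> j; apply: bmZ.
  apply: eq_bigr => j _; rewrite meanZ//; congr (_ * _).
  by rewrite /mean /Rintegral integral_indic// setIT.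
have stm : `|mean m st - mean m' st| <= K * eta.
  rewrite !st_sum -sumrB; apply: (le_trans (ler_norm_sum _ _ _)).
  apply: (@le_trans _ _ (\sum_(j < N) delta * (d.+1%:R * eta))).
    apply: ler_sum => j _; rewrite -mulrBr normrM gtr0_norm// ler_wpM2l ?(ltW d0)//.
    exact: tvclose_set.
  by rewrite sum_const card_ord /K !mulrA.
have Keta : K * eta <= e / 2.
  have -> : e / 2 = (K + 1) * eta by rewrite /eta; field; rewrite gt_eqF// ltr_wpDl.
  by rewrite ler_wpM2r ?lerDl// divr_ge0 ?(ltW e0)// mulr_ge0// addr_ge0.
have h1 := mean_st m; have h2 := mean_st m'.
move: h1 h2 stm; rewrite !ler_norml => /andP[? ?] /andP[? ?] /andP[? ?].
by have de : delta = e / 4 by []; apply/andP; split; lra.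
Qed.

(** The filter of neighbourhoods of [m] in total variation, within the measures of
    first marginal [mu], converges weakly to [m]. *)
Lemma coupling_tvclose (Q : Sigma -> prob_US d U -> U -> R) x (m : prob_US d U) u e :
  bounded_continuous_coupling mu Q -> Pmu mu m -> 0 < e ->
  exists2 eta, 0 < eta & \forall u' \near u, forall m' : prob_US d U, Pmu mu m' ->
    tvclose m m' eta -> `|Q x m' u' - Q x m u| < e.
Proof.
move=> [_ cQ] Pm e0.
pose G : set_system (prob_US d U) := filter_from [set eta : R | 0 < eta]
  (fun eta => [set m' : prob_US d U | Pmu mu m' /\ tvclose m m' eta]).
have FG : Filter G.
  apply: filter_from_filter; first by exists 1 => /=.
  move=> e1 e2 /= e10 e20; exists (Num.min e1 e2); first by rewrite /= lt_min e10.
  move=> m' [Pm' H]; split; split => // y A mA; apply: (le_trans (H y A mA)).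
    by rewrite ge_min lexx.
  by rewrite ge_min lexx orbT.
have Gm : G --> m.
  apply: initial_cvg; apply: prod_topology_cvg => phi.
  have [cphi [C phiC]] := svalP phi.
  apply/cvgrPdist_le => r r0.
  have [eta eta0 Heta] := mean_tvclose cphi phiC r0.
  by exists eta => // m' [_ H]; exact: Heta.
have /subspace_continuousP/(_ (m, u) (conj Pm I))/cvgrPdist_lt/(_ e e0) := cQ x.
move=> [[B1 B2] /= [/Gm [eta eta0 HB1] HB2] HB].
exists eta => //; apply: filterS HB2 => u' Hu' m' Pm' Hm'.
rewrite distrC; apply: (HB (m', u')) => //=.
by split => //; apply: HB1.
Qed.

End weak_from_total_variation.

(** * Follow the leader *)

Section averages.
Context {R : realType}.

(** The average of no data is [0], since [0^-1 = 0]; the first answer of the sequence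
    of leaders is thus optimal for zero data. *)
Definition average (a : nat -> R) (n : nat) : R := (\sum_(i < n) a i) / n%:R.

Lemma average_le a C n : 0 <= C -> (forall i, (i < n)%N -> `|a i| <= C) -> `|average a n| <= C.
Proof.
move=> C0 aC; case: n aC => [|n] aC; first by rewrite /average invr0 mulr0 normr0.
rewrite /average normrM normfV [`|n.+1%:R|]ger0_norm// ler_pdivrMr ?ltr0n//.
apply: (le_trans (ler_norm_sum _ _ _)); rewrite mulrC -[X in X%:R * _](card_ord n.+1) -sum_const.
by apply: ler_sum => i _; exact: aC.
Qed.

Lemma averageB a b n : average (fun i => a i - b i) n = average a n - average b n.
Proof. by rewrite /average sumrB mulrBl. Qed.

Lemma average_succ a n : average a n.+1 - average a n = (a n - average a n) / n.+1%:R.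
Proof.
case: n => [|n]; first by rewrite /average big_ord0 big_ord_recr big_ord0 /= mul0r add0r !subr0.
rewrite /average big_ord_recr /=; move: (\sum_(i < _) _) => S.
by field; rewrite -natr1 !gt_eqF//= ?ltr_wpDl// ltr0n.
Qed.

(** Cesaro's lemma, uniformly over the parameters in [S]. *)
Lemma average_uniform (J : Type) (S : set J) (a : nat -> J -> R) (C : R) :
  (forall n j, S j -> `|a n j| <= C) ->
  (forall e, 0 < e -> \forall n \near \oo, forall j, S j -> `|a n j| <= e) ->
  forall e, 0 < e -> \forall n \near \oo, forall j, S j -> `|average (a ^~ j) n| <= e.
Proof.
move=> aC ae e e0; have e2 : 0 < e / 2 by rewrite divr_gt0.
have [N0 _ H] := ae _ e2.
near=> n => j Sj.
have n0 : (0 < n)%N by near: n; exists 1%N.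
have nC : N0%:R * C <= n%:R * (e / 2).
  rewrite -ler_pdivrMr//; near: n; exists (Num.bound `|N0%:R * C / (e / 2)|) => // k /= hk.
  apply: le_trans (ler_norm _) _; apply: ltW.
  by apply: (lt_le_trans (archi_boundP (normr_ge0 _))); rewrite ler_nat.
have C0 : 0 <= C := le_trans (normr_ge0 _) (aC 0%N j Sj).
have sum k : \sum_(i < k) `|a i j| <= (minn k N0)%:R * C + k%:R * (e / 2).
  elim: k => [|k IH]; first by rewrite big_ord0 min0n !mul0r addr0.
  rewrite big_ord_recr /= -[k.+1%:R]natr1 mulrDl mul1r.
  have [kN|Nk] := ltnP k N0.
    have h := aC k j Sj; move: IH; rewrite (minn_idPl kN) (minn_idPl (ltnW kN)) -[k.+1%:R]natr1 mulrDl mul1r; lra.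
  have h := H k Nk j Sj; move: IH; rewrite (minn_idPr Nk) (minn_idPr (leqW Nk)); lra.
rewrite /average normrM normfV (@ger0_norm _ n%:R)// ler_pdivrMr ?ltr0n//.
apply: (le_trans (ler_norm_sum _ _ _)); apply: (le_trans (sum n)).
apply: (@le_trans _ _ (N0%:R * C + n%:R * (e / 2))); last by lra.
by rewrite lerD2r ler_wpM2r// ler_nat geq_minr.
Unshelve. all: by end_near. Qed.

Lemma average_harmonic_small e : 0 < e ->
  \forall n \near \oo, `|average (fun n => n.+1%:R^-1 : R) n| <= e.
Proof.
move=> e0; have := @average_uniform unit setT (fun n _ => n.+1%:R^-1 : R) 1.
move=> /(_ _ _ e e0) H.
have {}H : \forall n \near \oo, forall j : unit, setT j -> `|average (fun n => n.+1%:R^-1 : R) n| <= e.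
  apply: H => [n _ _|r r0]; first by rewrite ger0_norm ?invr_ge0// invf_le1 ?ltr0n// ler1n.
  have /cvgr0Pnorm_le/(_ _ r0) := @cvg_harmonic R.
  by apply: filterS => n h _ _; exact: h.
by apply: filterS H => n /(_ tt); exact.
Qed.

End averages.

Section regret.
Context {R : realType}.

(** The abstract game: [P i n] is the part of the cost of the answer [n] that is due
    to the datum [i], [Psi N] the optimal total cost against the average of the data
    [i < N], and [D n N] a distance from the answer [n] to the optimal one, bounded
    by the suboptimality of [n] through duality. Each answer, chosen without the
    newest datum, costs against it little more than the next answer, so the leaders
    pay on average hardly more than the optimal cost. At the two times [N] and [K]
    the optimal costs cancel out, and the mixed costs recombine into the differences
    that monotonicity signs. *)
Lemma follow_the_leader (P D : nat -> nat -> R) (Psi : nat -> R) (C : R)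
    (h := average (fun n => n.+1%:R^-1)) :
  (forall n N, 0 <= D n N) ->
  (forall n N, Psi N - Psi n + D n N <= average (P ^~ n) N - average (P ^~ n) n) ->
  (forall n, (P n n - average (P ^~ n) n) - (P n n.+1 - average (P ^~ n.+1) n) <= C / n.+1%:R) ->
  forall N K, (0 < N)%N -> (0 < K)%N ->
  average (D ^~ N) K + average (D ^~ K) N +
  (\sum_(i < N) \sum_(k < K) (P i i + P k k - P i k - P k i)) / (N%:R * K%:R)
    <= C * (h N + h K).
Proof.
pose avg N n := average (P ^~ n) N.
move=> D0 dual' step'.
have dual n N : Psi N - Psi n + D n N <= avg N n - avg n n := dual' n N.
have step n : (P n n - avg n n) - (P n n.+1 - avg n n.+1) <= C / n.+1%:R := step' n.
pose e n := Psi n + P n n - avg n n.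
have avgE N n : N%:R * avg N n = \sum_(i < N) P i n.
  rewrite /avg /average; case: N => [|N]; first by rewrite big_ord0 !mul0r.
  by rewrite mulrC divfK.
have reg N : \sum_(n < N) e n - N%:R * Psi N <= C * \sum_(n < N) n.+1%:R^-1.
  elim: N => [|N IH]; first by rewrite !big_ord0 mul0r subrr mulr0.
  rewrite !big_ord_recr /= mulrDr.
  suff key : e N - N.+1%:R * Psi N.+1 + N%:R * Psi N <= C / N.+1%:R.
    move: IH key; set A := \sum_(n < N) e n; set B := N%:R * _; set S := C * _; set c := C / _.
    by move: A B S c (e N) (N.+1%:R * _) => A B S c E Q; lra.
  have h1 := dual N.+1 N; have h2 := D0 N.+1 N; have h3 := step N.
  have h4 : N%:R * Psi N - N%:R * Psi N.+1 <= N%:R * avg N N.+1 - N%:R * avg N.+1 N.+1.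
    by rewrite -!mulrBr ler_wpM2l//; lra.
  have h5 := avgE N.+1 N.+1; rewrite big_ord_recr /= -avgE in h5.
  have s1 X : N.+1%:R * X = N%:R * X + X by rewrite -natr1 mulrDl mul1r.
  move: h1 h2 h3 h4 h5; rewrite /e !s1.
  move: (N%:R * avg N.+1 N.+1) (N%:R * avg N N.+1) (N%:R * Psi N) (N%:R * Psi N.+1) => z1 z2 z3 z4.
  move: (C / _) (avg N N) (avg N N.+1) (avg N.+1 N.+1) => c a1 a2 a3.
  by lra.
have half N K : (0 < K)%N -> Psi N + (\sum_(n < K) D n N) / K%:R <=
    Psi K + C * h K - (\sum_(n < K) P n n) / K%:R + (\sum_(n < K) avg N n) / K%:R.
  move=> K0; have Kp : 0 < K%:R :> R by rewrite ltr0n.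
  have Kn : K%:R != 0 :> R by rewrite gt_eqF.
  have h1 : K%:R * Psi N + \sum_(n < K) D n N <= \sum_(n < K) (e n - P n n + avg N n).
    rewrite -[X in X%:R * _](card_ord K) -sum_const -big_split /=.
    by apply: ler_sum => n _; have := dual n N; rewrite /e; lra.
  have h2 := reg K; rewrite -(ler_pM2r Kp) !mulrDl mulNr !divfK//.
  rewrite /h mulrA divfK//; move: h1; rewrite big_split sumrB /=; lra.
move=> N K N0 K0.
have Np : 0 < N%:R :> R by rewrite ltr0n.
have Kp : 0 < K%:R :> R by rewrite ltr0n.
have a1 := half N K K0; have a2 := half K N N0.
have E : (\sum_(i < N) \sum_(k < K) (P i i + P k k - P i k - P k i)) / (N%:R * K%:R) =
   (\sum_(n < K) P n n) / K%:R + (\sum_(n < N) P n n) / N%:R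
   - (\sum_(n < K) avg N n) / K%:R - (\sum_(n < N) avg K n) / N%:R.
  have -> : \sum_(n < K) avg N n = (\sum_(i < N) \sum_(k < K) P i k) / N%:R.
    by rewrite exchange_big mulr_suml; apply: eq_bigr.
  have -> : \sum_(n < N) avg K n = (\sum_(i < N) \sum_(k < K) P k i) / K%:R.
    by rewrite mulr_suml; apply: eq_bigr.
  have -> : \sum_(i < N) \sum_(k < K) (P i i + P k k - P i k - P k i) =
    K%:R * (\sum_(i < N) P i i) + N%:R * (\sum_(k < K) P k k)
    - \sum_(i < N) \sum_(k < K) P i k - \sum_(i < N) \sum_(k < K) P k i.
    rewrite (eq_bigr (fun i : 'I_N => (K%:R * P i i + \sum_(k < K) P k k - \sum_(k < K) P i k) - \sum_(k < K) P k i)).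
      by rewrite !sumrB big_split /= sum_const card_ord -mulr_sumr.
    by move=> i _; rewrite !sumrB big_split /= sum_const card_ord.
  by field; rewrite !gt_eqF.
by rewrite E /h /average in a1 a2 *; lra.
Qed.

End regret.

Section total_gain.
Context {R : realType} {d : nat} (T : R).
Hypothesis T0 : 0 < T.
Local Notation Sigma := 'I_d.+1.
Implicit Types (f m : R -> Sigma -> R) (g : Sigma -> R).

Let TT : T \in `[0, T]. Proof. by rewrite in_itv /= lexx ltW. Qed.

(** The right-hand side of [flow_duality]; its bilinearity allows data to be
    averaged. *)
Definition gain f g m : R := prim T (fun s => \sum_x m s x * f s x) T + \sum_x m T x * g x.

Lemma gain_icontinuous f m : (forall x, icontinuous T (f ^~ x)) -> (forall x, icontinuous T (m ^~ x)) ->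
  icontinuous T (fun s => \sum_x m s x * f s x).
Proof. by move=> cf cm; apply: icontinuous_sum => x; exact: icontinuousM. Qed.

Lemma gainB f f' g g' m : (forall x, icontinuous T (f ^~ x)) -> (forall x, icontinuous T (f' ^~ x)) ->
  (forall x, icontinuous T (m ^~ x)) ->
  gain (fun t x => f t x - f' t x) (fun x => g x - g' x) m = gain f g m - gain f' g' m.
Proof.
move=> cf cf' cm; rewrite /gain.
rewrite (prim_ext T0 (g := fun s => \sum_x m s x * f s x - \sum_x m s x * f' s x))//; last first.
  by move=> s _; rewrite -sumrB; apply: eq_bigr => x _; rewrite mulrBr.
rewrite primB//; [|exact: gain_icontinuous|exact: gain_icontinuous].
rewrite (eq_bigr (fun x => m T x * g x - m T x * g' x)) ?sumrB => [|x _]; last by rewrite mulrBr.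
by ring.
Qed.

Lemma gainB_flow f g m m' : (forall x, icontinuous T (f ^~ x)) ->
  (forall x, icontinuous T (m ^~ x)) -> (forall x, icontinuous T (m' ^~ x)) ->
  gain f g (fun t x => m t x - m' t x) = gain f g m - gain f g m'.
Proof.
move=> cf cm cm'; rewrite /gain.
rewrite (prim_ext T0 (g := fun s => \sum_x m s x * f s x - \sum_x m' s x * f s x))//; last first.
  by move=> s _; rewrite -sumrB; apply: eq_bigr => x _; rewrite mulrBl.
rewrite primB//; [|exact: gain_icontinuous|exact: gain_icontinuous].
rewrite (eq_bigr (fun x => m T x * g x - m' T x * g x)) ?sumrB => [|x _]; last by rewrite mulrBl.
by ring.
Qed.

Lemma average_icontinuous (f_ : nat -> R -> Sigma -> R) n : (forall i x, icontinuous T (f_ i ^~ x)) ->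
  forall x, icontinuous T (fun t => average (fun i => f_ i t x) n).
Proof.
move=> cf x; apply: icontinuousM; last exact: icontinuous_cst.
by apply: icontinuous_sum => i; exact: cf.
Qed.

Lemma gain_average (f_ : nat -> R -> Sigma -> R) (g_ : nat -> Sigma -> R) m n :
  (forall i x, icontinuous T (f_ i ^~ x)) -> (forall x, icontinuous T (m ^~ x)) ->
  gain (fun t x => average (fun i => f_ i t x) n) (fun x => average (fun i => g_ i x) n) m =
  average (fun i => gain (f_ i) (g_ i) m) n.
Proof.
move=> cf cm; rewrite /gain /average big_split /= mulrDl.
have ci i : icontinuous T (fun s => \sum_x m s x * f_ i s x).
  by apply: gain_icontinuous => // x; exact: cf.
rewrite -(prim_sum T0 (index_enum 'I_n) (f := fun (i : 'I_n) s => \sum_x m s x * f_ i s x))//.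
rewrite mulrC -primZ//; last by apply: icontinuous_sum => i; exact: ci.
congr (_ + _).
  apply: prim_ext => // s _; rewrite exchange_big mulr_sumr; apply: eq_bigr => x _ /=.
  by rewrite -mulr_sumr; ring.
rewrite exchange_big mulr_suml; apply: eq_bigr => x _ /=.
by rewrite -mulr_sumr mulrA.
Qed.

Lemma gain_bound f g m A B : 0 <= A -> (forall x, icontinuous T (f ^~ x)) ->
  (forall x, icontinuous T (m ^~ x)) ->
  (forall t x, t \in `[0, T] -> `|f t x| <= A) -> (forall x, `|g x| <= A) ->
  (forall t, t \in `[0, T] -> \sum_x `|m t x| <= B) ->
  `|gain f g m| <= A * B * (T + 1).
Proof.
move=> A0 cf cm fA gA mB; rewrite mulrDr mulr1.
have H t (k : Sigma -> R) : t \in `[0, T] -> (forall x, `|k x| <= A) -> `|\sum_x m t x * k x| <= A * B.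
  move=> tT kA; apply: (le_trans (ler_norm_sum _ _ _)).
  apply: (@le_trans _ _ (A * \sum_x `|m t x|)); last by rewrite ler_wpM2l// mB.
  by rewrite mulr_sumr; apply: ler_sum => x _; rewrite normrM mulrC ler_wpM2r.
apply: (le_trans (ler_normD _ _)); apply: lerD; last exact: H.
apply: prim_bound => //; first exact: gain_icontinuous.
by move=> s sT; apply: H => // x; exact: fA.
Qed.

End total_gain.

Section leaders.
Context {R : realType} {d : nat} {U : pmetricType R}.
Local Notation Sigma := 'I_d.+1.
Local Notation vec := 'rV[R]_d.+1.
Variables (L : Sigma -> vec -> U -> R) (gam CL T CF : R).
Hypothesis rc : regular_control L gam CL.
Hypothesis T0 : 0 < T.
Hypothesis CF0 : 0 < CF.

Local Notation data := (coupling_data T CF).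
Let CF0' : 0 <= CF. Proof. exact: ltW. Qed.

(** [follow_the_leader] at a fixed [u], with a constant independent of [u]. Its last
    hypothesis asks for a bound of the gain [q] of [f_ n] over the average between two
    consecutive answers. On the one hand [q] is at most linear in the distance of
    these answers; on the other hand consecutive averages differ by a fraction
    [1 / n.+1] of [f_ n] minus the average, so duality both ways round bounds the
    squared distance by a multiple of [q / n.+1]. Together, [q] is of order
    [1 / n.+1]. *)
Lemma leader_regret : exists2 kap, 0 < kap & exists C, forall u
  (f_ : nat -> R -> Sigma -> R) (g_ : nat -> Sigma -> R) (V_ m_ : nat -> R -> Sigma -> R) (ini : Sigma -> R),
  (forall n x, icontinuous T (f_ n ^~ x)) -> (forall n, data (f_ n) (g_ n)) -> prob_vector ini ->
  (forall n, hjb L T u (fun t x => average (fun i => f_ i t x) n) (fun x => average (fun i => g_ i x) n) (V_ n)) ->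
  (forall n, kolmogorov L T u (V_ n) ini (m_ n)) ->
  forall N K t, (0 < N)%N -> (0 < K)%N -> t \in `[0, T] ->
  average (fun n => kap * \sum_x (m_ n t x - m_ N t x) ^+ 2) K +
  average (fun n => kap * \sum_x (m_ n t x - m_ K t x) ^+ 2) N +
  (\sum_(i < N) \sum_(k < K) gain T (fun t x => f_ i t x - f_ k t x) (fun x => g_ i x - g_ k x)
     (fun t x => m_ i t x - m_ k t x)) / (N%:R * K%:R)
  <= C * (average (fun n => n.+1%:R^-1) N + average (fun n => n.+1%:R^-1) K).
Proof.
have [kap k0 Hk] := flow_duality rc T0 CF0'; exists kap => //.
pose D := CF * (T + 1); have D0 : 0 < D by rewrite mulr_gt0// addr_gt0.
exists (2 * d.+1%:R * D ^+ 2 / kap) => u f_ g_ V_ m_ ini cf fg p0 hV hm N K t N0 K0 tT.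
have fe (r a b p : R) : 0 < r -> 0 < a -> 0 < b ->
    p / (4 * b * a * r) = (2 * a)^-1 * ((2 * b)^-1 * (p / r)).
  by move=> r0 a0 b0; field; rewrite !gt_eqF.
have fe2 (n r a b p : R) : 0 < r -> 0 < a -> 0 < b ->
    2 * a * (n * (a / (b * r) / 2) + p / (4 * b * (a / (b * r)) * r)) = (2 * n * a ^+ 2 / b / r + p) / 2.
  by move=> r0 a0 b0; field; rewrite !gt_eqF.
have mid (x y : R) : x <= (y + x) / 2 -> x <= y by lra.
have cm n x : icontinuous T (m_ n ^~ x) by exact: (kolmogorov_icontinuous T0 (hm n)).
pose b n t x := average (fun i => f_ i t x) n; pose c n x := average (fun i => g_ i x) n.
have cb n x : icontinuous T (b n ^~ x) by exact: average_icontinuous.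
have bc n : data (b n) (c n).
  split=> [s x sT|x]; apply: average_le => // i _; [exact: (fg i).1|exact: (fg i).2].
pose P i n := gain T (f_ i) (g_ i) (m_ n).
pose Psi N := \sum_x ini x * V_ N 0 x.
have gainE i n : gain T (b i) (c i) (m_ n) = average (P ^~ n) i.
  by rewrite gain_average.
have dual s n k : s \in `[0, T] ->
    Psi k - Psi n + kap * (\sum_x (m_ n s x - m_ k s x) ^+ 2) <= average (P ^~ n) k - average (P ^~ n) n.
  move=> sT; have := Hk u _ _ _ _ _ _ _ _ _ (cb n) (cb k) (bc n) (bc k) (hV n) (hV k) (hm n) (hm k) p0 s sT.
  rewrite -/(gain T (fun s x => b k s x - b n s x) (fun x => c k x - c n x) (m_ n)) gainB// !gainE.
  by rewrite /Psi -sumrB; under eq_bigr do rewrite mulrBr.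
have step n : (P n n - average (P ^~ n) n) - (P n n.+1 - average (P ^~ n.+1) n) <=
    2 * d.+1%:R * D ^+ 2 / kap / n.+1%:R.
  set q := leLHS; have n1 : 0 < n.+1%:R :> R by rewrite ltr0n.
  have Z s : s \in `[0, T] -> 2 * kap * (\sum_x (m_ n s x - m_ n.+1 s x) ^+ 2) <= q / n.+1%:R.
    move=> sT; have h1 := dual s n n.+1 sT; have h2 := dual s n.+1 n sT.
    have h3 : \sum_x (m_ n.+1 s x - m_ n s x) ^+ 2 = \sum_x (m_ n s x - m_ n.+1 s x) ^+ 2.
      by apply: eq_bigr => x _; ring.
    have h4 := average_succ (P ^~ n) n; have h5 := average_succ (P ^~ n.+1) n.
    rewrite /q mulrBl -h4 -h5; move: h1 h2; rewrite h3 -mulrA.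
    by move: (kap * _) => Y; lra.
  (* the weight in Young's inequality for which half of [q] is absorbed *)
  pose th := D / (kap * n.+1%:R); have th0 : 0 < th by rewrite divr_gt0// mulr_gt0.
  have qE : q = gain T (fun t x => f_ n t x - b n t x) (fun x => g_ n x - c n x) (fun t x => m_ n t x - m_ n.+1 t x).
    rewrite gainB_flow//; last by move=> x; exact: icontinuousB.
    by rewrite !gainB// !gainE.
  have B s : s \in `[0, T] -> \sum_x `|m_ n s x - m_ n.+1 s x| <= d.+1%:R * (th / 2) + q / (4 * kap * th * n.+1%:R).
    move=> sT; apply: (@le_trans _ _ (\sum_x (th / 2 + (2 * th)^-1 * (m_ n s x - m_ n.+1 s x) ^+ 2))).
      apply: ler_sum => x _; set z := _ - _.
      have : 0 <= (`|z| - th) ^+ 2 / (2 * th) by rewrite divr_ge0 ?sqr_ge0// mulr_ge0// ltW.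
      rewrite (_ : _ / _ = th / 2 + (2 * th)^-1 * z ^+ 2 - `|z|); first lra.
      by rewrite sqrrB real_normK ?num_real//; field; rewrite gt_eqF.
    rewrite big_split /= sum_const card_ord -mulr_sumr lerD2l.
    have -> : q / (4 * kap * th * n.+1%:R) = (2 * th)^-1 * ((2 * kap)^-1 * (q / n.+1%:R)).
      exact: fe.
    apply: ler_wpM2l; first by rewrite invr_ge0 mulr_ge0// ltW.
    by rewrite ler_pdivlMl ?mulr_gt0//; exact: Z.
  have dA t' x : t' \in `[0, T] -> `|f_ n t' x - b n t' x| <= 2 * CF.
    move=> tT'; apply: (le_trans (ler_normB _ _)).
    have := (fg n).1 t' x tT'; have := (bc n).1 t' x tT'; lra.
  have dB x : `|g_ n x - c n x| <= 2 * CF.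
    by apply: (le_trans (ler_normB _ _)); have := (fg n).2 x; have := (bc n).2 x; lra.
  have := @gain_bound R d T T0 _ _ _ (2 * CF) _ _ _ _ dA dB B.
  rewrite -qE => /(_ _ _ _)/(le_trans (ler_norm _)) h.
  have {h} : q <= 2 * D * (d.+1%:R * (th / 2) + q / (4 * kap * th * n.+1%:R)).
    apply: le_trans (h _ _ _) _.
    - by rewrite mulr_ge0.
    - by move=> x; exact: icontinuousB.
    - by move=> x; exact: icontinuousB.
    - by rewrite /D le_eqVlt; apply/orP; left; apply/eqP; ring.
  have -> : 2 * D * (d.+1%:R * (th / 2) + q / (4 * kap * th * n.+1%:R)) =
     (2 * d.+1%:R * D ^+ 2 / kap / n.+1%:R + q) / 2.
    exact: fe2.
  exact: mid.
have -> : \sum_(i < N) \sum_(k < K) gain T (fun t x => f_ i t x - f_ k t x) (fun x => g_ i x - g_ k x)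
     (fun t x => m_ i t x - m_ k t x) = \sum_(i < N) \sum_(k < K) (P i i + P k k - P i k - P k i).
  apply: eq_bigr => i _; apply: eq_bigr => k _.
  rewrite gainB_flow//; last by move=> x; exact: icontinuousB.
  by rewrite !gainB// /P; ring.
apply: (@follow_the_leader R P (fun n k => kap * \sum_x (m_ n t x - m_ k t x) ^+ 2) Psi _ _ _ step N K N0 K0).
- by move=> n k; rewrite mulr_ge0 ?(ltW k0)// sumr_ge0// => x _; exact: sqr_ge0.
- by move=> n k; exact: dual.
Qed.

End leaders.

(** * Couplings along Lipschitz flows of measures *)

Section measure_flows.
Context {R : realType} {d : nat} {U : pmetricType R}.
Local Notation Sigma := 'I_d.+1.
Variables (mu : probability (borel U) R) (T : R).
Hypothesis T0 : 0 < T.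
Implicit Types (M : R -> prob_US d U).

Let T0' : 0 <= T. Proof. exact: ltW. Qed.

(** Total variation, rather than the weak topology, because the Kolmogorov equation
    gives it directly and [coupling_tvclose] turns it into continuity in time of the
    couplings. *)
Definition lipschitz_flow M := (forall t, t \in `[0, T] -> Pmu mu (M t)) /\
  exists2 B, 0 <= B & forall s t, s \in `[0, T] -> t \in `[0, T] -> tvclose (M t) (M s) (B * `|t - s|).

Lemma tvclose_trans (m1 m2 m3 : prob_US d U) (a b : R) :
  tvclose m1 m2 a -> tvclose m2 m3 b -> tvclose m1 m3 (a + b).
Proof.
move=> h1 h2 x A mA.
rewrite (_ : _ - _ = (fine ((m1 : probability _ R) (layer x A)) - fine ((m2 : probability _ R) (layer x A))) +
   (fine ((m2 : probability _ R) (layer x A)) - fine ((m3 : probability _ R) (layer x A)))); last by ring.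
by apply: (le_trans (ler_normD _ _)); apply: lerD; [exact: h1|exact: h2].
Qed.

Lemma tvclose_le (m1 m2 : prob_US d U) (a b : R) : a <= b -> tvclose m1 m2 a -> tvclose m1 m2 b.
Proof. by move=> ab h x A mA; exact: le_trans (h x A mA) ab. Qed.

Lemma tvclose_sym (m1 m2 : prob_US d U) (a : R) : tvclose m1 m2 a -> tvclose m2 m1 a.
Proof. by move=> h x A mA; rewrite distrC; exact: h. Qed.

Variable Q : Sigma -> prob_US d U -> U -> R.
Hypothesis bQ : bounded_continuous_coupling mu Q.

Lemma coupling_uniform_near (J : Type) (F : set_system J) (FF : Filter F) (M_ : J -> R -> prob_US d U) M
    (u_ : J -> U) u x : lipschitz_flow M -> (forall j t, t \in `[0, T] -> Pmu mu (M_ j t)) ->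
  (forall e, 0 < e -> \forall j \near F, forall t, t \in `[0, T] -> tvclose (M_ j t) (M t) e) ->
  u_ @ F --> u ->
  forall e, 0 < e -> \forall j \near F, forall t, t \in `[0, T] -> `|Q x (M_ j t) (u_ j) - Q x (M t) u| < e.
Proof.
move=> [PM [B B0 MB]] PM_ cM cu e e0.
have : \forall j \near F, forall t, t \in `[0, T] -> `|Q x (M_ j (clamp T t)) (u_ j) - Q x (M (clamp T t)) u| < e.
  apply: (uniform_near (h := fun t j => Q x (M_ j (clamp T t)) (u_ j) - Q x (M (clamp T t)) u)) => // t tT r r0.
  have r2 : 0 < r / 2 by rewrite divr_gt0.
  have [eta eta0 near_u] := coupling_tvclose x u bQ (PM t tT) r2.
  have eta2 : 0 < eta / 2 by rewrite divr_gt0.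
  have B1 : 0 < B + 1 by rewrite ltr_wpDl.
  have n1 : \forall z \near filter_prod (nbhs t) F, B * `|clamp T z.1 - t| <= eta / 2.
    have : \forall s \near t, B * `|clamp T s - t| <= eta / 2.
      have r3 : 0 < eta / 2 / (B + 1) by rewrite divr_gt0.
      have /cvgrPdist_le/(_ _ r3) := @clamp_continuous R T t.
      rewrite clamp_id//; apply: filterS => s; rewrite distrC ler_pdivlMr// => h.
      apply: le_trans h; rewrite mulrC ler_wpM2l// lerDl//.
    by move=> h; exact: (@cvg_fst _ _ (nbhs t) F _ _ h).
  have n2 : \forall z \near filter_prod (nbhs t) F, forall t, t \in `[0, T] -> tvclose (M_ z.2 t) (M t) (eta / 2).
    exact: (@cvg_snd _ _ (nbhs t) F _ _ (cM _ eta2)).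
  have n3 : \forall z \near filter_prod (nbhs t) F, forall m', Pmu mu m' -> tvclose (M t) m' eta ->
      `|Q x m' (u_ z.2) - Q x (M t) u| < r / 2.
    exact: (@cvg_snd _ _ (nbhs t) F _ _ (cu _ near_u)).
  near=> z.
  have z1 : B * `|clamp T z.1 - t| <= eta / 2 by near: z.
  have z2 : forall t, t \in `[0, T] -> tvclose (M_ z.2 t) (M t) (eta / 2) by near: z.
  have z3 : forall m', Pmu mu m' -> tvclose (M t) m' eta -> `|Q x m' (u_ z.2) - Q x (M t) u| < r / 2.
    by near: z.
  have cT := clamp_itv z.1 T0'; have c1 := MB t (clamp T z.1) tT cT.
  have c2 : tvclose (M (clamp T z.1)) (M t) (eta / 2) by exact: tvclose_le c1.
  have c3 : tvclose (M (clamp T z.1)) (M t) eta by apply: tvclose_le c2; lra.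
  have c4 : tvclose (M_ z.2 (clamp T z.1)) (M t) eta.
    by rewrite [eta]splitr; exact: tvclose_trans (z2 _ cT) c2.
  have h1 := z3 _ (PM_ _ _ cT) (tvclose_sym c4).
  have h2 := nbhs_singleton near_u _ (PM _ cT) (tvclose_sym c3).
  move: h1 h2; rewrite /= !ltr_norml => /andP[? ?] /andP[? ?]; apply/andP; split; lra.
by apply: filterS => j H t tT; have := H t tT; rewrite clamp_id.
Unshelve. all: by end_near. Qed.

Lemma coupling_near M x u e : lipschitz_flow M -> 0 < e ->
  \forall u' \near u, forall t, t \in `[0, T] -> `|Q x (M t) u' - Q x (M t) u| < e.
Proof.
move=> lM e0; apply: (@coupling_uniform_near U (nbhs u) _ (fun _ => M) M id u x lM) => //.
- by move=> _; exact: lM.1.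
- move=> r r0; apply: nearW => u' t tT y A mA; rewrite subrr normr0; exact: ltW.
Qed.

Lemma coupling_space_continuous M x t : lipschitz_flow M -> t \in `[0, T] -> continuous (Q x (M t)).
Proof.
move=> lM tT u; apply/cvgrPdist_lt => e e0; have := coupling_near x u lM e0.
by apply: filterS => u' /(_ t tT); rewrite distrC.
Qed.

Lemma coupling_time_continuous M x u : lipschitz_flow M -> icontinuous T (fun t => Q x (M t) u).
Proof.
move=> [PM [B B0 MB]] t; have cT := clamp_itv t T0'.
apply/cvgrPdist_lt => e e0; have [eta eta0 near_u] := coupling_tvclose x u bQ (PM _ cT) e0.
have B1 : 0 < B + 1 by rewrite ltr_wpDl.
have r3 : 0 < eta / (B + 1) by rewrite divr_gt0.
have /cvgrPdist_le/(_ _ r3) := @clamp_continuous R T t.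
apply: filterS => s; rewrite distrC ler_pdivlMr// => h.
rewrite distrC /=; apply: (nbhs_singleton near_u _ (PM _ (clamp_itv s T0'))).
rewrite distrC in h.
apply: tvclose_le (MB _ _ (clamp_itv s T0') cT).
by apply: le_trans h; rewrite mulrC ler_wpM2l// lerDl.
Qed.

End measure_flows.

Section coupled_data.
Context {R : realType} {d : nat} {U : pmetricType R}.
Local Notation Sigma := 'I_d.+1.
Variables (mu : probability (borel U) R) (T CF : R).
Hypothesis T0 : 0 < T.
Hypothesis CF0 : 0 <= CF.
Implicit Types (M : R -> prob_US d U).
Let TT : T \in `[0, T]. Proof. by rewrite in_itv /= lexx ltW. Qed.

Lemma average_data (f_ : nat -> R -> Sigma -> U -> R) (g_ : nat -> Sigma -> U -> R) n :
  (forall i, (i < n)%N -> continuous_data T CF (f_ i) (g_ i)) ->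
  continuous_data T CF (fun t x u => average (fun i => f_ i t x u) n) (fun x u => average (fun i => g_ i x u) n).
Proof.
move=> H; split.
- move=> u; split => [t x tT|x]; apply: average_le => // i /H [h _ _ _].
    exact: (h u).1.
  exact: (h u).2.
- move=> u x; apply: icontinuousM; last exact: icontinuous_cst.
  by apply: icontinuous_sum => i; have [_ h _ _] := H i (ltn_ord i); exact: h.
- move=> x u e e0; have e2 : 0 < e / 2 by rewrite divr_gt0.
  have : \forall u' \near u, forall i : 'I_n, forall t, t \in `[0, T] -> `|f_ i t x u' - f_ i t x u| < e / 2.
    by apply: filter_forall => i; have [_ _ h _] := H i (ltn_ord i); exact: h.
  apply: filterS => u' h t tT; rewrite -averageB.
  apply: (@le_lt_trans _ _ (e / 2)); last by lra.
  apply: average_le => [|i ni]; first exact: ltW.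
  exact: ltW (h (Ordinal ni) t tT).
- move=> x u; apply: cvgM; last exact: cvg_cst.
  by apply: cvg_fin_sum => i; have [_ _ _ h] := H i (ltn_ord i); exact: h.
Qed.

Variables F G : Sigma -> prob_US d U -> U -> R.
Hypothesis bF : bounded_continuous_coupling mu F.
Hypothesis bG : bounded_continuous_coupling mu G.
Hypothesis FCF : forall x m u, `|F x m u| <= CF.
Hypothesis GCF : forall x m u, `|G x m u| <= CF.

Lemma flow_data M : lipschitz_flow mu T M ->
  continuous_data T CF (fun t x u => F x (M t) u) (fun x u => G x (M T) u).
Proof.
move=> lM; split.
- by move=> u; split => *.
- by move=> u x; exact: (coupling_time_continuous T0 bF lM).
- by move=> x u e e0; exact: (coupling_near T0 bF).
- by move=> x; exact: (coupling_space_continuous T0 bG lM TT).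
Qed.

Hypothesis mF : monotone_coupling mu F.
Hypothesis mG : monotone_coupling mu G.

(** Monotonicity at each time, integrated in time by [mean_prim]. *)
Lemma monotone_gain M M' (m m' : R -> Sigma -> U -> R) :
  lipschitz_flow mu T M -> lipschitz_flow mu T M' ->
  (forall t, t \in `[0, T] -> disintegration mu (M t) (m t)) ->
  (forall t, t \in `[0, T] -> disintegration mu (M' t) (m' t)) ->
  (forall x u, icontinuous T (fun t => m t x u)) -> (forall x u, icontinuous T (fun t => m' t x u)) ->
  let h u := gain T (fun t x => F x (M t) u - F x (M' t) u) (fun x => G x (M T) u - G x (M' T) u)
    (fun t x => m t x u - m' t x u) in
  bounded_measurable (h : borel U -> R) /\ 0 <= mean mu (h : borel U -> R).
Proof.
move=> lM lM' dm dm' cm cm' /=.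
have bk t x : t \in `[0, T] -> bounded_measurable ((fun u => m t x u - m' t x u) : borel U -> R).
  move=> tT; have [a1 a2 _] := dm t tT; have [b1 b2 _] := dm' t tT.
  by apply: bmB; exact: kernel_bm.
have bQ Q t x : bounded_continuous_coupling mu Q -> t \in `[0, T] ->
    bounded_measurable ((fun u => Q x (M t) u - Q x (M' t) u) : borel U -> R).
  move=> hQ tT; have [[C QC] _] := hQ; apply: bmB; (split; last by exists C => u; exact: QC);
    by apply: continuous_borel; first [exact: (coupling_space_continuous T0 hQ lM tT)|exact: (coupling_space_continuous T0 hQ lM' tT)].
pose k (Q : Sigma -> prob_US d U -> U -> R) t (u : borel U) : R :=
  \sum_x (m t x u - m' t x u) * (Q x (M t) u - Q x (M' t) u).
have bmk Q t : bounded_continuous_coupling mu Q -> t \in `[0, T] -> bounded_measurable (k Q t).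
  by move=> hQ tT; apply: bm_sum => x; apply: bmM; [exact: bk|exact: bQ].
have k0 Q t : bounded_continuous_coupling mu Q -> monotone_coupling mu Q -> t \in `[0, T] -> 0 <= mean mu (k Q t).
  move=> hQ mQ tT; rewrite mean_sum => [|x]; last by apply: bmM; [exact: bk|exact: bQ].
  have := mQ _ _ _ _ (lM.1 t tT) (lM'.1 t tT) (dm t tT) (dm' t tT).
  rewrite (eq_bigr (fun x => mean mu ((fun u => (m t x u - m' t x u) * (Q x (M t) u - Q x (M' t) u)) : borel U -> R)))//.
  by move=> x _; apply: eq_Rintegral => u _; rewrite mulrC.
have kC t u : t \in `[0, T] -> `|k F t u| <= \sum_(x : Sigma) 2 * (2 * CF).
  move=> tT; apply: (le_trans (ler_norm_sum _ _ _)); apply: ler_sum => x _.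
  have [_ p _] := dm t tT; have [_ p' _] := dm' t tT.
  rewrite normrM; apply: ler_pM => //; apply: (le_trans (ler_normB _ _)).
    have := prob_vector_le1 x (p u); have := prob_vector_le1 x (p' u); lra.
  have := FCF x (M t) u; have := FCF x (M' t) u; lra.
have ck u : icontinuous T ((k F) ^~ u).
  apply: icontinuous_sum => x; apply: icontinuousM; apply: icontinuousB => //.
    exact: (coupling_time_continuous T0 bF lM).
  exact: (coupling_time_continuous T0 bF lM').
have [b1 b2] := mean_prim mu T0 ck (fun t tT => (bmk F t bF tT).1) kC.
split; first by apply: bmD => //; exact: bmk.
rewrite meanD//; last exact: bmk.
by apply: addr_ge0; [apply: b2 => t tT; exact: k0|exact: k0].
Qed.

End coupled_data.

(** * The equilibrium *)

Section mean_of_averages.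
Context {dd : measure_display} {X : measurableType dd} {R : realType} (mu : probability X R).

Lemma mean_sum_div n (h : nat -> X -> R) (c : R) : (forall i, bounded_measurable (h i)) ->
  bounded_measurable (fun u => (\sum_(i < n) h i u) / c) /\
  mean mu (fun u => (\sum_(i < n) h i u) / c) = (\sum_(i < n) mean mu (h i)) / c.
Proof.
move=> bh; have E : (fun u => (\sum_(i < n) h i u) / c) = (fun u => c^-1 * \sum_(i < n) h i u).
  by apply/funext => u; rewrite mulrC.
have bs : bounded_measurable (fun u => \sum_(i < n) h i u) by exact: bm_sum.
by rewrite E; split; [exact: bmZ|rewrite meanZ// mean_sum// mulrC].
Qed.

(** Young's inequality in the place of Cauchy-Schwarz. *)
Lemma mean_norm_le (h : X -> R) e : bounded_measurable h -> 0 < e ->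
  mean mu (fun u => h u ^+ 2) <= e ^+ 2 -> mean mu (fun u => `|h u|) <= e.
Proof.
move=> bh e0 He; have bn := bm_norm bh; have bs := bm_sqr bh.
have : mean mu (fun u => `|h u|) <= mean mu (fun u => e / 2 + (2 * e)^-1 * h u ^+ 2).
  apply: mean_le => //; first by apply: bmD; [exact: bm_cst|exact: bmZ].
  move=> u; have : 0 <= (`|h u| - e) ^+ 2 / (2 * e) by rewrite divr_ge0 ?sqr_ge0// mulr_ge0// ltW.
  rewrite (_ : _ / _ = e / 2 + (2 * e)^-1 * h u ^+ 2 - `|h u|); first lra.
  by rewrite sqrrB real_normK ?num_real//; field; rewrite gt_eqF.
rewrite meanD//; [|exact: bm_cst|exact: bmZ].
rewrite mean_cst meanZ// => /le_trans; apply.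
rewrite [leRHS](_ : e = e / 2 + (2 * e)^-1 * e ^+ 2); last by field; rewrite gt_eqF.
by rewrite lerD2l ler_wpM2l// invr_ge0 mulr_ge0// ltW.
Qed.

End mean_of_averages.

Section total_variation_limit.
Context {R : realType} {d : nat} {U : pmetricType R}.
Local Notation E := (U * states d)%type.
Variable mu : probability (borel U) R.
Implicit Types (m : prob_US d U).

Local Notation layer_mass m x A := (fine ((m : probability (borel E) R) (@layer R d U x A))).

Lemma Pmu_layers m (A : set (borel U)) : Pmu mu m -> measurable A -> \sum_x layer_mass m x A = fine (mu A).
Proof.
move=> Pm mA; rewrite -(Pm A mA) measure_layers; last exact: measurable_cylinder.
rewrite -sum_fine//; last first.
  move=> x _; apply: fin_num_measure; apply: measurable_layer; apply: measurable_slice.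
  exact: measurable_cylinder.
apply: eq_bigr => x _; congr (fine ((m : probability _ R) (layer x _))).
by apply/seteqP; split => u // [].
Qed.

(** The limits of the masses form a finitely additive set function dominated by [mu],
    to which [measure_of_layers] applies. *)
Lemma tv_limit (m_ : nat -> prob_US d U) : (forall n, Pmu mu (m_ n)) ->
  (forall e, 0 < e -> exists N0, forall N K, (N0 <= N)%N -> (N0 <= K)%N -> tvclose (m_ N) (m_ K) e) ->
  exists m, Pmu mu m /\ forall x (A : set (borel U)), measurable A -> layer_mass (m_ n) x A @[n --> \oo] --> layer_mass m x A.
Proof.
move=> Pm cm; pose nu x (A : set (borel U)) : R := lim (layer_mass (m_ n) x A @[n --> \oo]).
have cnu x (A : set (borel U)) : measurable A -> layer_mass (m_ n) x A @[n --> \oo] --> nu x A.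
  move=> mA; apply: cauchy_cvg; apply: cauchy_exP => e e0.
  have e2 : 0 < e / 2 by rewrite divr_gt0.
  have [N0 H] := cm _ e2; exists (layer_mass (m_ N0) x A); exists N0 => // n /= N0n.
  rewrite /ball /=; apply: (le_lt_trans (H N0 n (leqnn _) N0n x A mA)); lra.
have sumnu (A : set (borel U)) : measurable A -> \sum_x nu x A = fine (mu A).
  move=> mA; have h : \sum_x layer_mass (m_ n) x A @[n --> \oo] --> \sum_x nu x A.
    by apply: cvg_fin_sum => x; exact: cnu.
  apply: (cvg_unique (@Rhausdorff R)) h _.
  rewrite (_ : (fun n => _) = (fun _ => fine (mu A))); first exact: cvg_cst.
  by apply/funext => n; exact: Pmu_layers.
have [|||m Hm] := @measure_of_layers R d U mu nu.
- move=> x A mA; rewrite -(cvg_lim (@Rhausdorff R) (cnu x A mA)); apply: limr_ge.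
    by apply/cvg_ex; exists (nu x A); exact: cnu.
  by apply: nearW => n; exact: fine_ge0.
- move=> x A A' mA mA' AA'; apply: (cvg_unique (@Rhausdorff R)) (cnu x _ (measurableU _ _ mA mA')) _.
  have E n : layer_mass (m_ n) x (A `|` A') = layer_mass (m_ n) x A + layer_mass (m_ n) x A'.
    have -> : @layer R d U x (A `|` A') = @layer R d U x A `|` @layer R d U x A'.
      by apply/seteqP; split => [[u y] /= [[a|a] b]|[u y] /= [[a b]|[a b]]]; [left|right|split=> //; left|split=> //; right].
    rewrite measureU ?fineD ?fin_num_measure//; try exact: measurable_layer.
    apply/seteqP; split => // -[u y] /= [[a _] [a' _]].
    by have : (A `&` A') u by []; rewrite AA'.
  have h := cvgD (cnu x A mA) (cnu x A' mA'); rewrite /= in h *.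
  by under eq_fun do rewrite E; exact: h.
- by move=> A mA; rewrite sumnu// fineK// fin_num_measure.
exists m; split => [|x A mA]; last by rewrite Hm//; exact: cnu.
apply: layers_Pmu => A mA.
rewrite -[RHS]fineK ?fin_num_measure// (eq_bigr (fun x => (nu x A)%:E)); last by move=> x _; exact: Hm.
by rewrite sumEFin sumnu.
Qed.

Lemma tvclose_limit (m_ m'_ : nat -> prob_US d U) m m' e :
  (forall x (A : set (borel U)), measurable A -> layer_mass (m_ n) x A @[n --> \oo] --> layer_mass m x A) ->
  (forall x (A : set (borel U)), measurable A -> layer_mass (m'_ n) x A @[n --> \oo] --> layer_mass m' x A) ->
  (\forall n \near \oo, tvclose (m_ n) (m'_ n) e) -> tvclose m m' e.
Proof.
move=> cm cm' H x A mA.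
have h : `|layer_mass (m_ n) x A - layer_mass (m'_ n) x A| @[n --> \oo] --> `|layer_mass m x A - layer_mass m' x A|.
  by apply: cvg_norm; apply: cvgB; [exact: cm|exact: cm'].
rewrite -(cvg_lim (@Rhausdorff R) h); apply: limr_le; first by apply/cvg_ex; eexists; exact: h.
by apply: filterS H => n; exact.
Qed.

Lemma tvclose_eq m m' (B : set (borel E)) : (forall e, 0 < e -> tvclose m m' e) -> measurable B ->
  (m' : probability (borel E) R) B = (m : probability (borel E) R) B.
Proof.
move=> H mB; rewrite !measure_layers//; apply: eq_bigr => x _.
have ml := measurable_layer x (measurable_slice x mB).
rewrite -[LHS]fineK ?fin_num_measure// -[RHS]fineK ?fin_num_measure//; congr EFin.
apply/eqP; rewrite eq_sym -subr_eq0 -normr_le0; apply/ler_addgt0Pl => e e0; rewrite addr0.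
by apply: H => //; exact: measurable_slice.
Qed.

End total_variation_limit.

Section equilibrium.
Context {R : realType} {d : nat} {U : pmetricType R}.
Local Notation Sigma := 'I_d.+1.
Local Notation vec := 'rV[R]_d.+1.
Variables (L : Sigma -> vec -> U -> R) (gam CL T CF : R).
Hypothesis rc : regular_control L gam CL.
Hypothesis T0 : 0 < T.
Hypothesis CF0 : 0 < CF.
Variables (mu : probability (borel U) R) (F G : Sigma -> prob_US d U -> U -> R) (m0 : Sigma -> U -> R).
Hypothesis bF : bounded_continuous_coupling mu F.
Hypothesis bG : bounded_continuous_coupling mu G.
Hypothesis FCF : forall x m u, `|F x m u| <= CF.
Hypothesis GCF : forall x m u, `|G x m u| <= CF.
Hypothesis mF : monotone_coupling mu F.
Hypothesis mG : monotone_coupling mu G.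
Hypothesis m0_measurable : forall x, measurable_fun [set: borel U] (m0 x : borel U -> R).
Hypothesis m0_prob : forall u, prob_vector (m0 ^~ u).

Let T0' : 0 <= T. Proof. exact: ltW. Qed.
Let CF0' : 0 <= CF. Proof. exact: ltW. Qed.
Let TT : T \in `[0, T]. Proof. by rewrite in_itv /= lexx ltW. Qed.
Local Notation data := (coupling_data T CF).

(** A variant of fictitious play in which the data are averaged rather than the
    measures, so that the bilinearity of [flow_duality] in the data can be used. *)
Definition leaders (V_ : nat -> R -> Sigma -> U -> R) (M_ : nat -> R -> prob_US d U)
    (m_ : nat -> R -> Sigma -> U -> R) :=
  [/\ forall n, lipschitz_flow mu T (M_ n),
      forall n t, t \in `[0, T] -> disintegration mu (M_ n t) (m_ n t),
      forall n u, hjb L T u (fun t x => average (fun i => F x (M_ i t) u) n)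
        (fun x => average (fun i => G x (M_ i T) u) n) (fun t x => V_ n t x u) &
      forall n u, kolmogorov L T u (fun t x => V_ n t x u) (m0 ^~ u) (fun t x => m_ n t x u)].

(** Integrated in [u], the mixed term of [leader_regret] is nonnegative by
    monotonicity. So the answers [N] and [K] are both close, on average, to the
    answers [n < N], through which they are compared. *)
Lemma leaders_cauchy V_ M_ m_ e : leaders V_ M_ m_ -> 0 < e ->
  exists N0, forall N K t x, (N0 <= N)%N -> (N0 <= K)%N -> t \in `[0, T] ->
  mean mu ((fun u => `|m_ N t x u - m_ K t x u|) : borel U -> R) <= e.
Proof.
move=> [lM dm hV hm] e0; have [kap k0 [C HC]] := leader_regret rc T0 CF0.
have bm n t x : t \in `[0, T] -> bounded_measurable (m_ n t x : borel U -> R).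
  by move=> tT; have [a1 a2 _] := dm n t tT; exact: kernel_bm.
pose D n N t : borel U -> R := fun u => kap * \sum_x (m_ n t x u - m_ N t x u) ^+ 2.
have bD n N t : t \in `[0, T] -> bounded_measurable (D n N t).
  by move=> tT; apply: bmZ; apply: bm_sum => x; apply: bm_sqr; apply: bmB; exact: bm.
pose dn n N t := mean mu (D n N t).
have dn0 n N t : 0 <= dn n N t.
  by apply: mean_ge0 => u; rewrite mulr_ge0 ?(ltW k0)// sumr_ge0// => x _; exact: sqr_ge0.
pose h := average (fun n => n.+1%:R^-1 : R).
have cm n x u : icontinuous T (fun t => m_ n t x u) .
  exact: (kolmogorov_icontinuous T0 (hm n u)).
have cF n x u : icontinuous T (fun t => F x (M_ n t) u) .
  exact: (coupling_time_continuous T0 bF (lM n)).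
have main N K t : (0 < N)%N -> (0 < K)%N -> t \in `[0, T] ->
    (\sum_(n < K) dn n N t) / K%:R + (\sum_(n < N) dn n K t) / N%:R <= C * (h N + h K).
  move=> N0 K0 tT.
  pose g i k : borel U -> R := fun u => gain T (fun t x => F x (M_ i t) u - F x (M_ k t) u)
    (fun x => G x (M_ i T) u - G x (M_ k T) u) (fun t x => m_ i t x u - m_ k t x u).
  have mg i k : bounded_measurable (g i k) /\ 0 <= mean mu (g i k).
    by apply: (monotone_gain T0 bF bG FCF mF mG (lM i) (lM k) (dm i) (dm k)).
  have [b1 e1] := mean_sum_div mu K K%:R (fun n => bD n N t tT).
  have [b2 e2] := mean_sum_div mu N N%:R (fun n => bD n K t tT).
  have bg i : bounded_measurable (fun u => \sum_(k < K) g i k u) by apply: bm_sum => k; exact: (mg i k).1.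
  have [b3 e3] := mean_sum_div mu N (N%:R * K%:R) bg.
  have g0 : 0 <= (\sum_(i < N) mean mu (fun u => \sum_(k < K) g i k u)) / (N%:R * K%:R).
    rewrite divr_ge0 ?mulr_ge0// sumr_ge0// => i _; rewrite (mean_sum mu _ (h := fun k : 'I_K => g i k)).
      by apply: sumr_ge0 => k _; exact: (mg i k).2.
    by move=> k; exact: (mg i k).1.
  have := mean_le mu (bmD (bmD b1 b2) b3) (bm_cst (C * (h N + h K))).
  rewrite mean_cst (meanD mu (bmD b1 b2) b3) (meanD mu b1 b2) e1 e2 e3 => H.
  suff /H : forall u, (\sum_(i < K) D i N t u) / K%:R + (\sum_(i < N) D i K t u) / N%:R +
     (\sum_(i < N) \sum_(k < K) g i k u) / (N%:R * K%:R) <= C * (h N + h K) by rewrite /dn; lra.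
  move=> u; apply: (HC u (fun n t x => F x (M_ n t) u) (fun n x => G x (M_ n T) u)
    (fun n t x => V_ n t x u) (fun n t x => m_ n t x u) (m0 ^~ u)) => //.
have tri n N K t : t \in `[0, T] -> dn N K t <= 2 * dn n N t + 2 * dn n K t.
  move=> tT; rewrite -(meanZ mu 2 (bD n N t tT)) -(meanZ mu 2 (bD n K t tT)).
  rewrite -(meanD mu (bmZ 2 (bD n N t tT)) (bmZ 2 (bD n K t tT))).
  apply: mean_le; [exact: bD|by apply: bmD; apply: bmZ; exact: bD|].
  move=> u; rewrite /D !mulrA ![2 * _]mulrC -!mulrA -mulrDr ler_wpM2l ?(ltW k0)//.
  rewrite !mulr_sumr -big_split; apply: ler_sum => x _ /=.
  have := sqr_ge0 ((m_ n t x u - m_ N t x u) + (m_ n t x u - m_ K t x u)).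
  by rewrite !expr2; lra.
have pair N K t : (0 < N)%N -> (0 < K)%N -> t \in `[0, T] -> dn N K t <= C * (4 * h N + 2 * h K).
  move=> N0 K0 tT; have h1 := main N N t N0 N0 tT; have h2 := main N K t N0 K0 tT.
  have Np : 0 < N%:R :> R by rewrite ltr0n.
  have h3 : 0 <= (\sum_(n < K) dn n N t) / K%:R by rewrite divr_ge0// sumr_ge0.
  have : N%:R * dn N K t <= 2 * (\sum_(n < N) dn n N t) + 2 * \sum_(n < N) dn n K t.
    rewrite -[X in X%:R * _](card_ord N) -sum_const !mulr_sumr -big_split.
    by apply: ler_sum => n _; exact: tri.
  rewrite mulrC -ler_pdivlMr// mulrDl -!mulrA; lra.
pose r := kap * e ^+ 2 / (6 * (`|C| + 1)).
have r0 : 0 < r by rewrite !(divr_gt0, mulr_gt0, exprn_gt0)// ltr_wpDl.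
have [N1 _ HN1] := average_harmonic_small r0.
exists N1.+1 => N K t x N1N N1K tT; apply: mean_norm_le => //; first by apply: bmB; exact: bm.
have hN : `|h N| <= r by apply: HN1; exact: ltnW.
have hK : `|h K| <= r by apply: HN1; exact: ltnW.
have b : bounded_measurable ((fun u => (m_ N t x u - m_ K t x u) ^+ 2) : borel U -> R).
  by apply: bm_sqr; apply: bmB; exact: bm.
rewrite -(ler_pM2l k0) -meanZ//.
apply: (@le_trans _ _ (dn N K t)).
  apply: mean_le; [exact: bmZ|exact: bD|move=> u].
  rewrite ler_wpM2l ?(ltW k0)// (bigD1 x)//= lerDl sumr_ge0// => y _; exact: sqr_ge0.
apply: (le_trans (pair N K t (leq_ltn_trans _ N1N) (leq_ltn_trans _ N1K) tT)) => //.
apply: (le_trans (ler_norm _)); rewrite normrM.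
apply: (@le_trans _ _ ((`|C| + 1) * (6 * r))).
  apply: ler_pM => //; first by rewrite lerDl.
  by move: hN hK; rewrite !ler_norml => /andP[? ?] /andP[? ?]; apply/andP; split; lra.
rewrite le_eqVlt; apply/orP; left; apply/eqP; rewrite /r; field.
by rewrite gt_eqF// ltr_wpDl.
Qed.


Lemma kolmogorov_flow_lipschitz : exists2 B, 0 <= B & forall f g V m (M : R -> prob_US d U),
  (forall u, data (fun t x => f t x u) (g ^~ u)) ->
  (forall u, hjb L T u (fun t x => f t x u) (g ^~ u) (fun t x => V t x u)) ->
  (forall u, kolmogorov L T u (fun t x => V t x u) (m0 ^~ u) (fun t x => m t x u)) ->
  (forall t, t \in `[0, T] -> disintegration mu (M t) (m t)) ->
  forall s t, s \in `[0, T] -> t \in `[0, T] -> tvclose (M t) (M s) (B * `|t - s|).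
Proof.
have [B B0 HB] := kolmogorov_lipschitz rc T0 CF0'; exists B => // f g V m M fg hV hm dm s t sT tT.
apply: (tvclose_mean (dm t tT) (dm s sT)) => x.
have [a1 a2 _] := dm t tT; have [b1 b2 _] := dm s sT.
have b : bounded_measurable (fun u : borel U => `|m t x u - m s x u|).
  by apply: bm_norm; apply: bmB; exact: kernel_bm.
rewrite -[leRHS](mean_cst mu); apply: mean_le => //; first exact: bm_cst.
by move=> u; exact: (HB u _ _ _ _ _ (fg u) (hV u) (hm u) (m0_prob u)).
Qed.

Lemma response_flow f g : continuous_data T CF f g -> exists V M m,
  [/\ lipschitz_flow mu T M, forall t, t \in `[0, T] -> disintegration mu (M t) (m t),
      forall u, hjb L T u (fun t x => f t x u) (g ^~ u) (fun t x => V t x u) &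
      forall u, kolmogorov L T u (fun t x => V t x u) (m0 ^~ u) (fun t x => m t x u)].
Proof.
move=> cfg; have [V [m [hV hm mm]]] := best_response rc T0 CF0' m0_measurable cfg.
have [fg _ _ _] := cfg.
have pm t u : t \in `[0, T] -> prob_vector (fun x => m t x u).
  exact: (kolmogorov_prob rc T0 CF0' (fg u) (hV u) (hm u) (m0_prob u)).
have /choice[M hM] : forall t, exists M : prob_US d U, disintegration mu M (m (clamp T t)).
  by move=> t; apply: kernel_measure => [x|u]; [apply: mm|apply: pm]; exact: clamp_itv.
have dM t : t \in `[0, T] -> disintegration mu (M t) (m t).
  by move=> tT; have := hM t; rewrite clamp_id.
exists V, M, m; split => //; split; first by move=> t tT; exact: disintegration_Pmu (dM t tT).
by have [B B0 HB] := kolmogorov_flow_lipschitz; exists B => //; exact: (HB f g V m).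
Qed.

(** Recursion on the sum of the past data. The response is extended to a total
    function, so that the admissibility of the sums can be proved afterwards, by
    strong induction. *)
Lemma leaders_exist : exists V_ M_ m_, leaders V_ M_ m_.
Proof.
pose dataT : Type := ((R -> Sigma -> U -> R) * (Sigma -> U -> R))%type.
pose respT : Type := ((R -> Sigma -> U -> R) * (R -> prob_US d U) * (R -> Sigma -> U -> R))%type.
have [M0 _] := kernel_measure mu m0_measurable m0_prob.
have /choice[Phi hPhi] : forall b : dataT, exists r : respT, continuous_data T CF b.1 b.2 ->
  [/\ lipschitz_flow mu T r.1.2, forall t, t \in `[0, T] -> disintegration mu (r.1.2 t) (r.2 t),
      forall u, hjb L T u (fun t x => b.1 t x u) (b.2 ^~ u) (fun t x => r.1.1 t x u) &
      forall u, kolmogorov L T u (fun t x => r.1.1 t x u) (m0 ^~ u) (fun t x => r.2 t x u)].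
  move=> [f g]; have [cfg|ncfg] := pselect (continuous_data T CF f g).
    by have [V [M [m H]]] := response_flow cfg; exists (V, M, m) => _.
  by exists ((fun _ _ _ => 0), (fun _ => M0 : prob_US d U), (fun _ _ _ => 0)).
pose ave (s : dataT) n : dataT := (fun t x u => s.1 t x u / n%:R, fun x u => s.2 x u / n%:R).
pose S := nat_rect (fun _ => dataT) (fun _ _ _ => 0, fun _ _ => 0) (fun n s =>
  let r := Phi (ave s n) in (fun t x u => s.1 t x u + F x (r.1.2 t) u, fun x u => s.2 x u + G x (r.1.2 T) u)).
pose r n := Phi (ave (S n) n).
have SE n : S n = (fun t x u => \sum_(i < n) F x ((r i).1.2 t) u, fun x u => \sum_(i < n) G x ((r i).1.2 T) u).
  elim: n => [|n IH].
    by rewrite /S /=; congr pair; apply/funext => t; apply/funext => x; try (apply/funext => u); rewrite big_ord0.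
  rewrite [LHS]/= -/(S n) -/(r n) IH /=.
  by congr pair; apply/funext => t; apply/funext => x; try (apply/funext => u); rewrite big_ord_recr.
have aveE n : ave (S n) n = (fun t x u => average (fun i => F x ((r i).1.2 t) u) n,
    fun x u => average (fun i => G x ((r i).1.2 T) u) n) by rewrite SE.
have cd n : continuous_data T CF (ave (S n) n).1 (ave (S n) n).2.
  elim/ltn_ind: n => n IH; rewrite aveE; apply: average_data => // i ni.
  by apply: (flow_data T0 bF bG) => //; have [] := hPhi _ (IH i ni).
exists (fun n => (r n).1.1), (fun n => (r n).1.2), (fun n => (r n).2); split => n.
- by have [] := hPhi _ (cd n).
- by have [] := hPhi _ (cd n).
- by move=> u; have [_ _ /(_ u) h _] := hPhi _ (cd n); move: h; rewrite -/(r n) aveE.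
- by have [_ _ _ h] := hPhi _ (cd n).
Qed.

Lemma leaders_flow_limit V_ M_ m_ : leaders V_ M_ m_ -> exists M, lipschitz_flow mu T M /\
  forall e, 0 < e -> \forall n \near \oo, forall t, t \in `[0, T] -> tvclose (M_ n t) (M t) e.
Proof.
move=> lead; have [lM dm hV hm] := lead.
have cau e : 0 < e -> exists N0, forall N K t, (N0 <= N)%N -> (N0 <= K)%N -> t \in `[0, T] ->
    tvclose (M_ N t) (M_ K t) e.
  move=> e0; have [N0 H] := leaders_cauchy lead e0.
  by exists N0 => N K t NN KN tT; apply: (tvclose_mean (dm N t tT) (dm K t tT)) => x; exact: H.
have /choice[M hM] : forall t, exists M : prob_US d U, t \in `[0, T] -> Pmu mu M /\
    forall x (A : set (borel U)), measurable A -> fine ((M_ n t : probability _ R) (@layer R d U x A)) @[n --> \oo] -->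
       fine ((M : probability _ R) (@layer R d U x A)).
  move=> t; have [tT|] := boolP (t \in `[0, T]); last by exists (M_ 0%N t).
  have [|e e0|M HM] := @tv_limit R d U mu (fun n => M_ n t); last by exists M.
    by move=> n; exact: (lM n).1.
  by have [N0 H] := cau e e0; exists N0 => N K NN KN; exact: H.
have [B B0 HB] := kolmogorov_flow_lipschitz.
exists M; split.
  split; first by move=> t tT; exact: (hM t tT).1.
  exists B => // s t sT tT; apply: tvclose_limit (hM t tT).2 (hM s sT).2 _.
  apply: nearW => n; apply: (HB _ _ _ _ (M_ n) _ (hV n) (hm n) (dm n)) => // u.
  by have [h _ _ _] := average_data CF0' (fun i _ => flow_data T0 bF bG FCF GCF (lM i)) (n := n); exact: h.
move=> e e0; have [N0 H] := cau e e0; exists N0 => // n N0n t tT.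
apply: (tvclose_limit (m_ := fun _ => M_ n t)) (hM t tT).2 _; first by move=> x A mA; exact: cvg_cst.
by exists N0 => // k N0k; exact: H.
Qed.

(** The averaged data converge, uniformly in time, to the data of the limit flow. So
    the answer to the latter is the pointwise limit of the leaders, and dominated
    convergence shows that it disintegrates the limit flow. *)
Lemma equilibrium_exists : exists V M m, mfg_solution L mu T F G m0 V M m.
Proof.
have [V_ [M_ [m_ lead]]] := leaders_exist; have [lM dm hV hm] := lead.
have [M [lMM cM]] := leaders_flow_limit lead.
have cfg := flow_data T0 bF bG FCF GCF lMM; have [fg ft _ _] := cfg.
have [V [m [hVV hmm mm]]] := best_response rc T0 CF0' m0_measurable cfg.
have pm t u : t \in `[0, T] -> prob_vector (fun x => m t x u).
  exact: (kolmogorov_prob rc T0 CF0' (fg u) (hVV u) (hmm u) (m0_prob u)).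
have small Q x u : bounded_continuous_coupling mu Q -> (forall x m u, `|Q x m u| <= CF) ->
    forall e, 0 < e -> \forall n \near \oo, forall t, t \in `[0, T] ->
      `|average (fun i => Q x (M_ i t) u) n - Q x (M t) u| <= e.
  move=> bQ QCF e e0.
  have := @average_uniform R R [set t | t \in `[0, T]] (fun n t => Q x (M_ n t) u - Q x (M t) u) (CF + CF).
  move=> /(_ _ _ e e0) H.
  have {H} : \forall n \near \oo, forall t, [set t | t \in `[0, T]] t -> `|average (fun n => Q x (M_ n t) u - Q x (M t) u) n| <= e.
    apply: H => [n t _|r r0].
      by apply: (le_trans (ler_normB _ _)); apply: lerD.
    have H : \forall n \near \oo, forall t, t \in `[0, T] -> `|Q x (M_ n t) u - Q x (M t) u| < r.
      exact: (@coupling_uniform_near R d U mu T T0 Q bQ nat \oo _ M_ M (fun _ => u) u x lMM (fun n => (lM n).1) cM (cvg_cst _)).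
    by apply: filterS H => n H t tT; apply: ltW; exact: H.
  have n0 : \forall n \near \oo, (0 < n)%N by exists 1%N.
  apply: filterS2 n0 => n n0 H t tT; have := H t tT; rewrite averageB.
  have -> // : average (fun _ => Q x (M t) u) n = Q x (M t) u.
  by rewrite /average sum_const card_ord mulrAC divff ?mul1r// pnatr_eq0 -lt0n.
have cm t x u : t \in `[0, T] -> m_ n t x u @[n --> \oo] --> m t x u.
  move=> tT; apply/cvgrPdist_le => e e0.
  have data_ n : data (fun t x => average (fun i => F x (M_ i t) u) n) (fun x => average (fun i => G x (M_ i T) u) n).
    by have [h _ _ _] := average_data CF0' (fun i _ => flow_data T0 bF bG FCF GCF (lM i)) (n := n); exact: h.
  have cFn y r : 0 < r -> \forall n \near \oo, forall s, s \in `[0, T] ->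
      `|average (fun i => F y (M_ i s) u) n - F y (M s) u| < r.
    move=> r0; have r2 : 0 < r / 2 by rewrite divr_gt0.
    apply: filterS (small F y u bF FCF _ r2) => n h s sT.
    by apply: le_lt_trans (h s sT) _; lra.
  have cGn y : average (fun i => G y (M_ i T) u) n @[n --> \oo] --> G y (M T) u.
    apply/cvgrPdist_le => r r0; apply: filterS (small G y u bG GCF r r0) => n h.
    by rewrite distrC; exact: h.
  have H : \forall n \near \oo, forall t x, t \in `[0, T] -> `|m_ n t x u - m t x u| <= e.
    exact: (@kolmogorov_uniform_cvg R d U L gam CL T CF rc T0 CF0' nat \oo _ (fun _ => u) u (cvg_cst _)
      (fun n t x => average (fun i => F x (M_ i t) u) n) (fun n x => average (fun i => G x (M_ i T) u) n)
      (fun n t x => V_ n t x u) (fun t x => F x (M t) u) (fun x => G x (M T) u) (fun t x => V t x u)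
      data_ (fg u) (fun n => hV n u) (hVV u) cFn cGn _ _ _ (m0_prob u) (fun n => hm n u) (hmm u) e e0).
  by apply: filterS H => n /(_ t x tT); rewrite distrC.
exists V, M, m; split.
- move=> t tT; have PM := lMM.1 t tT; split => //; split; first by move=> x; exact: mm.
    by move=> u; exact: pm.
  move=> x A mA; have bm : bounded_measurable (m t x : borel U -> R).
    by apply: kernel_bm; [move=> y; exact: mm|move=> u; exact: pm].
  rewrite EFin_Rintegral// -[LHS]fineK; last by rewrite fin_num_measure//; exact: measurable_layer.
  congr EFin.
  have c1 : fine ((M_ n t : probability _ R) (@layer R d U x A)) @[n --> \oo] --> fine ((M t : probability _ R) (@layer R d U x A)).
    apply/cvgrPdist_le => e e0; apply: filterS (cM e e0) => n h; rewrite distrC; exact: h.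
  have c2 : \int[mu]_(u in A) m_ n t x u @[n --> \oo] --> \int[mu]_(u in A) m t x u.
    apply: (@mean_cvg _ _ _ mu (fun n => m_ n t x : borel U -> R) (m t x : borel U -> R) 1 A mA) => [n|n u|u].
    - by have [h _ _] := dm n t tT; exact: h.
    - by have [_ q _] := dm n t tT; exact: (prob_vector_le1 x (q u)).
    - exact: cm.
  apply: (cvg_unique (@Rhausdorff R)) c1 _.
  rewrite (_ : (fun n => _) = (fun n => \int[mu]_(u in A) m_ n t x u)) => [|]; first exact: c2.
  by apply/funext => n; exact: (disintegration_layer x (dm n t tT) mA).
- move=> t x u tT; eexists; first exact: (hVV u).2.
  by rewrite opprB addrC.
- by move=> x u; exact: (hVV u).1.
- by move=> t x u tT; exact: (hmm u).2.
- by move=> x u; exact: (hmm u).1.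
Qed.


(** The Lipschitz continuity in total variation of an arbitrary solution is a
    consequence of the Kolmogorov equation. *)
Lemma solution_equations V M m : mfg_solution L mu T F G m0 V M m ->
  [/\ lipschitz_flow mu T M, forall t, t \in `[0, T] -> disintegration mu (M t) (m t),
      forall u, hjb L T u (fun t x => F x (M t) u) (fun x => G x (M T) u) (fun t x => V t x u) &
      forall u, kolmogorov L T u (fun t x => V t x u) (m0 ^~ u) (fun t x => m t x u)].
Proof.
move=> [dM dV VT dm m_0].
have hV u : hjb L T u (fun t x => F x (M t) u) (fun x => G x (M T) u) (fun t x => V t x u).
  split=> [x|t x tT]; first exact: VT.
  by have [dv hd hE] := dV t x u tT; apply: has_derivative_eq hd; rewrite -[LHS]opprK hE; ring.
have hm u : kolmogorov L T u (fun t x => V t x u) (m0 ^~ u) (fun t x => m t x u).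
  by split=> [x|t x tT]; [exact: m_0|exact: dm].
have dis t : t \in `[0, T] -> disintegration mu (M t) (m t) by move=> tT; exact: (dM t tT).2.
split => //; split; first by move=> t tT; exact: (dM t tT).1.
have [B B0 HB] := kolmogorov_flow_lipschitz.
by exists B => //; apply: (HB (fun t x u => F x (M t) u) (fun x u => G x (M T) u) V m) => // u; split.
Qed.

(** [flow_duality] both ways round, summed and integrated in [u]: the initial terms
    cancel and the right-hand side is nonpositive by monotonicity. *)
Lemma equilibrium_unique V M m V' M' m' :
  mfg_solution L mu T F G m0 V M m -> mfg_solution L mu T F G m0 V' M' m' ->
  forall t, t \in `[0, T] ->
  [/\ forall x u, V' t x u = V t x u, forall x u, m' t x u = m t x u &
      forall A : set (borel (U * states d)%type), measurable A ->
        (M' t : probability (borel (U * states d)%type) R) A =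
        (M t : probability (borel (U * states d)%type) R) A].
Proof.
move=> /solution_equations[lM dm hV hm] /solution_equations[lM' dm' hV' hm'].
have [fg ft _ _] := flow_data T0 bF bG FCF GCF lM.
have [fg' ft' _ _] := flow_data T0 bF bG FCF GCF lM'.
have cm x u : icontinuous T (fun t => m t x u) by exact: (kolmogorov_icontinuous T0 (hm u)).
have cm' x u : icontinuous T (fun t => m' t x u) by exact: (kolmogorov_icontinuous T0 (hm' u)).
have [kap k0 Hk] := flow_duality rc T0 CF0'.
have [bh h0] := monotone_gain T0 bF bG FCF mF mG lM lM' dm dm' cm cm'.
have close t e : t \in `[0, T] -> 0 < e -> tvclose (M t) (M' t) e.
  move=> tT e0; apply: (tvclose_mean (dm t tT) (dm' t tT)) => x.
  have b y : bounded_measurable ((fun u => m t y u - m' t y u) : borel U -> R).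
    by have [a1 a2 _] := dm t tT; have [b1 b2 _] := dm' t tT; apply: bmB; exact: kernel_bm.
  apply: mean_norm_le => //; apply: (@le_trans _ _ 0); last exact: sqr_ge0.
  have k2 : 0 < 2 * kap by rewrite mulr_gt0.
  rewrite -(pmulr_rle0 _ k2) -(meanZ mu _ (bm_sqr (b x))).
  apply: (@le_trans _ _ (mean mu (fun u => -1 * gain T (fun t x => F x (M t) u - F x (M' t) u)
      (fun x => G x (M T) u - G x (M' T) u) (fun t x => m t x u - m' t x u)))); last first.
    by rewrite meanZ// mulN1r oppr_le0.
  apply: mean_le => [||u]; [by apply: bmZ; exact: bm_sqr|exact: bmZ|].
  have h1 := Hk u _ _ _ _ _ _ _ _ _ (ft u) (ft' u) (fg u) (fg' u) (hV u) (hV' u) (hm u) (hm' u) (m0_prob u) t tT.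
  have h2 := Hk u _ _ _ _ _ _ _ _ _ (ft' u) (ft u) (fg' u) (fg u) (hV' u) (hV u) (hm' u) (hm u) (m0_prob u) t tT.
  have E1 := gainB T0 (fun x => G x (M' T) u) (fun x => G x (M T) u) (ft' u) (ft u) (cm ^~ u).
  have E2 := gainB T0 (fun x => G x (M T) u) (fun x => G x (M' T) u) (ft u) (ft' u) (cm' ^~ u).
  have E3 := gainB T0 (fun x => G x (M T) u) (fun x => G x (M' T) u) (ft u) (ft' u) (cm ^~ u).
  rewrite gainB_flow//; last by move=> y; exact: icontinuousB.
  rewrite E2 E3; rewrite -/(gain _ _ _ _) E1 in h1; rewrite -/(gain _ _ _ _) E2 in h2.
  have E4 : \sum_y m0 y u * (V 0 y u - V' 0 y u) = - \sum_y m0 y u * (V' 0 y u - V 0 y u).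
    by rewrite -sumrN; apply: eq_bigr => y _; ring.
  have E5 : \sum_y (m' t y u - m t y u) ^+ 2 = \sum_y (m t y u - m' t y u) ^+ 2.
    by apply: eq_bigr => y _; ring.
  have h3 : kap * (m t x u - m' t x u) ^+ 2 <= kap * \sum_y (m t y u - m' t y u) ^+ 2.
    by rewrite ler_wpM2l ?(ltW k0)// (bigD1 x)//= lerDl sumr_ge0// => y _; exact: sqr_ge0.
  by rewrite E4 E5 in h2; lra.
have same Q t x u : bounded_continuous_coupling mu Q -> t \in `[0, T] -> Q x (M' t) u = Q x (M t) u.
  move=> bQ tT; apply/eqP; rewrite -subr_eq0 -normr_le0; apply/ler_addgt0Pl => e e0; rewrite addr0.
  have [eta eta0 near_u] := coupling_tvclose x u bQ (lM.1 t tT) e0.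
  by apply: ltW; apply: (nbhs_singleton near_u _ (lM'.1 t tT)); exact: close.
have VV t x u : t \in `[0, T] -> V' t x u = V t x u.
  move=> tT; have h : hjb L T u (fun t x => F x (M t) u) (fun x => G x (M T) u) (fun t x => V' t x u).
    split=> [y|s y sT]; first by rewrite (hV' u).1 same.
    by have := (hV' u).2 s y sT; rewrite same.
  exact: (hjb_unique rc T0 CF0' (fg u) (hV u) h x tT).
move=> t tT; split => [x u|x u|A mA]; first exact: VV.
  have h : kolmogorov L T u (fun t x => V t x u) (m0 ^~ u) (fun t x => m' t x u).
    by apply: kolmogorov_eq (hm' u) => s y sT; rewrite VV.
  exact: (kolmogorov_unique rc T0 CF0' (fg u) (hV u) (hm u) h x tT).
by apply: tvclose_eq mA => e e0; exact: close.
Qed.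

End equilibrium.

(** * Existence and uniqueness *)

Theorem theorem5 (R : realType) (d : nat) (U : pmetricType R)
    (mu : probability (borel U) R) (T : R)
    (L : 'I_d.+1 -> 'rV[R]_d.+1 -> U -> R)
    (F G : 'I_d.+1 -> prob_US d U -> U -> R)
    (m0 : 'I_d.+1 -> U -> R)
    (T_gt0 : 0 < T)
    (U_compact : compact [set: U])
    (m0_measurable : forall x, measurable_fun [set: borel U] (m0 x : borel U -> R))
    (m0_prob : forall u, prob_vector (m0 ^~ u))
    (HL : strongly_convex_cost L)
    (HF2 : bounded_continuous_coupling mu F) (HG2 : bounded_continuous_coupling mu G)
    (HF3 : monotone_coupling mu F) (HG3 : monotone_coupling mu G) :
  exists (V : R -> 'I_d.+1 -> U -> R) (M : R -> prob_US d U)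
      (m : R -> 'I_d.+1 -> U -> R),
    mfg_solution L mu T F G m0 V M m /\
    forall (V' : R -> 'I_d.+1 -> U -> R) (M' : R -> prob_US d U)
        (m' : R -> 'I_d.+1 -> U -> R),
      mfg_solution L mu T F G m0 V' M' m' ->
      forall t, t \in `[0, T] ->
        [/\ forall x u, V' t x u = V t x u,
            forall x u, m' t x u = m t x u &
            forall A : set (borel (U * states d)%type),
              measurable A ->
              (M' t : probability (borel (U * states d)%type) R) A =
              (M t : probability (borel (U * states d)%type) R) A].
Proof.
have [gam [CL rc]] := strongly_convex_regular U_compact HL.
have [[CF FCF] _] := HF2; have [[CG GCG] _] := HG2.
pose C := `|CF| + `|CG| + 1.
have C0 : 0 < C by rewrite ltr_wpDl// addr_ge0.
have FC x m u : `|F x m u| <= C.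
  by apply: (le_trans (FCF x m u)); have := ler_norm CF; have := normr_ge0 CG; rewrite /C; lra.
have GC x m u : `|G x m u| <= C.
  by apply: (le_trans (GCG x m u)); have := ler_norm CG; have := normr_ge0 CF; rewrite /C; lra.
have [V [M [m sol]]] := equilibrium_exists rc T_gt0 C0 HF2 HG2 FC GC HF3 HG3 m0_measurable m0_prob.
exists V, M, m; split=> // V' M' m' sol' t tT.
exact: (equilibrium_unique rc T_gt0 C0 HF2 HG2 FC GC HF3 HG3 m0_prob sol sol' tT).
Qed.
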